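(* Let $(V_n,\mathbf r_n)$ be a sequence of finite transitive Markov chains with $|V_n|\to\infty$, such that $t_{\mathrm{meet}}(\mathbf r_n)\le C|V_n|$ for some constant $C$ and all $n$, and $t_{\mathrm{rel}}(\mathbf r_n)/t_{\mathrm{meet}}(\mathbf r_n)\to0$. Then for any sequence of times $t_n$ with $t_{\mathrm{rel}}(\mathbf r_n)/t_n\to0$ and $t_n/t_{\mathrm{meet}}(\mathbf r_n)\to0$, \[\lim_{n\to\infty}\frac{|V_n|t_n}{2t_{\mathrm{meet}}(\mathbf r_n)}P_{t_n}=1\qquad\text{and}\qquad\lim_{n\to\infty}t_n\alpha_{t_n}P_{t_n}=1.\]
   Context: A Markov chain $(V,\mathbf r)$ is a continuous-time irreducible Markov chain on a finite or countable set $V$ with symmetric jump rates $r_{x,y}=r_{y,x}\ge0$ ($r_{x,x}=0$); $r(x)=\sum_y r_{x,y}$. It is transitive if for all $u,v$ there is a permutation $\phi$ of $V$ with $\phi(u)=v$ and $r_{\phi(x),\phi(y)}=r_{x,y}$ for all $x,y$; transitive chains are assumed to have $r(x)=1$ for all $x$. Coalescing random walks: initially one particle per state; particles move independently according to $\mathbf r$, and when one jumps onto another they merge. $P_t$ is the probability that a given state is occupied at time $t$ (independent of the state by transitivity). $\tau_{\mathrm{meet}}$ is the first meeting time of two independent walks; $t_{\mathrm{meet}}(\mathbf r)$ is its expectation when both start independently from the uniform distribution. $t_{\mathrm{rel}}(\mathbf r)$ is the inverse of the spectral gap of the generator. With $\nu_x(y)=r_{x,y}/r(x)$, $\alpha_t:=r(x)\mathbb{P}(\tau_{\mathrm{meet}}>t)$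 for walks started at $x$ and at a $\nu_x$-distributed state (independent of $x$ by transitivity). *)

(* Defs.v *)
From HB Require Import structures.
From mathcomp Require Import all_boot all_order all_algebra.
From mathcomp Require Import all_classical all_reals all_analysis.
Set Implicit Arguments. Unset Strict Implicit. Unset Printing Implicit Defensive.
Import Order.TTheory GRing.Theory Num.Theory.
Import numFieldNormedType.Exports.
Local Open Scope classical_set_scope.
Local Open Scope ring_scope.

Section MarkovDefs.
Variable R : realType.

Definition kmul (T : finType) (A B : T -> T -> R) : T -> T -> R :=
  fun x y => \sum_(z : T) A x z * B z y.
Definition kid (T : finType) : T -> T -> R := fun x y => (x == y)%:R.
Definition kpow (T : finType) (A : T -> T -> R) (k : nat) : T -> T -> R :=
  iter k (kmul A) (@kid T).
Definition kexp (T : finType) (A : T -> T -> R) (t : R) : T -> T -> R :=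
  fun x y => limn (fun N => \sum_(k < N) (t ^+ k / (k`!)%:R) * kpow A k x y).

Definition generator (T : finType) (q : T -> T -> R) : T -> T -> R :=
  fun x y => if x == y then - \sum_(z | z != x) q x z else q x y.

Definition rate (T : finType) (r : T -> T -> R) (x : T) : R := \sum_(y : T) r x y.

Definition sym_rates (T : finType) (r : T -> T -> R) : Prop :=
  (forall x y, 0 <= r x y) /\ (forall x y, r x y = r y x) /\ (forall x, r x x = 0).

Definition irreducible (T : finType) (r : T -> T -> R) : Prop :=
  forall x y, connect [rel a b | 0 < r a b] x y.

(* transitivity (with the standing normalization r(x) = 1) *)
Definition transitive_chain (T : finType) (r : T -> T -> R) : Prop :=
  (forall u v, exists phi : T -> T,
     bijective phi /\ phi u = v /\ forall x y, r (phi x) (phi y) = r x y) /\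
  (forall x, rate r x = 1).

(* Coalescing random walks: process of occupied sets. A particle at x jumps to y
   at rate r x y; the new occupied set is (A minus x) plus y (merging if y occupied). *)
Definition coal_rate (T : finType) (r : T -> T -> R) (A B : {set T}) : R :=
  \sum_(x in A) \sum_(y : T) (if B == (A :\ x) :|: [set y] then r x y else 0).

(* P_t : probability that state x is occupied at time t, all states initially occupied *)
Definition setTfin (T : finType) : {set T} := finset.setT.

Definition Pocc (T : finType) (r : T -> T -> R) (x : T) (t : R) : R :=
  \sum_(B : {set T} | x \in B) kexp (generator (coal_rate r)) t (setTfin T) B.

(* Two independent walks, stopped (absorbed) when they meet. *)
Definition pair_rate (T : finType) (r : T -> T -> R) (a b : T * T) : R :=
  if a.1 == a.2 then 0 else
  (if a.2 == b.2 then r a.1 b.1 else 0) + (if a.1 == b.1 then r a.2 b.2 else 0).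

Definition meet_tail (T : finType) (r : T -> T -> R) (x y : T) (t : R) : R :=
  \sum_(b : T * T | b.1 != b.2) kexp (generator (pair_rate r)) t (x, y) b.

(* t_meet = E[tau_meet] with both walks started independently uniform
   = int_0^oo P(tau_meet > t) dt  (finite for irreducible finite chains) *)
Definition tmeet (T : finType) (r : T -> T -> R) : R :=
  fine (\int[lebesgue_measure]_(t in `[0%R, +oo[)
          ((#|T|%:R ^+ 2)^-1 * \sum_(x : T) \sum_(y : T) meet_tail r x y t)%:E)%E.

Definition is_eigenvalue (T : finType) (A : T -> T -> R) (l : R) : Prop :=
  exists f : T -> R, (exists x, f x != 0) /\
    forall x, \sum_(y : T) A x y * f y = l * f x.

Definition spectral_gap (T : finType) (r : T -> T -> R) : R :=
  inf [set l : R | 0 < l /\ is_eigenvalue (fun x y => - generator r x y) l].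

Definition trel (T : finType) (r : T -> T -> R) : R := (spectral_gap r)^-1.

(* alpha_t = r(x) P(tau_meet > t), walks from x and from a nu_x-distributed state *)
Definition alpha (T : finType) (r : T -> T -> R) (x : T) (t : R) : R :=
  rate r x * \sum_(y : T) (r x y / rate r x) * meet_tail r x y t.

End MarkovDefs.

(* Main.v *)
(* Let n = |V|, let rho_t(x,y) = P(x and y are occupied at time t) and P = P_t,
   so that P' = - sum_y r(x,y) rho_t(x,y).

   Duality with the voter model makes distinct sites negatively correlated:
   rho_t(x,y) <= P^2 and rho_t(x,y,z) <= rho_t(x,y) P.  Hence rho is a subsolution
   of the equation of two walks killed at their meeting, while w = P^2 - rho is a
   subsolution of the same equation with source 2 r P^2.  Running these equations
   over a time window of length s gives
     P_{t+s}^2 - P_t^2 (1 - alpha_s) - p_{2s} P_t <= - P'_{t+s} <= alpha_s P_t^2,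
   where p is the return probability; the total mass of w is at most n P because
   the number of particles has nonnegative variance.

   The expected meeting time h, as a function of the starting pair, solves a
   Poisson equation off the diagonal.  Applied to h, the Poincare inequality for
   the product chain yields both 2 t_meet alpha_s / n -> 1 when
   t_rel << s << t_meet, and p_{2s} - 1/n <= (t_meet / n) min(1/s, 4 t_rel / s^2).

   Finally 1/P has speed between 0 and 1.  A first comparison with windows
   proportional to 1/P shows that 1/P_u >= c u; then the windows of fixed length
   s = eps^2 t show that 1/P has speed alpha_s up to a small error on [eps t, t]. *)
Require Import Defs.
From HB Require Import structures.
From mathcomp Require Import all_boot all_order all_algebra.
From mathcomp Require Import all_classical all_reals all_analysis.
From mathcomp Require Import ring lra.
Set Implicit Arguments. Unset Strict Implicit. Unset Printing Implicit Defensive.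
Import Order.TTheory GRing.Theory Num.Theory.
Import numFieldNormedType.Exports.
Local Open Scope classical_set_scope.
Local Open Scope ring_scope.

(** No path space is built: every probability is a sum of entries of a matrix exponential.
    Stochastic comparisons become differential inequalities on a finite set, settled by
    [min_principle]; reversibility and the Markov property become the constancy in time of a
    pairing, [pairing_split].

    The error term p_{2s} P decides the shape of the last part. Relative to P^2 it has size p_{2s} /
    P, and 1/P may be as large as 1 + t. For s = eps^2 t the return bound of order 1/s only gives an
    error of order eps^-2, whereas the one of order t_rel / s^2 gives eps^-4 t_rel / t, which
    vanishes. Moreover a window of length s is useful only where 1/P changes little in proportion,
    that is where s is small against 1/P. Hence a linear lower bound on 1/P must come before the
    fixed windows; it uses windows adapted to 1/P, for which the bound of order 1/s is enough.

    The assumption t_meet <= C n gives alpha >= 1/(4C) at the relevant times, and bounds the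
    coefficient t_meet / n in the return estimates. *)

Section Calculus.
Variable R : realType.
Implicit Types (f g : R -> R) (a b t : R).

(** * Derivative rules and mean value bounds on the real line *)

Lemma is_derive_sumf (T : finType) (P : pred T) (f : T -> R -> R) (t : R) (df : T -> R) :
  (forall i, P i -> is_derive t 1 (f i) (df i)) ->
  is_derive t 1 (fun s => \sum_(i | P i) f i s) (\sum_(i | P i) df i).
Proof.
move=> H; rewrite (_ : (fun s => _) = \sum_(i | P i) f i); last first.
  by apply/funext => s; rewrite fct_sumE.
elim/big_ind2 : _ => //.
- exact: is_derive_cst.
- by move=> *; exact: is_deriveD.
Qed.

Lemma is_derive_prod f g (t df dg : R) :
  is_derive t 1 f df -> is_derive t 1 g dg ->
  is_derive t 1 (fun s => f s * g s) (df * g t + f t * dg).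
Proof.
move=> Hf Hg; have H := is_deriveM Hf Hg.
apply: (@is_derive_eq _ _ _ _ _ _ _ _ H).
by rewrite /GRing.scale /= addrC [g t * _]mulrC.
Qed.

Lemma is_derive_scale c f (t df : R) :
  is_derive t 1 f df -> is_derive t 1 (fun s => c * f s) (c * df).
Proof. by move=> H; exact: (is_deriveZ c H). Qed.

Lemma is_derive_add f g (t df dg : R) :
  is_derive t 1 f df -> is_derive t 1 g dg ->
  is_derive t 1 (fun s => f s + g s) (df + dg).
Proof. by move=> Hf Hg; exact: (is_deriveD Hf Hg). Qed.

Lemma is_derive_sub f g (t df dg : R) :
  is_derive t 1 f df -> is_derive t 1 g dg ->
  is_derive t 1 (fun s => f s - g s) (df - dg).
Proof. by move=> Hf Hg; exact: (is_deriveB Hf Hg). Qed.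

Lemma is_derive_affine f (a b t df : R) :
  is_derive (a * t + b) 1 f df -> is_derive t 1 (fun s => f (a * s + b)) (a * df).
Proof.
move=> Hf.
have H : is_derive t 1 (fun s : R => a * s + b) a.
  have H1 : is_derive t (1:R) (fun s : R => a * s) (a * 1) by apply: is_derive_scale; exact: is_derive_id.
  have := is_derive_add H1 (is_derive_cst b t 1).
  by rewrite mulr1 addr0.
have := @is_derive1_comp _ f (fun s => a * s + b) _ _ _ Hf H.
by rewrite mulrC.
Qed.

Lemma is_derive_inv f (t df : R) : f t != 0 ->
  is_derive t 1 f df -> is_derive t 1 (fun s => (f s)^-1) (- df / f t ^+ 2).
Proof.
move=> ft H; have H' := is_deriveV ft H.
apply: (@is_derive_eq _ _ _ _ _ _ _ _ H').
by rewrite /GRing.scale /= mulNr mulNr mulrC.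
Qed.

Lemma derive_cts f df : (forall t, is_derive t 1 f (df t)) -> continuous f.
Proof.
by move=> H t; apply: differentiable_continuous; apply/derivable1_diffP; case: (H t).
Qed.

Lemma mvt f df a b : a < b -> (forall t, a <= t <= b -> is_derive t 1 f (df t)) ->
  exists2 c, a < c < b & f b - f a = df c * (b - a).
Proof.
move=> ab H.
have [||c cab E] := @MVT R f df a b ab.
- by move=> x; rewrite in_itv => /andP[/ltW ax /ltW xb]; apply: H; rewrite ax.
- apply: derivable_within_continuous => x; rewrite in_itv => xab.
  by case: (H x xab).
by exists c; rewrite // -in_itv.
Qed.

Lemma ge0_derive_le f df a b : a <= b ->
  (forall t, a <= t <= b -> is_derive t 1 f (df t)) ->
  (forall t, a <= t <= b -> 0 <= df t) -> f a <= f b.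
Proof.
rewrite le_eqVlt => /predU1P[->//|ab] H H0.
have [c /andP[ac cb] E] := mvt ab H.
by rewrite -subr_ge0 E mulr_ge0 ?H0 ?subr_ge0 ?ltW // ac.
Qed.

Lemma derive_ge f df a b c : a <= b ->
  (forall t, a <= t <= b -> is_derive t 1 f (df t)) ->
  (forall t, a <= t <= b -> c <= df t) -> c * (b - a) <= f b - f a.
Proof.
rewrite le_eqVlt => /predU1P[->|ab] H H0; first by rewrite !subrr mulr0.
have [d /andP[ad db] ->] := mvt ab H.
by rewrite ler_wpM2r ?subr_ge0 ?H0 ?ltW // ad.
Qed.

Lemma derive_le f df a b c : a <= b ->
  (forall t, a <= t <= b -> is_derive t 1 f (df t)) ->
  (forall t, a <= t <= b -> df t <= c) -> f b - f a <= c * (b - a).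
Proof.
rewrite le_eqVlt => /predU1P[->|ab] H H0; first by rewrite !subrr mulr0.
have [d /andP[ad db] ->] := mvt ab H.
by rewrite ler_wpM2r ?subr_ge0 ?H0 ?ltW // ad.
Qed.

Lemma derive0_const f a b :
  (forall t, is_derive t 1 f 0) -> f a = f b.
Proof.
wlog ab : a b / a <= b.
  by move=> W H; case: (leP a b) => [/W|/ltW /W] h; [|symmetry]; exact: h.
move=> H; apply/eqP; rewrite eq_le; apply/andP; split.
  by apply: (@ge0_derive_le f (fun=> 0)).
rewrite -lerN2; apply: (@ge0_derive_le (fun s => - f s) (fun=> - 0)) => // t _; rewrite oppr0.
Qed.

(** The minimum may sit at the right end [t1], so only increments to the left are available; they
    give the sign of the derivative but not its vanishing. *)
Lemma min_derive_le0 f df (t1 c : R) : 0 < c -> c <= t1 ->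
  is_derive c 1 f df -> (forall s, 0 <= s <= t1 -> f c <= f s) -> df <= 0.
Proof.
move=> c0 ct Hf Hmin; rewrite leNgt; apply/negP => df0.
have Hd : derivable f c 1 by case: Hf.
have E : 'D_1 f c = df by exact: derive_val.
have Hl : h^-1 *: ((f \o shift c) (h *: 1) - f c) @[h --> (0:R)^'] --> df.
  by rewrite -E; exact: Hd.
have Hl' : (\forall h \near (0:R)^', 0 < h^-1 *: ((f \o shift c) (h *: 1) - f c)).
  by apply: cvgr_gt Hl _ df0.
rewrite /dnbhs in Hl'.
move: Hl' => /nbhs_ballP[e /= e0 He].
pose h := - (Num.min e c / 2).
have m0 : 0 < Num.min e c by rewrite lt_min e0.
have h0 : h < 0 by rewrite /h oppr_lt0 divr_gt0.
have me : Num.min e c <= e by rewrite ge_min lexx.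
have mc : Num.min e c <= c by rewrite ge_min lexx orbT.
have := He h; rewrite /ball /= sub0r normrN ltr0_norm // => /(_ _ _).
have A1 : - h < e by rewrite /h opprK; lra.
have A2 : h != 0 by rewrite lt_eqF.
move=> /(_ A1 A2) /=.
rewrite /GRing.scale /= mulr1 => P0.
have : f c <= f (h + c).
  by apply: Hmin; apply/andP; split; rewrite /h; lra.
move=> A3.
have : h^-1 * (f (h + c) - f c) <= 0.
  by rewrite nmulr_rle0 ?invr_lt0 // subr_ge0.
by rewrite leNgt P0.
Qed.

End Calculus.

Local Arguments kpow : simpl never.

(** * Matrix exponentials as power series *)

Lemma cvgn_sum (R : realType) (T : finType) (f : T -> nat -> R) (l : T -> R) :
  (forall i, f i @ \oo --> l i) -> (fun N => \sum_i f i N) @ \oo --> \sum_i l i.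
Proof.
move=> H; rewrite (_ : (fun N => _) = \sum_i f i); last first.
  by apply/funext => N; rewrite fct_sumE.
elim/big_ind2 : _ => // [|*]; [exact: cvg_cst | exact: cvgD].
Qed.

Section Kexp.
Variables (R : realType) (T : finType) (A : T -> T -> R).

Let M : R := \sum_x \sum_y `|A x y|.

Lemma kpow0 x y : kpow A 0 x y = (x == y)%:R.
Proof. by []. Qed.

Lemma kpowS k x y : kpow A k.+1 x y = \sum_z A x z * kpow A k z y.
Proof. by []. Qed.

Lemma kpowSr k x y : kpow A k.+1 x y = \sum_z kpow A k x z * A z y.
Proof.
elim: k x => [|k IH] x.
  rewrite kpowS (bigD1 y) //= big1 ?addr0; last first.
    by move=> z zy; rewrite kpow0 (negbTE zy) mulr0.
  rewrite (bigD1 x) //= big1 ?addr0; last first.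
    by move=> z zx; rewrite kpow0 eq_sym (negbTE zx) mul0r.
  by rewrite !kpow0 !eqxx mulr1 mul1r.
rewrite kpowS; under eq_bigr => z _ do rewrite IH mulr_sumr.
rewrite exchange_big /=; apply: eq_bigr => w _.
by rewrite kpowS mulr_suml; apply: eq_bigr => z _; rewrite mulrA.
Qed.

Lemma kpow_bound k x y : `|kpow A k x y| <= M ^+ k.
Proof.
have M0 : 0 <= M by apply: sumr_ge0 => ? _; apply: sumr_ge0.
elim: k x => [|k IH] x.
  by rewrite expr0 kpow0; case: (x == y); rewrite ?normr1 ?normr0.
rewrite kpowS; apply: le_trans (ler_norm_sum _ _ _) _.
apply: (@le_trans _ _ (\sum_z `|A x z| * M ^+ k)).
  by apply: ler_sum => z _; rewrite normrM ler_wpM2l.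
rewrite -mulr_suml exprS ler_wpM2r ?exprn_ge0 //.
rewrite /M [leRHS](bigD1 x) //= lerDl; apply: sumr_ge0 => ? _; exact: sumr_ge0.
Qed.

(** Coefficients of the [j]-th derivative of the exponential series: differentiation only raises
    [j], see [diffs_coef]. *)
Let coef j x y k : R := kpow A (k + j) x y / k`!%:R.

Let coef_cvg j x y K : cvgn (pseries (coef j x y) K).
Proof.
have M0 : 0 <= M by apply: sumr_ge0 => ? _; apply: sumr_ge0.
apply: normed_cvg.
apply: (@series_le_cvg _ _ (fun k => M ^+ j * exp_coeff (M * `|K|) k)).
- by move=> k; exact: normr_ge0.
- by move=> k; rewrite mulr_ge0 ?exprn_ge0 // exp_coeff_ge0 // mulr_ge0.
- move=> k; rewrite /= /coef /exp_coeff /= !normrM normrX.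
  rewrite normfV normr_nat mulrAC exprMn !mulrA -exprD addnC.
  by rewrite ler_wpM2r // ler_wpM2r // kpow_bound.
- apply: is_cvg_seriesZ; exact: is_cvg_series_exp_coeff.
Qed.

Let diffs_coef j x y : pseries_diffs (coef j x y) = coef j.+1 x y.
Proof.
apply/funext => k; rewrite /pseries_diffs /coef addSnnS factS natrM invfM.
by rewrite mulrCA mulVKf // pnatr_eq0.
Qed.

Let kexpE t x y : kexp A t x y = limn (pseries (coef 0 x y) t).
Proof.
rewrite /kexp; congr (lim (_ @ \oo)); apply/funext => N.
rewrite /pseries /series /= big_mkord; apply: eq_bigr => k _.
by rewrite /coef addn0 mulrAC [t ^+ k * _]mulrC mulrAC.
Qed.

Let is_derive_kexp0 (t : R) x y :
  is_derive t 1 (fun s => kexp A s x y) (limn (pseries (coef 1 x y) t)).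
Proof.
rewrite (_ : (fun s => _) = (fun s => limn (pseries (coef 0 x y) s))); last first.
  by apply/funext => s; exact: kexpE.
rewrite -(diffs_coef 0).
apply: (@pseries_snd_diffs R (coef 0 x y) (`|t| + 1) t).
- exact: coef_cvg.
- by rewrite diffs_coef; exact: coef_cvg.
- by rewrite !diffs_coef; exact: coef_cvg.
- by rewrite [ltRHS]ger0_norm ?addr_ge0 // ltrDl.
Qed.

(** Backward equation, the generator acting on the starting state; [is_derive_kexpr] is the forward
    one, from multiplying the powers on the other side. *)
Lemma is_derive_kexp (t : R) x y :
  is_derive t 1 (fun s => kexp A s x y) (\sum_z A x z * kexp A t z y).
Proof.
apply: (@is_derive_eq _ _ _ _ _ _ _ _ (is_derive_kexp0 t x y)).
apply: cvg_lim => //.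
rewrite (_ : pseries _ _ = (fun N => \sum_z A x z * pseries (coef 0 z y) t N)).
  apply: cvgn_sum => z; rewrite kexpE; apply: cvgMr; exact: coef_cvg.
apply/funext => N; rewrite /pseries /series /=.
under [in RHS]eq_bigr => z _ do rewrite mulr_sumr.
rewrite exchange_big /=; apply: eq_bigr => k _.
rewrite /coef addn1 addn0 kpowS !mulr_suml; apply: eq_bigr => z _.
by rewrite !mulrA.
Qed.

Lemma is_derive_kexpr (t : R) x y :
  is_derive t 1 (fun s => kexp A s x y) (\sum_z kexp A t x z * A z y).
Proof.
apply: (@is_derive_eq _ _ _ _ _ _ _ _ (is_derive_kexp0 t x y)).
apply: cvg_lim => //.
rewrite (_ : pseries _ _ = (fun N => \sum_z pseries (coef 0 x z) t N * A z y)).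
  apply: cvgn_sum => z; rewrite kexpE; apply: cvgMl; exact: coef_cvg.
apply/funext => N; rewrite /pseries /series /=.
under [in RHS]eq_bigr => z _ do rewrite mulr_suml.
rewrite exchange_big /=; apply: eq_bigr => k _.
rewrite /coef addn1 addn0 kpowSr !mulr_suml; apply: eq_bigr => z _.
by rewrite -!mulrA; congr (_ * _); rewrite mulrC -mulrA.
Qed.

Lemma kexp0 x y : kexp A 0 x y = (x == y)%:R.
Proof.
rewrite kexpE; apply: cvg_lim => //.
apply: cvg_near_cst; exists 1%N => // N /= N0.
rewrite /pseries /series /= big_ltn // expr0 big_nat big1 ?addr0.
  by rewrite /coef /= addn0 mulr1 fact0 divr1.
by move=> k /andP[k0 _]; rewrite expr0n gtn_eqF // mulr0.
Qed.

Lemma is_derive_flow (t : R) x (f : T -> R) :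
  is_derive t 1 (fun s => \sum_y kexp A s x y * f y)
    (\sum_z A x z * \sum_y kexp A t z y * f y).
Proof.
have -> : \sum_z A x z * (\sum_y kexp A t z y * f y) =
   \sum_y (\sum_z A x z * kexp A t z y) * f y.
  under eq_bigr => z _ do rewrite mulr_sumr.
  rewrite exchange_big /=; apply: eq_bigr => y _; rewrite mulr_suml.
  by apply: eq_bigr => z _; rewrite mulrA.
apply: is_derive_sumf => y _.
have := is_derive_prod (is_derive_kexp t x y) (is_derive_cst (f y) t 1).
by rewrite mulr0 addr0.
Qed.

Lemma flow0 x (f : T -> R) : \sum_y kexp A 0 x y * f y = f x.
Proof.
rewrite (bigD1 x) //= kexp0 eqxx mul1r big1 ?addr0 // => y yx.
by rewrite kexp0 eq_sym (negbTE yx) mul0r.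
Qed.

End Kexp.

Lemma kpow_map (R : realType) (T : finType) (A : T -> T -> R) (phi : T -> T) k x y :
  bijective phi -> (forall x y, A (phi x) (phi y) = A x y) ->
  kpow A k (phi x) (phi y) = kpow A k x y.
Proof.
move=> bphi HA; elim: k x => [|k IH] x.
  by rewrite !kpow0 (inj_eq (bij_inj bphi)).
rewrite !kpowS (reindex phi) /=; last exact: onW_bij.
by apply: eq_bigr => z _; rewrite HA IH.
Qed.

(** This is how transitivity makes return probabilities, occupation probabilities and [alpha]
    independent of the state. *)
Lemma kexp_map (R : realType) (T : finType) (A : T -> T -> R) (phi : T -> T) t x y :
  bijective phi -> (forall x y, A (phi x) (phi y) = A x y) ->
  kexp A t (phi x) (phi y) = kexp A t x y.
Proof.
move=> bphi HA; rewrite /kexp; congr (lim (_ @ \oo)); apply/funext => N.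
by apply: eq_bigr => k _; rewrite (kpow_map _ _ _ bphi HA).
Qed.

(** * Comparison and duality for linear evolutions on a finite set *)

Section Evolution.
Variables (R : realType) (T : finType).

(* Minimum principle: at a negative minimum over [G] the inequality
   [K * u <= du] forces [exp (- (K + 1) s) * u] to increase. *)
Lemma min_principle (G : pred T) (u du : R -> T -> R) (K t : R) :
  (forall (s : R) x, G x -> is_derive s 1 (u ^~ x) (du s x)) ->
  (forall (s : R) x, 0 <= s -> G x -> u s x < 0 -> (forall y, G y -> u s x <= u s y) ->
     K * u s x <= du s x) ->
  (forall x, G x -> 0 <= u 0 x) -> 0 <= t -> forall x, G x -> 0 <= u t x.
Proof.
move=> Hd Hmin H0 t0 x0 Gx0; rewrite leNgt; apply/negP => ux0.
pose e (s : R) := expR (- (K + 1) * s + 0).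
pose v (s : R) x := e s * u s x.
have Hv (s : R) x : G x -> is_derive s 1 (v ^~ x) (- (K + 1) * e s * u s x + e s * du s x).
  move=> Gx; apply: is_derive_prod; last exact: Hd.
  by apply: is_derive_affine; exact: is_derive_expR.
have e0 (s : R) : 0 < e s by exact: expR_gt0.
(* For each state a minimizing time in [[0, t]]; the least of these finitely many values is a
   minimum over space and time. *)
have /choice[c Hc] x : exists c, G x -> c \in `[0, t] /\ (forall s, s \in `[0, t] -> v c x <= v s x).
  case Gx: (G x); last by exists 0.
  have [|c cI Hc] := @EVT_min R (v ^~ x) 0 t t0; last by exists c.
  apply: derivable_within_continuous => s _.
  by case: (Hv s x Gx).
pose x1 := [arg min_(x < x0 | G x) v (c x) x]%O.
have [Gx1 Hx1] : G x1 /\ (forall y, G y -> v (c x1) x1 <= v (c y) y).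
  by rewrite /x1; case: arg_minP => // i Gi Hi; split.
have /Hc[cI Hcx] := Gx1.
have Hall (s : R) y : G y -> 0 <= s <= t -> v (c x1) x1 <= v s y.
  move=> Gy sI; apply: le_trans (Hx1 y Gy) _.
  by have [_ ->] := Hc y Gy; rewrite ?in_itv.
have vneg : v (c x1) x1 < 0.
  apply: le_lt_trans (Hall t x0 Gx0 _) _; first by rewrite t0 lexx.
  by rewrite /v pmulr_rlt0.
have uneg : u (c x1) x1 < 0 by move: vneg; rewrite /v pmulr_rlt0.
have /andP[c0 ct] : 0 <= c x1 <= t by move: cI; rewrite in_itv.
have cpos : 0 < c x1.
  rewrite lt_neqAle c0 andbT; apply/eqP => cE.
  by move: uneg; rewrite -cE ltNge H0.
have Hd0 := min_derive_le0 cpos ct (Hv (c x1) x1 Gx1) (fun s sI => Hall s x1 Gx1 sI).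
have HK : K * u (c x1) x1 <= du (c x1) x1.
  apply: Hmin => // y Gy.
  have := Hall (c x1) y Gy; rewrite /v c0 ct => /(_ isT).
  by rewrite ler_pM2l.
have : e (c x1) * (du (c x1) x1 - (K + 1) * u (c x1) x1) <= 0.
  by apply: le_trans Hd0; rewrite le_eqVlt; apply/orP; left; apply/eqP; ring.
rewrite pmulr_rle0 // => Hle; lra.
Qed.

(** The derivative in [s] is the difference of the two pairings in the last hypothesis, hence zero
    for a generator symmetric on [D]. This stands in for the semigroup property combined with
    reversibility. *)
Lemma pairing_split (D : pred T) (u du v dv : R -> T -> R) (t s s' : R) :
  (forall (s : R) x, D x -> is_derive s 1 (u ^~ x) (du s x)) ->
  (forall (s : R) x, D x -> is_derive s 1 (v ^~ x) (dv s x)) ->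
  (forall s s', \sum_(x | D x) du s x * v s' x = \sum_(x | D x) u s x * dv s' x) ->
  \sum_(x | D x) u s x * v (t - s) x = \sum_(x | D x) u s' x * v (t - s') x.
Proof.
move=> Hu Hv Hs.
apply: (@derive0_const R (fun s => \sum_(x | D x) u s x * v (t - s) x)) => w.
have : is_derive w 1 (fun s => \sum_(x | D x) u s x * v (t - s) x)
    (\sum_(x | D x) (du w x * v (t - w) x + u w x * - dv (t - w) x)).
  apply: is_derive_sumf => x Dx; apply: is_derive_prod; first exact: Hu.
  rewrite (_ : (fun s => _) = (fun s => v (-1 * s + t) x)); last first.
    by apply/funext => y; congr (v _ x); ring.
  rewrite -[- dv _ _]mulN1r; apply: (@is_derive_affine R (v ^~ x)).
  by rewrite (_ : - 1 * w + t = t - w); [exact: Hv | ring].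
move=> H; apply: (@is_derive_eq _ _ _ _ _ _ _ _ H).
rewrite big_split /= Hs.
by under [X in _ + X]eq_bigr => x _ do rewrite mulrN; rewrite sumrN subrr.
Qed.

End Evolution.

Lemma sum_generator (R : realType) (T : finType) (q : T -> T -> R) (f : T -> R) x :
  \sum_y generator q x y * f y = \sum_y q x y * (f y - f x).
Proof.
rewrite (bigD1 x) //= [RHS](bigD1 x) //= subrr mulr0 add0r /generator eqxx.
rewrite mulNr mulr_suml addrC -sumrB; apply: eq_bigr => y yx.
by rewrite eq_sym (negbTE yx) mulrBr.
Qed.

Lemma sumr_continuous (R : realType) (V : topologicalType) (I : finType) (f : I -> V -> R) :
  (forall i, continuous (f i)) -> continuous (fun v => \sum_i f i v).
Proof.
move=> H; rewrite (_ : (fun v => _) = \sum_i f i); last first.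
  by apply/funext => N; rewrite fct_sumE.
apply: (@big_ind _ (fun g : V -> R => continuous g)) => // [|a b Ha Hb].
  exact: cst_continuous.
by move=> v; apply: continuousD; [exact: Ha | exact: Hb].
Qed.

(** * The Poincare inequality with constant [trel] *)

Section Poincare.
Variables (R : realType) (T : finType) (r : T -> T -> R).
Hypothesis sym_r : sym_rates r.
Hypothesis irr_r : irreducible r.
Hypothesis T_gt1 : (1 < #|T|)%N.
Implicit Types (f g : T -> R).

Let n : R := #|T|%:R.

Definition dirichlet f : R := (\sum_x \sum_y r x y * (f x - f y) ^+ 2) / 2.

Let r_ge0 x y : 0 <= r x y. Proof. by case: sym_r. Qed.
Let r_sym x y : r x y = r y x. Proof. by case: sym_r => _ []. Qed.
Let n_gt1 : 1 < n. Proof. by rewrite ltr1n. Qed.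
Let n_gt0 : 0 < n. Proof. exact: lt_trans n_gt1. Qed.

Definition lap f x : R := \sum_y r x y * (f y - f x).

Lemma sum_lap_pairing f g :
  \sum_x lap f x * g x = - (\sum_x \sum_y r x y * (f x - f y) * (g x - g y)) / 2.
Proof.
have E1 : \sum_x lap f x * g x = \sum_x \sum_y r x y * (f y - f x) * g x.
  by apply: eq_bigr => x _; rewrite mulr_suml.
have E2 : \sum_x lap f x * g x = \sum_x \sum_y r x y * (f x - f y) * g y.
  rewrite E1 exchange_big /=; apply: eq_bigr => x _; apply: eq_bigr => y _.
  by rewrite r_sym.
have : \sum_x lap f x * g x + \sum_x lap f x * g x =
    - (\sum_x \sum_y r x y * (f x - f y) * (g x - g y)).
  rewrite {1}E1 E2 -big_split -sumrN /=; apply: eq_bigr => x _.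
  by rewrite -big_split -sumrN /=; apply: eq_bigr => y _; ring.
by move=> E; lra.
Qed.

Lemma dirichletE f : dirichlet f = - \sum_x lap f x * f x.
Proof.
rewrite sum_lap_pairing mulNr opprK /dirichlet; congr (_ / _).
by apply: eq_bigr => x _; apply: eq_bigr => y _; rewrite expr2 mulrA.
Qed.

Lemma sum_lap_sym f g : \sum_x lap f x * g x = \sum_x f x * lap g x.
Proof.
under [RHS]eq_bigr => x _ do rewrite mulrC.
rewrite !sum_lap_pairing; congr (- _ / _).
by apply: eq_bigr => x _; apply: eq_bigr => y _; ring.
Qed.

Lemma dirichlet_ge0 f : 0 <= dirichlet f.
Proof.
by rewrite divr_ge0 //; do 2![apply: sumr_ge0 => ? _]; rewrite mulr_ge0 // sqr_ge0.
Qed.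

Lemma dirichlet_scale a f : dirichlet (fun x => a * f x) = a ^+ 2 * dirichlet f.
Proof.
rewrite /dirichlet mulrA mulr_sumr; congr (_ / _); apply: eq_bigr => x _.
by rewrite mulr_sumr; apply: eq_bigr => y _; ring.
Qed.

Lemma dirichlet_shift a f : dirichlet (fun x => f x - a) = dirichlet f.
Proof.
congr (_ / _); apply: eq_bigr => x _.
by apply: eq_bigr => y _; congr (_ * _ ^+ 2); ring.
Qed.

Lemma sum_lap f : \sum_x lap f x = 0.
Proof.
have := sum_lap_pairing f (fun=> 1).
under eq_bigr => x _ do rewrite mulr1.
move=> ->; rewrite big1 ?oppr0 ?mul0r // => x _; rewrite big1 // => y _.
by rewrite subrr mulr0.
Qed.

Lemma dirichlet0_const f : dirichlet f = 0 -> forall x y, f x = f y.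
Proof.
move=> E0.
have H x y : 0 < r x y -> f x = f y.
  move=> rxy; move/eqP: E0; rewrite mulf_eq0 invr_eq0 pnatr_eq0 orbF.
  rewrite psumr_eq0; last first.
    by move=> ? _; apply: sumr_ge0 => ? _; rewrite mulr_ge0 // sqr_ge0.
  move=> /allP /(_ x); rewrite mem_index_enum => /(_ isT) /=.
  rewrite psumr_eq0; last by move=> ? _; rewrite mulr_ge0 // sqr_ge0.
  move=> /allP /(_ y); rewrite mem_index_enum => /(_ isT) /=.
  by rewrite mulf_eq0 gt_eqF //= sqrf_eq0 subr_eq0 => /eqP.
move=> x y; have /connectP[p + ->] := irr_r x y.
elim: p x => //= z p IH x /andP[/H -> /IH ->].
by [].
Qed.

(** Functions on [T] as row vectors, where compactness and the extreme value theorem apply. *)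
Let vf (v : 'rV[R]_#|T|) x : R := v ord0 (enum_rank x).
Let fv f : 'rV[R]_#|T| := \row_i f (enum_val i).
Let fvK f : vf (fv f) = f.
Proof. by apply/funext => x; rewrite /vf mxE enum_rankK. Qed.

Let vf_continuous x : continuous (vf^~ x).
Proof. by move=> v; exact: coord_continuous. Qed.

Let sphere := [set v | \sum_x vf v x = 0] `&` [set v | \sum_x vf v x ^+ 2 = 1].

Let compact_sphere : compact sphere.
Proof.
have sq_cont : continuous (fun v => \sum_x vf v x ^+ 2).
  apply: sumr_continuous => x v.
  apply: (@continuous_comp _ _ _ (vf^~ x) (fun a : R => a ^+ 2)).
    exact: vf_continuous.
  exact: exprn_continuous.
refine (@subclosed_compact _ _ [set v : 'rV[R]_#|T| | forall i, `[(-1:R), 1]%classic (v ord0 i)] _ _ _).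
- apply: closedI.
    apply: (@closed_comp _ _ (fun v => \sum_x vf v x) [set 0]).
      by move=> v _; exact: (sumr_continuous vf_continuous).
    exact: closed_eq.
  apply: (@closed_comp _ _ (fun v => \sum_x vf v x ^+ 2) [set 1]).
    by move=> v _; exact: sq_cont.
  exact: closed_eq.
- by refine (@rV_compact R #|T| (fun=> `[(-1:R), 1]%classic) _) => i; exact: segment_compact.
- move=> v [_ /= Hv] i /=; rewrite in_itv /= -ler_norml.
  have : v ord0 i ^+ 2 <= 1.
    rewrite -Hv (bigD1 (enum_val i)) //= /vf enum_valK lerDl.
    by apply: sumr_ge0 => x _; exact: sqr_ge0.
  by rewrite -real_normK ?num_real // expr_le1.
Qed.

Let sphere_nonempty : sphere !=set0.
Proof.
have /card_gt0P[x0 _] : (0 < #|T|)%N by exact: ltn_trans T_gt1.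
pose f x : R := (x == x0)%:R - n^-1.
have S1 : \sum_x f x = 0.
  rewrite sumrB (bigD1 x0) //= eqxx big1 ?addr0; last by move=> x /negbTE ->.
  by rewrite sumr_const -[n^-1 *+ _]mulr_natl mulfV ?subrr // gt_eqF.
have S2 : 0 < \sum_x f x ^+ 2.
  rewrite (bigD1 x0) //= ltr_pwDl //; last by apply: sumr_ge0 => x _; exact: sqr_ge0.
  rewrite exprn_gt0 // /f eqxx subr_gt0 invf_lt1 //.
exists (fv (fun x => (Num.sqrt (\sum_x f x ^+ 2))^-1 * f x)); split; rewrite /= fvK.
  by rewrite -mulr_sumr S1 mulr0.
under eq_bigr => x _ do rewrite exprMn.
by rewrite -mulr_sumr exprVn sqr_sqrtr ?ltW // mulVf // gt_eqF.
Qed.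

(** The Dirichlet form is minimized on the unit sphere of mean-zero functions; both sides being
    quadratic, scaling extends the inequality to every mean-zero [g]. *)
Let rayleigh : exists f, [/\ \sum_x f x = 0, \sum_x f x ^+ 2 = 1 &
  forall g, \sum_x g x = 0 -> dirichlet f * (\sum_x g x ^+ 2) <= dirichlet g].
Proof.
have [|v vS Hv] := @EVT_min_rV R _ (fun v => dirichlet (vf v)) sphere sphere_nonempty compact_sphere.
  apply: continuous_subspaceT.
  rewrite /dirichlet; move=> v; apply: (@continuousM _ _ _ (fun=> 2^-1)); last exact: cst_continuous.
  apply: (sumr_continuous (f := fun x v => \sum_y r x y * (vf v x - vf v y) ^+ 2)) => x.
  apply: (sumr_continuous (f := fun y v => r x y * (vf v x - vf v y) ^+ 2)) => y {}v.
  apply: (@continuousM _ _ (fun=> r x y) (fun v => (vf v x - vf v y) ^+ 2)).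
    exact: cst_continuous.
  apply: (@continuous_comp _ _ _ (fun v => vf v x - vf v y) (fun a : R => a ^+ 2)).
    by apply: continuousB; exact: vf_continuous.
  exact: exprn_continuous.
have {vS} [/= v0 v1] : sphere v by rewrite inE in vS.
exists (vf v); split => // g g0.
have [|gn] := leP (\sum_x g x ^+ 2) 0.
  move=> Hg; apply: le_trans (dirichlet_ge0 g).
  by rewrite mulr_ge0_le0 ?dirichlet_ge0.
pose a := (Num.sqrt (\sum_x g x ^+ 2))^-1.
have a2 : a ^+ 2 = (\sum_x g x ^+ 2)^-1 by rewrite exprVn sqr_sqrtr // ltW.
have := Hv (fv (fun x => a * g x)); rewrite fvK dirichlet_scale a2.
rewrite ler_pdivlMl // mulrC; apply; rewrite inE; split; rewrite /= fvK.
  by rewrite -mulr_sumr g0 mulr0.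
under eq_bigr => x _ do rewrite exprMn.
by rewrite -mulr_sumr a2 mulVf // gt_eqF.
Qed.

Lemma sum_sqr_center f : \sum_x (f x - (\sum_x f x) / n) ^+ 2 =
  \sum_x f x ^+ 2 - (\sum_x f x) ^+ 2 / n.
Proof.
set s := \sum_x f x.
under eq_bigr => x _ do rewrite sqrrB.
rewrite big_split sumrB /= sumr_const -[_ *+ #|T|]mulr_natl -/n.
under [X in _ - X]eq_bigr => x _ do rewrite -mulr_natl mulrCA.
rewrite -mulr_suml -/s.
by field; rewrite gt_eqF.
Qed.

(** The infimum of the positive eigenvalues is identified with the Rayleigh minimum [l]: the
    minimizer is an eigenfunction, and conversely an eigenfunction with positive eigenvalue has mean
    zero, so its eigenvalue is at least [l]. *)
Lemma spectral_gap_poincare : 0 < spectral_gap r /\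
  (forall f, spectral_gap r * (\sum_x f x ^+ 2 - (\sum_x f x) ^+ 2 / n) <= dirichlet f).
Proof.
have [f [f0 f1 Hf]] := rayleigh.
set l := dirichlet f in Hf.
have l0 : 0 < l.
  rewrite lt_neqAle dirichlet_ge0 andbT eq_sym; apply/eqP => /dirichlet0_const fc.
  have /card_gt0P[x0 _] : (0 < #|T|)%N by exact: ltn_trans T_gt1.
  move: f0; under eq_bigr => x _ do rewrite (fc x x0).
  rewrite sumr_const -[_ *+ #|T|]mulr_natl => /eqP; rewrite mulf_eq0 gt_eqF //= => /eqP fo.
  move: f1; under eq_bigr => x _ do rewrite (fc x x0) fo expr0n.
  by rewrite big1 // => /eqP; rewrite eq_sym oner_eq0.
(* First variation: the residual [g] of the eigenvalue equation has mean zero, so [f + e * g]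
   competes with [f]. The resulting inequality [Hq], for all [e], forces [B = 0]. *)
have eig : forall x, - lap f x = l * f x.
  pose g x := - lap f x - l * f x.
  have g0 : \sum_x g x = 0 by rewrite sumrB sumrN sum_lap oppr0 -mulr_sumr f0 mulr0 subrr.
  set B := \sum_x g x ^+ 2.
  pose C := dirichlet g - l * B.
  have C0 : 0 <= C by rewrite subr_ge0 Hf.
  have Hq e : 0 <= 2 * e * B + e ^+ 2 * C.
    pose h x := f x + e * g x.
    have h0 : \sum_x h x = 0 by rewrite big_split /= -mulr_sumr f0 g0 mulr0 addr0.
    suff -> : 2 * e * B + e ^+ 2 * C = dirichlet h - l * \sum_x h x ^+ 2.
      by rewrite subr_ge0; exact: Hf.
    have -> : \sum_x h x ^+ 2 =
        \sum_x f x ^+ 2 + 2 * e * (\sum_x f x * g x) + e ^+ 2 * B.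
      rewrite /B !mulr_sumr -!big_split /=; apply: eq_bigr => x _; rewrite /h; ring.
    have -> : dirichlet h = l + e ^+ 2 * dirichlet g - 2 * e * (\sum_x lap f x * g x).
      rewrite sum_lap_pairing /l /dirichlet.
      have -> : \sum_x \sum_y r x y * (h x - h y) ^+ 2 =
         \sum_x \sum_y r x y * (f x - f y) ^+ 2 +
         e ^+ 2 * (\sum_x \sum_y r x y * (g x - g y) ^+ 2) +
         2 * e * (\sum_x \sum_y r x y * (f x - f y) * (g x - g y)).
        rewrite !mulr_sumr -!big_split /=; apply: eq_bigr => x _.
        rewrite !mulr_sumr -!big_split /=; apply: eq_bigr => y _; rewrite /h; ring.
      by field.
    have EB : B = - (\sum_x lap f x * g x) - l * (\sum_x f x * g x).
      rewrite /B mulr_sumr -sumrN -sumrB; apply: eq_bigr => x _; rewrite /g; ring.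
    rewrite f1 /C {1}EB; ring.
  have B0 : 0 <= B by apply: sumr_ge0 => x _; exact: sqr_ge0.
  have : B = 0.
    apply/eqP; rewrite eq_le B0 andbT leNgt; apply/negP => Bp.
    have C1 : 0 < C + 1 by lra.
    (* A negative [e] small enough for the linear term to win; [C + 1] keeps the denominator
       positive when [C = 0]. *)
    have := Hq (- B / (C + 1)); rewrite leNgt => /negP; apply.
    have -> : 2 * (- B / (C + 1)) * B + (- B / (C + 1)) ^+ 2 * C =
       - (B ^+ 2 / (C + 1) ^+ 2 * (C + 2)) by field; rewrite gt_eqF.
    by rewrite oppr_lt0 mulr_gt0 ?divr_gt0 ?exprn_gt0 //; lra.
  move=> /eqP; rewrite psumr_eq0; last by move=> x _; exact: sqr_ge0.
  move=> /allP Hg x; have := Hg x; rewrite mem_index_enum => /(_ isT) /=.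
  by rewrite sqrf_eq0 subr_eq0 => /eqP.
pose S := [set l : R | 0 < l /\ is_eigenvalue (fun x y => - generator r x y) l].
have opE g x : \sum_y - generator r x y * g y = - lap g x.
  by rewrite /lap -sum_generator -sumrN; apply: eq_bigr => y _; rewrite mulNr.
have lS : S l.
  split=> //; exists f; split; last by move=> x; rewrite opE eig.
  apply/existsP; rewrite -negb_forall; apply/negP => /forallP fz.
  move: f1; rewrite big1; first by move/eqP; rewrite eq_sym oner_eq0.
  by move=> x _; rewrite (eqP (fz x)) expr0n.
have Slb : lbound S l.
  move=> k [k0 [g [[x gx] Hg]]].
  have eg y : - lap g y = k * g y by rewrite -opE Hg.
  have g0 : \sum_y g y = 0.
    have : k * \sum_y g y = 0.
      rewrite mulr_sumr.
      by under eq_bigr => y _ do rewrite -eg; rewrite sumrN sum_lap oppr0.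
    by move/eqP; rewrite mulf_eq0 gt_eqF //= => /eqP.
  have gp : 0 < \sum_y g y ^+ 2.
    rewrite (bigD1 x) //= ltr_pwDl ?exprn_even_gt0 //.
    by apply: sumr_ge0 => y _; exact: sqr_ge0.
  have := Hf g g0; rewrite dirichletE -sumrN.
  have -> : \sum_y - (lap g y * g y) = k * \sum_y g y ^+ 2.
    by rewrite mulr_sumr; apply: eq_bigr => y _; rewrite -mulNr eg; ring.
  by rewrite ler_pM2r.
have gapl : spectral_gap r <= l by apply: ge_inf => //; exists l.
have lgap : l <= spectral_gap r by apply: lb_le_inf => //; exists l.
split; first exact: lt_le_trans lgap.
move=> g; apply: (@le_trans _ _ (l * (\sum_x g x ^+ 2 - (\sum_x g x) ^+ 2 / n))).
  rewrite ler_wpM2r // -sum_sqr_center; apply: sumr_ge0 => x _; exact: sqr_ge0.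
rewrite -sum_sqr_center -(dirichlet_shift ((\sum_x g x) / n) g); apply: Hf.
rewrite sumrB sumr_const -[_ *+ #|T|]mulr_natl -/n mulrC divfK ?subrr //.
by rewrite gt_eqF.
Qed.

Lemma trel_gt0 : 0 < trel r.
Proof. by rewrite invr_gt0; case: spectral_gap_poincare. Qed.

Lemma poincare f : \sum_x f x ^+ 2 - (\sum_x f x) ^+ 2 / n <= trel r * dirichlet f.
Proof.
have [g0 H] := spectral_gap_poincare.
by rewrite /trel ler_pdivlMl.
Qed.

End Poincare.

(** * Covariance under the uniform distribution, and solvability of linear systems *)

Section Covariance.
Variables (R : realType) (X : finType).
Implicit Types (f g : X -> R).

(** This is [#|X|] times the covariance under the uniform distribution. *)
Definition cov f g : R := \sum_x f x * g x - (\sum_x f x) * (\sum_x g x) / #|X|%:R.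

Lemma cauchy_schwarz f g :
  (\sum_x f x * g x) ^+ 2 <= (\sum_x f x ^+ 2) * (\sum_x g x ^+ 2).
Proof.
have : 0 <= \sum_x \sum_y (f x * g y - f y * g x) ^+ 2.
  by do 2![apply: sumr_ge0 => ? _]; exact: sqr_ge0.
have -> : \sum_x \sum_y (f x * g y - f y * g x) ^+ 2 =
   2 * ((\sum_x f x ^+ 2) * (\sum_x g x ^+ 2) - (\sum_x f x * g x) ^+ 2).
  have E1 : (\sum_x f x ^+ 2) * (\sum_x g x ^+ 2) =
      \sum_x \sum_y f x ^+ 2 * g y ^+ 2.
    by rewrite mulr_suml; apply: eq_bigr => x _; rewrite mulr_sumr.
  have E2 : (\sum_x f x ^+ 2) * (\sum_x g x ^+ 2) =
      \sum_x \sum_y f y ^+ 2 * g x ^+ 2.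
    by rewrite E1 exchange_big.
  have E3 : (\sum_x f x * g x) ^+ 2 = \sum_x \sum_y f x * g x * (f y * g y).
    by rewrite expr2 mulr_suml; apply: eq_bigr => x _; rewrite mulr_sumr.
  rewrite mulrBr mulr2n mulrDl !mul1r {1}E1 E2 E3 mulrDl mul1r opprD addrACA.
  rewrite -!sumrB -big_split /=; apply: eq_bigr => x _.
  rewrite -!sumrB -big_split /=; apply: eq_bigr => y _; ring.
by rewrite pmulr_rge0 // subr_ge0.
Qed.

Hypothesis X_gt0 : (0 < #|X|)%N.

Let N_neq0 : (#|X|%:R : R) != 0.
Proof. by rewrite pnatr_eq0 -lt0n. Qed.

Lemma covE f g : cov f g =
  \sum_x (f x - (\sum_x f x) / #|X|%:R) * (g x - (\sum_x g x) / #|X|%:R).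
Proof.
set a := _ / _; set b := _ / _.
under eq_bigr => x _ do rewrite mulrBl !mulrBr.
rewrite !sumrB -mulr_suml -!mulr_sumr sumr_const -[_ *+ #|X|]mulr_natl /cov /a /b.
by field.
Qed.

Lemma cov_ge0 f : 0 <= cov f f.
Proof. by rewrite covE; apply: sumr_ge0 => x _; rewrite -expr2 sqr_ge0. Qed.

Lemma cov_sqr_le f g : cov f g ^+ 2 <= cov f f * cov g g.
Proof. by rewrite !covE; apply: le_trans (cauchy_schwarz _ _) _; rewrite le_eqVlt eqxx. Qed.

Lemma cov0_const f : cov f f <= 0 -> forall x y, f x = f y.
Proof.
rewrite covE => H.
have H1 x : f x = (\sum_x f x) / #|X|%:R.
  have : \sum_x (f x - (\sum_x f x) / #|X|%:R) * (f x - (\sum_x f x) / #|X|%:R) == 0.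
    by rewrite eq_le H; apply: sumr_ge0 => y _; rewrite -expr2 sqr_ge0.
  rewrite psumr_eq0; last by move=> y _; rewrite -expr2 sqr_ge0.
  move=> /allP /(_ x); rewrite mem_index_enum => /(_ isT) /=.
  by rewrite mulf_eq0 orbb subr_eq0 => /eqP.
by move=> x y; rewrite (H1 x) (H1 y).
Qed.

Lemma sum_sqr_le f : (\sum_x f x) ^+ 2 <= #|X|%:R * \sum_x f x ^+ 2.
Proof.
have := cov_ge0 f; rewrite /cov subr_ge0 -expr2.
rewrite ler_pdivrMr ?ltr0n // mulrC => H; apply: le_trans H _.
by rewrite le_eqVlt; apply/orP; left; apply/eqP; congr (_ * _); apply: eq_bigr => x _; rewrite expr2.
Qed.

End Covariance.

(** Serves to obtain expected meeting times from a linear system rather than from integrals. *)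
Lemma linear_solvable (R : realType) (X : finType) (a : X -> X -> R) (g : X -> R) :
  (forall f, (forall x, \sum_y a x y * f y = 0) -> forall x, f x = 0) ->
  exists f, forall x, \sum_y a x y * f y = g x.
Proof.
move=> inj.
pose A : 'M[R]_#|X| := \matrix_(i, j) a (enum_val j) (enum_val i).
have AE (v : 'rV[R]_#|X|) x : (v *m A) ord0 (enum_rank x) =
    \sum_y a x y * v ord0 (enum_rank y).
  rewrite mxE (reindex (@enum_rank X)) /=; last by apply: onW_bij; exact: enum_rank_bij.
  by apply: eq_bigr => y _; rewrite mxE !enum_rankK mulrC.
have Afree : row_free A.
  rewrite -kermx_eq0; apply/eqP/row_matrixP => i; rewrite row0.
  have : row i (kermx A) *m A = 0 by rewrite -row_mul mulmx_ker row0.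
  move=> H; apply/rowP => j; rewrite [RHS]mxE -[j]enum_valK.
  apply: (inj (fun y => row i (kermx A) ord0 (enum_rank y))) => x.
  by rewrite -AE H mxE.
have Aunit : A \in unitmx by rewrite -row_free_unit.
pose v := (\row_i g (enum_val i)) *m invmx A.
exists (fun y => v ord0 (enum_rank y)) => x.
by rewrite -AE /v mulmxKV // mxE enum_rankK.
Qed.

(** * Two independent walks as a chain on pairs *)

Section Pairs.
Variables (R : realType) (T : finType) (r : T -> T -> R).
Hypothesis sym_r : sym_rates r.
Implicit Types (F G : T * T -> R) (p : T * T).

Let r_ge0 x y : 0 <= r x y. Proof. by case: sym_r. Qed.

(** Generator of two walks that ignore each other; the generator of [pair_rate] agrees with it off
    the diagonal and vanishes on the diagonal. *)
Definition plap F p : R :=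
  lap r (fun z => F (z, p.2)) p.1 + lap r (fun z => F (p.1, z)) p.2.

Definition offd p := p.1 != p.2.

Lemma sum_plap_pairing F G : \sum_p plap F p * G p =
  \sum_y \sum_x lap r (fun z => F (z, y)) x * G (x, y) +
  \sum_x \sum_y lap r (fun z => F (x, z)) y * G (x, y).
Proof.
under eq_bigr => p _ do rewrite mulrDl.
rewrite big_split /=; congr (_ + _).
  by rewrite exchange_big /= pair_bigA /=; apply: eq_bigr => -[].
by rewrite pair_bigA /=; apply: eq_bigr => -[].
Qed.

Lemma sum_plap_sym F G : \sum_p plap F p * G p = \sum_p F p * plap G p.
Proof.
under [RHS]eq_bigr => p _ do rewrite mulrC.
rewrite !sum_plap_pairing; congr (_ + _); apply: eq_bigr => y _.
  rewrite (sum_lap_sym sym_r (fun x => F (x, y)) (fun x => G (x, y))).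
  by apply: eq_bigr => x _; rewrite mulrC.
rewrite (sum_lap_sym sym_r (fun x => F (y, x)) (fun x => G (y, x))).
by apply: eq_bigr => x _; rewrite mulrC.
Qed.

Lemma sum_plap F : \sum_p plap F p = 0.
Proof.
have := sum_plap_sym F (fun=> 1).
under eq_bigr => p _ do rewrite mulr1.
move=> ->; rewrite big1 // => p _.
rewrite /plap /lap !big1 ?addr0 ?mulr0 // => z _; by rewrite subrr mulr0.
Qed.

Lemma plapB F G p : plap (fun q => F q - G q) p = plap F p - plap G p.
Proof.
rewrite /plap /lap [in RHS]opprD [RHS]addrACA -!sumrB.
by congr (_ + _); apply: eq_bigr => z _; ring.
Qed.

Lemma plapZ (c : R) F p : plap (fun q => c * F q) p = c * plap F p.
Proof.
rewrite /plap /lap mulrDr !mulr_sumr.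
by congr (_ + _); apply: eq_bigr => z _; ring.
Qed.

Lemma plap_ge0_min F p : (forall q, F p <= F q) -> 0 <= plap F p.
Proof.
case: p => x y H; rewrite addr_ge0 //; apply: sumr_ge0 => z _;
  by rewrite mulr_ge0 // subr_ge0.
Qed.

Lemma sum_pair_generator F p : \sum_q generator (pair_rate r) p q * F q =
  if offd p then plap F p else 0.
Proof.
rewrite sum_generator /pair_rate /offd; case: p => x y /=.
case: eqP => [_|_]; first by rewrite big1 // => q _; rewrite mul0r.
under eq_bigr => q _ do rewrite mulrDl.
rewrite big_split /=; congr (_ + _).
  rewrite (_ : \sum_i _ = \sum_i \sum_j (if y == j then r x i else 0) * (F (i, j) - F (x, y))).
    apply: eq_bigr => i _; rewrite (bigD1 y) //= eqxx big1 ?addr0 // => j /negbTE jy.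
    by rewrite eq_sym jy mul0r.
  by rewrite pair_bigA /=; apply: eq_bigr => -[].
rewrite (_ : \sum_i _ = \sum_i \sum_j (if x == i then r y j else 0) * (F (i, j) - F (x, y))).
  rewrite (bigD1 x) //= eqxx [X in _ + X]big1 ?addr0 // => i /negbTE ix.
  by rewrite big1 // => j _; rewrite eq_sym ix mul0r.
by rewrite pair_bigA /=; apply: eq_bigr => -[].
Qed.

(** Outside [D] the sign is known at all times, so a negative minimum over [D] is a minimum over all
    pairs, and [plap] is nonnegative there. *)
Lemma plap_min_principle (D : pred (T * T)) (u du : R -> T * T -> R) (t : R) :
  (forall (s : R) p, D p -> is_derive s 1 (u ^~ p) (du s p)) ->
  (forall s p, 0 <= s -> D p -> plap (u s) p <= du s p) ->
  (forall s p, 0 <= s -> ~~ D p -> 0 <= u s p) ->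
  (forall p, D p -> 0 <= u 0 p) -> 0 <= t -> forall p, 0 <= u t p.
Proof.
move=> Hd Hle Hoff H0 t0 p.
have [Dp|nDp] := boolP (D p); last exact: Hoff.
apply: (@min_principle R _ D u du 0) => // s q s0 Dq uq Hmin.
rewrite mul0r; apply: le_trans (Hle s q s0 Dq); apply: plap_ge0_min => q'.
by have [/Hmin //|nD] := boolP (D q'); rewrite (le_trans (ltW uq)) // Hoff.
Qed.

Hypothesis irr_r : irreducible r.
Hypothesis T_gt1 : (1 < #|T|)%N.

Let n : R := #|T|%:R.
Let n_gt0 : 0 < n. Proof. by rewrite ltr0n (ltn_trans _ T_gt1). Qed.

Lemma card_pair : #|{: T * T}|%:R = n ^+ 2.
Proof. by rewrite card_prod natrM -expr2. Qed.

Lemma card_pair_gt0 : (0 < #|{: T * T}|)%N.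
Proof. by rewrite card_prod muln_gt0 (ltn_trans _ T_gt1). Qed.

(** Tensorization, without loss in the constant: the variance splits into the one along the first
    coordinate and that of the sums [f], and Cauchy-Schwarz bounds the energy of [f] by the energy
    along the second coordinate. *)
Lemma poincare_pair F : cov F F <= trel r * - \sum_p plap F p * F p.
Proof.
have t0 : 0 < trel r by exact: trel_gt0.
pose f y := \sum_x F (x, y).
have P1 : \sum_y (\sum_x F (x, y) ^+ 2 - f y ^+ 2 / n) <=
    trel r * \sum_y dirichlet r (fun x => F (x, y)).
  by rewrite mulr_sumr; apply: ler_sum => y _; exact: (poincare sym_r irr_r T_gt1).
have P2 : \sum_y f y ^+ 2 - (\sum_y f y) ^+ 2 / n <= trel r * dirichlet r f.
  exact: (poincare sym_r irr_r T_gt1).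
have P3 : dirichlet r f <= n * \sum_x dirichlet r (fun y => F (x, y)).
  rewrite /dirichlet -mulr_suml mulrA ler_pM2r ?invr_gt0 //.
  rewrite [X in n * X]exchange_big /= mulr_sumr; apply: ler_sum => y _.
  rewrite [X in n * X]exchange_big /= mulr_sumr; apply: ler_sum => y' _.
  rewrite -mulr_sumr [leRHS]mulrCA; apply: ler_wpM2l => //; rewrite /f -sumrB.
  by apply: sum_sqr_le; exact: ltn_trans T_gt1.
have E : - \sum_p plap F p * F p = \sum_y dirichlet r (fun x => F (x, y)) +
    \sum_x dirichlet r (fun y => F (x, y)).
  rewrite sum_plap_pairing opprD -!sumrN.
  by congr (_ + _); apply: eq_bigr => x _; rewrite dirichletE.
have E2 : cov F F = \sum_y (\sum_x F (x, y) ^+ 2 - f y ^+ 2 / n) +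
    (\sum_y f y ^+ 2 - (\sum_y f y) ^+ 2 / n) / n.
  have -> : \sum_y (\sum_x F (x, y) ^+ 2 - f y ^+ 2 / n) = \sum_p F p * F p - (\sum_y f y ^+ 2) / n.
    rewrite sumrB mulr_suml exchange_big pair_bigA /=; congr (_ - _).
    by apply: eq_bigr => -[? ?] _; rewrite expr2.
  have -> : \sum_y f y = \sum_p F p.
    by rewrite /f exchange_big pair_bigA /=; apply: eq_bigr => -[].
  by rewrite /cov card_pair; field; rewrite gt_eqF.
rewrite E E2 mulrDr lerD // ler_pdivrMr // (le_trans P2) // -mulrA ler_pM2l //.
by rewrite mulrC.
Qed.

(** The indicator of a point has energy 1 and centred square sum [1 - n^-1], at least one half. The
    bound lets errors of order [1 / t] be absorbed into [trel / t]. *)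
Lemma trel_ge_half : (forall x, rate r x = 1) -> 2^-1 <= trel r.
Proof.
move=> rate1.
have /card_gt0P[x0 _] : (0 < #|T|)%N by exact: ltn_trans T_gt1.
have := poincare sym_r irr_r T_gt1 (fun x => (x == x0)%:R).
have S1 (k : nat) : (0 < k)%N -> \sum_x ((x == x0)%:R : R) ^+ k = 1.
  move=> k0; rewrite (bigD1 x0) //= eqxx expr1n big1 ?addr0 // => x /negbTE ->.
  by rewrite expr0n gtn_eqF.
have := S1 1%N isT; under eq_bigr => x _ do rewrite expr1.
rewrite S1 // => ->.
have L : lap r (fun x => (x == x0)%:R) x0 = -1.
  have [_ [_ r0]] := sym_r.
  transitivity (- rate r x0); last by rewrite rate1.
  rewrite /rate -sumrN; apply: eq_bigr => y _; rewrite eqxx.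
  have [->|_] := eqVneq y x0; first by rewrite r0 mul0r oppr0.
  by rewrite sub0r mulrN mulr1.
have -> : dirichlet r (fun x => (x == x0)%:R) = 1.
  rewrite (dirichletE sym_r) (bigD1 x0) //= eqxx mulr1 L big1 ?addr0 ?opprK //.
  by move=> x /negbTE ->; rewrite mulr0.
rewrite mulr1 expr1n mul1r => H; apply: le_trans H.
have : n^-1 <= 2^-1 by rewrite lef_pV2 ?posrE // ler_nat.
rewrite -/n; lra.
Qed.

(** Injectivity of the system: a solution of the homogeneous one has zero energy, so it is constant
    by the Poincare inequality, and it vanishes on the diagonal. Sign: at a minimum off the diagonal
    [plap h] would be nonnegative instead of -1. *)
Lemma meeting_time_exists : exists h : T * T -> R,
  [/\ forall p, 0 <= h p, forall p, ~~ offd p -> h p = 0 &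
      forall p, offd p -> plap h p = -1].
Proof.
(* The generator has zero rows on the diagonal; the identity added there imposes the boundary value
   0. *)
pose a p q := generator (pair_rate r) p q + ((p == q) && ~~ offd p)%:R.
have aE F p : \sum_q a p q * F q = if offd p then plap F p else F p.
  under eq_bigr => q _ do rewrite mulrDl.
  rewrite big_split /= sum_pair_generator (bigD1 p) //= eqxx /= big1 ?addr0; last first.
    by move=> q /negbTE; rewrite eq_sym => ->; rewrite mul0r.
  by case: ifP => _ /=; rewrite ?mul0r ?addr0 ?mul1r ?add0r.
have [F HF p|h Hh] := @linear_solvable R _ a (fun p => if offd p then -1 else 0).
  have HF' q := etrans (esym (aE F q)) (HF q).
  have : cov F F <= 0.
    apply: le_trans (poincare_pair F) _; rewrite big1 ?oppr0 ?mulr0 // => q _.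
    by have := HF' q; case: ifP => _ ->; rewrite ?mul0r ?mulr0.
  move=> /(cov0_const card_pair_gt0) Fc.
  by rewrite (Fc p (p.1, p.1)); have := HF' (p.1, p.1); rewrite /offd /= eqxx.
have {}Hh p := etrans (esym (aE h p)) (Hh p).
exists h; split; last by move=> p op; have := Hh p; rewrite op.
  move=> p; have [q _ Hq] : exists2 q, true & forall q', h q <= h q'.
    by exists [arg min_(q < p) h q]%O => //; case: arg_minP => // i _ Hi q'; exact: Hi.
  apply: le_trans (Hq p).
  have := Hh q; case: ifP => [oq hq|_ ->//].
  by have := plap_ge0_min Hq; rewrite hq lerNr oppr0 ler10.
by move=> p /negbTE op; have := Hh p; rewrite op.
Qed.

End Pairs.

(** * An abstract estimate of the density of the meeting time *)

Lemma is_derive_uniq (R : realType) (f : R -> R) (t a b : R) :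
  is_derive t 1 f a -> is_derive t 1 f b -> a = b.
Proof. by move=> Ha Hb; rewrite -(@derive_val _ _ _ _ _ _ _ Ha) derive_val. Qed.

(* Here [sg t] stands for the probability that two uniform walks have not met
   by time [t], [m] is the density of their meeting time, and [j t] is the mean
   over uniform starting points of (expected meeting time) * (probability of
   not having met by [t]); [k] is the relaxation time.  By [cov_bound] these two
   functions of the starting points are nearly uncorrelated, which together with
   [j t = tau + O(t)] pins down [1 - sg t] up to a factor close to 1. *)
Section MeanFieldDecay.
Variables (R : realType) (sg m j : R -> R) (tau k : R).
Hypothesis sg' : forall t : R, is_derive t 1 sg (- m t).
Hypothesis j' : forall t : R, is_derive t 1 j (- sg t).
Hypothesis m_anti : forall s t, 0 <= s -> s <= t -> m t <= m s.
Hypothesis m_ge0 : forall s, 0 <= s -> 0 <= m s.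
Hypothesis sg_ge0 : forall s, 0 <= s -> 0 <= sg s.
Hypothesis sg_le1 : forall s, 0 <= s -> sg s <= 1.
Hypothesis j0 : j 0 = tau.
Hypothesis tau_gt0 : 0 < tau.
Hypothesis k_gt0 : 0 < k.
Hypothesis cov_bound : forall s, 0 <= s -> (j s - tau * sg s) ^+ 2 <= k ^+ 2 * tau * m (2 * s).

Let D s := 1 - sg s.

Let D_incr s t : 0 <= s -> s <= t ->
  m t * (t - s) <= D t - D s /\ D t - D s <= m s * (t - s).
Proof.
move=> s0 st; rewrite (_ : D t - D s = sg s - sg t); last by rewrite /D; ring.
split.
  have := @derive_le R sg (fun t => - m t) s t (- m t) st (fun x _ => sg' x).
  move=> H; have : sg t - sg s <= - m t * (t - s); last lra.
  by apply: H => x /andP[sx xt]; rewrite lerN2 m_anti // (le_trans s0).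
have := @derive_ge R sg (fun t => - m t) s t (- m s) st (fun x _ => sg' x).
move=> H; have : - m s * (t - s) <= sg t - sg s; last lra.
by apply: H => x /andP[sx xt]; rewrite lerN2 m_anti.
Qed.

Let D0_ge0 : 0 <= D 0. Proof. by rewrite subr_ge0 sg_le1. Qed.

Let j_bounds s : 0 <= s -> sg s * s <= tau - j s <= s.
Proof.
move=> s0; apply/andP; split.
  have := @derive_le R j (fun t => - sg t) 0 s (- sg s) s0 (fun x _ => j' x).
  rewrite j0 => H; have : j s - tau <= - sg s * (s - 0); last lra.
  apply: H => x /andP[x0 xs]; rewrite lerN2.
  have := D_incr x0 xs; have := m_ge0 s0; rewrite /D.
  have : 0 <= s - x by lra.
  move=> H1 H2; have := mulr_ge0 H2 H1; lra.
have := @derive_ge R j (fun t => - sg t) 0 s (-1) s0 (fun x _ => j' x).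
rewrite j0 => H; have : -1 * (s - 0) <= j s - tau; last lra.
by apply: H => x /andP[x0 xs]; rewrite lerN2 sg_le1.
Qed.

(** The meeting probability by time [s] per unit of time, in units of [1 / tau]; for an exponential
    law of mean [tau] it is close to 1 when [s] is small against [tau]. *)
Let Q s := tau * D s / s.

(** The quotient [(tau - j s) / s] is the mean of [sg] over [[0, s]], so it lies in [[sg s, 1]]. Its
    distance [y] to [Q s] satisfies [s * y = j s - tau * sg s], which is what [cov_bound]
    controls. *)
Lemma meeting_hazard_bounds s : k <= s -> 1 - 3 * (s / tau) - 2 * (k / s) <= Q s <= 1 + 2 * (k / s).
Proof.
move=> ks; have s0 : 0 < s by exact: lt_le_trans ks.
have s20 : 0 <= 2 * s by lra.
set y := Q s - (tau - j s) / s.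
have kap0 : 0 <= k / s by rewrite divr_ge0 ?ltW.
have kap1 : k / s <= 1 by rewrite ler_pdivrMr // mul1r.
have /andP[Hd1 Hd2] : sg s <= (tau - j s) / s <= 1.
  have /andP[a b] := j_bounds (ltW s0).
  by rewrite ler_pdivlMr // ler_pdivrMr // mul1r a b.
have DQ : D s = Q s * (s / tau) by rewrite /Q; field; rewrite !gt_eqF.
have D0 : 0 <= D s by rewrite subr_ge0 sg_le1 ?ltW.
have Q0 : 0 <= Q s by rewrite /Q divr_ge0 ?mulr_ge0 // ltW.
have Hm : tau * m (2 * s) <= Q s.
  have [H3 _] := D_incr (lexx 0) (ltW s0).
  rewrite /Q ler_pdivlMr // -mulrA ler_pM2l //.
  have H4 : m (2 * s) <= m s by apply: m_anti; lra.
  have : 0 <= (m s - m (2 * s)) * s by rewrite mulr_ge0 ?subr_ge0 // ltW.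
  move: H3; have := D0_ge0; rewrite subr0; lra.
have yE : y ^+ 2 <= (k / s) ^+ 2 * Q s.
  have := cov_bound (ltW s0).
  rewrite (_ : j s - tau * sg s = s * y); last first.
    by rewrite /y /Q /D; field; rewrite gt_eqF.
  rewrite -mulrA => H.
  have : (s * y) ^+ 2 <= k ^+ 2 * Q s.
    by apply: le_trans H _; rewrite ler_wpM2l ?sqr_ge0.
  have -> : (k / s) ^+ 2 * Q s = k ^+ 2 * Q s / s ^+ 2 by field; rewrite gt_eqF.
  by rewrite ler_pdivlMr ?exprn_gt0 // mulrC -exprMn.
(* The bound on [y ^+ 2] contains [Q s] itself. A crude bound breaks the circle: [Q s > 4] would
   give [(Q s - 1) ^+ 2 <= Q s]. *)
have Q4 : Q s <= 4.
  rewrite leNgt; apply/negP => Q4.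
  have y1 : Q s - 1 <= y by rewrite /y; lra.
  have y2 : (Q s - 1) ^+ 2 <= y ^+ 2 by rewrite lerXn2r ?nnegrE //; lra.
  have y3 : (k / s) ^+ 2 * Q s <= Q s.
    by rewrite -[leRHS]mul1r ler_wpM2r // expr_le1.
  nra.
have y2 : y ^+ 2 <= (2 * (k / s)) ^+ 2.
  by have := ler_wpM2l (sqr_ge0 (k / s)) Q4; lra.
have : `|y| <= 2 * (k / s).
  have k20 : 0 <= 2 * (k / s) by lra.
  rewrite -(@ler_pXn2r _ 2) ?nnegrE ?normr_ge0 //.
  by rewrite real_normK ?num_real.
rewrite ler_norml => /andP[ya yb].
have Q1 : Q s <= 1 + 2 * (k / s) by rewrite /y in yb; lra.
rewrite Q1 andbT.
have st0 : 0 <= s / tau by rewrite divr_ge0 ?ltW.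
have Ds3 : D s <= 3 * (s / tau).
  by rewrite DQ; apply: ler_wpM2r => //; lra.
by move: Ds3; rewrite /D; rewrite /y in ya; lra.
Qed.

(** As [m] is nonincreasing, [m s] lies between its means over [[s, 2 s]] and over [[s / 2, s]]; the
    latter needs [k <= s / 2]. The 12 arises in the lower bound, the 8 in the upper one. *)
Lemma meeting_density_bounds s : 2 * k <= s ->
  `|tau * m s - 1| <= 12 * (s / tau) + 8 * (k / s).
Proof.
move=> ks; have s0 : 0 < s by have := k_gt0; lra.
have k0 := k_gt0.
have ks1 : k <= s by lra.
have ks2 : k <= 2 * s by lra.
have ks3 : k <= s / 2 by lra.
have /andP[_ U1] := meeting_hazard_bounds ks1.
have /andP[L2 _] := meeting_hazard_bounds ks2.
have /andP[L3 _] := meeting_hazard_bounds ks3.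
have E2 : k / (2 * s) = (k / s) / 2 by field; rewrite gt_eqF.
have E3 : k / (s / 2) = 2 * (k / s) by field; rewrite gt_eqF.
have s1 : 0 <= s / 2 by lra.
have s2 : s / 2 <= s by lra.
have s3 : s <= 2 * s by lra.
have [H1 _] := D_incr s1 s2.
have [_ H2] := D_incr (ltW s0) s3.
have QD x : 0 < x -> tau * D x = Q x * x by move=> x0; rewrite /Q; field; rewrite gt_eqF.
have kap0 : 0 <= k / s by rewrite divr_ge0 ?ltW.
have st0 : 0 <= s / tau by rewrite divr_ge0 ?ltW.
have A1 : tau * m s <= 2 * Q s - Q (s / 2).
  have : tau * (m s * (s - s / 2)) <= tau * (D s - D (s / 2)) by rewrite ler_pM2l.
  have QD1 := QD _ s0; have QD2 := QD (s / 2) ltac:(lra) => H.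
  have : tau * m s * s <= (2 * Q s - Q (s / 2)) * s by lra.
  by rewrite ler_pM2r.
have A2 : 2 * Q (2 * s) - Q s <= tau * m s.
  have : tau * (D (2 * s) - D s) <= tau * (m s * (2 * s - s)) by rewrite ler_pM2l.
  have QD1 := QD _ s0; have QD2 := QD (2 * s) ltac:(lra) => H.
  have : (2 * Q (2 * s) - Q s) * s <= tau * m s * s by lra.
  by rewrite ler_pM2r.
rewrite ler_norml; move: L2 L3; rewrite E2 E3 => L2 L3; apply/andP; split; lra.
Qed.

End MeanFieldDecay.

(** * The probability that two walks have not met *)

Section Survival.
Variables (R : realType) (T : finType) (r : T -> T -> R).
Hypothesis sym_r : sym_rates r.
Implicit Types (p : T * T).

Let r_ge0 x y : 0 <= r x y. Proof. by case: sym_r. Qed.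
Let r_sym x y : r x y = r y x. Proof. by case: sym_r => _ []. Qed.

Definition survival (s : R) p : R := meet_tail r p.1 p.2 s.

Lemma survivalE s p :
  survival s p = \sum_q kexp (generator (pair_rate r)) s p q * (offd q)%:R.
Proof.
rewrite /survival /meet_tail big_mkcond /=; apply: eq_bigr => q _.
by case: p => x y; rewrite /offd; case: (q.1 != q.2); rewrite ?mulr1 ?mulr0.
Qed.

Lemma is_derive_survival (s : R) p :
  is_derive s 1 (survival ^~ p) (if offd p then plap r (survival s) p else 0).
Proof.
rewrite (_ : survival ^~ p = fun s => \sum_q kexp (generator (pair_rate r)) s p q * (offd q)%:R); last first.
  by apply/funext => ?; exact: survivalE.
have := is_derive_flow (generator (pair_rate r)) s p (fun q => (offd q)%:R).
rewrite sum_pair_generator.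
by rewrite (_ : (fun z => \sum_y _) = survival s) //; apply/funext => q; rewrite survivalE.
Qed.

Lemma survival_offd (s : R) p : offd p -> is_derive s 1 (survival ^~ p) (plap r (survival s) p).
Proof. by move=> op; have := is_derive_survival s p; rewrite op. Qed.

Lemma survival0 p : survival 0 p = (offd p)%:R.
Proof. by rewrite survivalE flow0. Qed.

Lemma survival_diag s p : ~~ offd p -> survival s p = 0.
Proof.
move=> /negbTE op; rewrite (_ : 0 = survival 0 p); last by rewrite survival0 op.
apply: (@derive0_const R (survival ^~ p)) => t.
by have := is_derive_survival t p; rewrite op.
Qed.

Lemma survival_ge0 s p : 0 <= s -> 0 <= survival s p.
Proof.
move=> s0.
apply: (@plap_min_principle R T r sym_r (@offd T) survival (fun s => plap r (survival s)) s) => //.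
- exact: survival_offd.
- by move=> t q _ /survival_diag ->.
- by move=> q _; rewrite survival0.
Qed.

Lemma plap_offd p : offd p -> plap r (fun q => (offd q)%:R) p = - 2 * r p.1 p.2.
Proof.
case: p => x y op; rewrite /plap /lap op /=; rewrite /offd /= in op *.
rewrite (bigD1 y) //= eqxx big1 => [|z /negbTE zy]; last by rewrite zy subrr mulr0.
rewrite (bigD1 x) //= eqxx big1 => [|z /negbTE zy]; last by rewrite eq_sym zy subrr mulr0.
by rewrite (r_sym y x) /=; ring.
Qed.

Lemma plap_const (c : R) p : plap r (fun=> c) p = 0.
Proof. by rewrite /plap /lap !big1 ?addr0 // => z _; rewrite subrr mulr0. Qed.

Lemma survival_le1 s p : 0 <= s -> survival s p <= 1.
Proof.
move=> s0; rewrite -subr_ge0.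
apply: (@plap_min_principle R T r sym_r (@offd T) (fun s q => 1 - survival s q)
  (fun s q => - plap r (survival s) q) s) => //.
- move=> t q oq; rewrite -[- _]sub0r.
  by apply: is_derive_sub; exact: survival_offd.
- by move=> t q _ _; rewrite plapB plap_const sub0r.
- by move=> t q _ /survival_diag ->; rewrite subr0.
- by move=> q _; rewrite survival0 subr_ge0; case: (offd q).
Qed.

(** Both terms solve the same killed equation, and they are ordered at the start because survival
    equals 1 off the diagonal at time 0. *)
Lemma survival_anti s t p : 0 <= s -> s <= t -> survival t p <= survival s p.
Proof.
move=> s0 st; rewrite -subr_ge0; set d := t - s.
have d0 : 0 <= d by rewrite subr_ge0.
rewrite (_ : t = 1 * s + d); last by rewrite /d; ring.
apply: (@plap_min_principle R T r sym_r (@offd T)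
  (fun s q => survival s q - survival (1 * s + d) q)
  (fun s q => plap r (survival s) q - 1 * plap r (survival (1 * s + d)) q) s) => //.
- move=> w q oq; apply: is_derive_sub; first exact: survival_offd.
  by apply: (@is_derive_affine R (survival ^~ q)); exact: survival_offd.
- by move=> w q w0 oq; rewrite plapB !mul1r.
- by move=> w q w0 /survival_diag H; rewrite !H subrr.
- by move=> q oq; rewrite survival0 oq mulr0 add0r subr_ge0 survival_le1.
Qed.

Lemma sum_offd (F : T * T -> R) : (forall p, ~~ offd p -> F p = 0) ->
  \sum_(p | offd p) F p = \sum_p F p.
Proof.
move=> H; rewrite big_mkcond; apply: eq_bigr => p _.
by case: ifP => // /negbT /H ->.
Qed.

Lemma sum_survival_split (s t : R) :
  \sum_p survival t p * survival 0 p = \sum_p survival s p * survival (t - s) p.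
Proof.
have H u v : \sum_(p | offd p) survival u p * survival v p = \sum_p survival u p * survival v p.
  by apply: sum_offd => p /survival_diag ->; rewrite mul0r.
rewrite -!H -[in survival 0](subrr t).
apply: (@pairing_split R _ (@offd T) survival (fun s => plap r (survival s))
  survival (fun s => plap r (survival s)) t t s).
- exact: survival_offd.
- exact: survival_offd.
- move=> u v; rewrite !sum_offd => [||p].
  + by rewrite (sum_plap_sym sym_r).
  + by move=> p /survival_diag ->; rewrite mul0r.
  + by move=> /survival_diag ->; rewrite mulr0.
Qed.

(** Reversibility of the killed pair: a trajectory of length [2 * s] is cut at its midpoint into two
    of length [s]. *)
Lemma sum_survival_sqr s : \sum_p survival (2 * s) p = \sum_p survival s p ^+ 2.
Proof.
have := sum_survival_split s (2 * s).
rewrite (_ : 2 * s - s = s); last by ring.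
under [in X in _ = X -> _]eq_bigr => p _ do rewrite -expr2.
move=> <-; apply: eq_bigr => p _; rewrite survival0.
by have [op|/survival_diag ->] := boolP (offd p); rewrite ?mulr1 ?mul0r.
Qed.

(** Equals [#|T|] times [alpha] by transitivity, see [collisionE]; the sum over all pairs is the
    form to which the symmetry of [plap] applies. *)
Definition collision (s : R) : R := \sum_p r p.1 p.2 * survival s p.

(** Symmetry moves [plap] onto the indicator of the off-diagonal pairs, so that only pairs one jump
    away from meeting contribute. *)
Lemma is_derive_sum_survival (s : R) :
  is_derive s 1 (fun s => \sum_p survival s p) (- (2 * collision s)).
Proof.
have -> : - (2 * collision s) = \sum_p (if offd p then plap r (survival s) p else 0).
  rewrite -big_mkcond /= (_ : \sum_(p | offd p) _ = \sum_p (offd p)%:R * plap r (survival s) p).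
    rewrite -(sum_plap_sym sym_r) mulr_sumr -sumrN; apply: eq_bigr => p _.
    have [op|/survival_diag ->] := boolP (offd p); last by rewrite !mulr0 oppr0.
    by rewrite plap_offd //; ring.
  rewrite big_mkcond; apply: eq_bigr => p _.
  by case: (offd p); rewrite ?mul1r ?mul0r.
by apply: is_derive_sumf => p _; exact: is_derive_survival.
Qed.

Lemma collision_anti s t : 0 <= s -> s <= t -> collision t <= collision s.
Proof. by move=> s0 st; apply: ler_sum => p _; rewrite ler_wpM2l // survival_anti. Qed.

Lemma collision_ge0 s : 0 <= s -> 0 <= collision s.
Proof. by move=> s0; apply: sumr_ge0 => p _; rewrite mulr_ge0 // survival_ge0. Qed.

(** The identity [sum_survival_sqr] is differentiated in two ways. *)
Lemma survival_energy s : - \sum_p plap r (survival s) p * survival s p = 2 * collision (2 * s).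
Proof.
have H1 : is_derive s 1 (fun s => \sum_p survival (2 * s) p) (2 * - (2 * collision (2 * s))).
  rewrite (_ : (fun s => _) = fun s => \sum_p survival (2 * s + 0) p); last first.
    by apply/funext => t; rewrite addr0.
  apply: (@is_derive_affine R (fun s => \sum_p survival s p)).
  by rewrite addr0; exact: is_derive_sum_survival.
have H2 : is_derive s 1 (fun s => \sum_p survival (2 * s) p)
    (\sum_p ((if offd p then plap r (survival s) p else 0) * survival s p +
             survival s p * (if offd p then plap r (survival s) p else 0))).
  rewrite (_ : (fun s => _) = fun s => \sum_p survival s p * survival s p); last first.
    by apply/funext => t; rewrite sum_survival_sqr; apply: eq_bigr => p _; rewrite expr2.
  apply: is_derive_sumf => p _.
  by apply: is_derive_prod; exact: is_derive_survival.
have := is_derive_uniq H1 H2.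
have -> : \sum_p ((if offd p then plap r (survival s) p else 0) * survival s p +
             survival s p * (if offd p then plap r (survival s) p else 0)) =
   2 * \sum_p plap r (survival s) p * survival s p.
  rewrite mulr_sumr; apply: eq_bigr => p _.
  have [op|/survival_diag ->] := boolP (offd p); last by rewrite !mulr0 ?mul0r addr0.
  by ring.
by move=> E; lra.
Qed.

Hypothesis irr_r : irreducible r.
Hypothesis T_gt1 : (1 < #|T|)%N.

Let n : R := #|T|%:R.
Let n_gt0 : 0 < n. Proof. by rewrite ltr0n (ltn_trans _ T_gt1). Qed.
Let n2_gt0 : 0 < n ^+ 2. Proof. by rewrite exprn_gt0. Qed.

Lemma sum_offd1 : \sum_(p : T * T) (offd p)%:R = n ^+ 2 - n :> R.
Proof.
have -> : \sum_(p : T * T) (offd p)%:R = \sum_(p : T * T) (1 - (p.1 == p.2)%:R : R).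
  by apply: eq_bigr => p _; rewrite /offd; case: (p.1 == p.2); rewrite ?subrr ?subr0.
rewrite sumrB sumr_const card_pair; congr (_ - _).
transitivity (\sum_(x : T) \sum_(y : T) (x == y)%:R : R); first by rewrite pair_bigA.
rewrite /n -sumr_const; apply: eq_bigr => x _.
by rewrite (bigD1 x) //= eqxx big1 ?addr0 // => y /negbTE; rewrite eq_sym => ->.
Qed.

Section MeetingTime.
Variable h : T * T -> R.
Hypothesis h_ge0 : forall p, 0 <= h p.
Hypothesis h_diag : forall p, ~~ offd p -> h p = 0.
Hypothesis h_off : forall p, offd p -> plap r h p = -1.

Let tau := (\sum_p h p) / n ^+ 2.
Let sg s := (\sum_p survival s p) / n ^+ 2.
Let j s := (\sum_p h p * survival s p) / n ^+ 2.

Let is_derive_sg (s : R) : is_derive s 1 sg (- (2 * collision s / n ^+ 2)).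
Proof.
have := is_derive_scale (n ^+ 2)^-1 (is_derive_sum_survival s).
rewrite mulrN mulrC; rewrite (_ : (fun s => _) = sg) //.
by apply/funext => t; rewrite mulrC.
Qed.

Let is_derive_j (s : R) : is_derive s 1 j (- sg s).
Proof.
have H : is_derive s 1 (fun s => \sum_p h p * survival s p) (- \sum_p survival s p).
  have -> : - \sum_p survival s p = \sum_p h p * (if offd p then plap r (survival s) p else 0).
    rewrite (_ : \sum_p h p * _ = \sum_p h p * plap r (survival s) p).
      rewrite -(sum_plap_sym sym_r) -sumrN; apply: eq_bigr => p _.
      have [op|/survival_diag ->] := boolP (offd p); last by rewrite mulr0 oppr0.
      by rewrite h_off // mulN1r.
    by apply: eq_bigr => p _; case: ifP => // /negbT /h_diag ->; rewrite !mul0r.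
  by apply: is_derive_sumf => p _; apply: is_derive_scale; exact: is_derive_survival.
have := is_derive_scale (n ^+ 2)^-1 H.
rewrite mulrN mulrC; rewrite (_ : (fun s => _) = j) //.
by apply/funext => t; rewrite mulrC.
Qed.

Let sg_ge0 s : 0 <= s -> 0 <= sg s.
Proof.
move=> s0; rewrite divr_ge0 ?(ltW n2_gt0) //; apply: sumr_ge0 => p _; exact: survival_ge0.
Qed.

Let sg_le1 s : 0 <= s -> sg s <= 1.
Proof.
move=> s0; rewrite ler_pdivrMr // mul1r -card_pair -sumr_const.
by apply: ler_sum => p _; exact: survival_le1.
Qed.

Let j0 : j 0 = tau.
Proof.
congr (_ / _); apply: eq_bigr => p _; rewrite survival0.
by have [op|/h_diag ->] := boolP (offd p); rewrite ?mulr1 ?mul0r.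
Qed.

Let j_ge0 s : 0 <= s -> 0 <= j s.
Proof.
move=> s0; rewrite divr_ge0 ?(ltW n2_gt0) //; apply: sumr_ge0 => p _.
by rewrite mulr_ge0 // survival_ge0.
Qed.

Lemma mean_meeting_time_gt0 : 0 < tau.
Proof.
rewrite divr_gt0 // lt_neqAle sumr_ge0 // andbT eq_sym; apply/negP => /eqP H.
have h0 p : h p = 0.
  apply/eqP; move/eqP: H; rewrite psumr_eq0 // => /allP /(_ p).
  by rewrite mem_index_enum => /(_ isT).
have /card_gt0P[x0 _] : (0 < #|T|)%N by exact: ltn_trans T_gt1.
have /card_gt0P[y0] : (0 < #|predC1 x0|)%N by rewrite cardC1; case: #|T| T_gt1 => [|[]].
rewrite inE => yx; have /h_off : offd (y0, x0) by [].
rewrite (_ : h = fun=> 0); last by apply/funext.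
by rewrite plap_const => /eqP; rewrite eq_sym oppr_eq0 oner_eq0.
Qed.

(** Because [plap h = -1] wherever [h] is nonzero, the energy of [h] is its own sum. The relative
    variance of [h] is thus at most [trel r / tau], small by assumption in the theorem. *)
Lemma cov_h_le : cov h h <= trel r * (n ^+ 2 * tau).
Proof.
apply: le_trans (poincare_pair sym_r irr_r T_gt1 h) _.
rewrite ler_pM2l ?trel_gt0 // mulrC divfK ?gt_eqF // -sumrN.
apply: ler_sum => p _; have [op|/h_diag ->] := boolP (offd p).
  by rewrite h_off // mulN1r opprK.
by rewrite mulr0 oppr0.
Qed.

Let cov_bound s : 0 <= s ->
  (j s - tau * sg s) ^+ 2 <= trel r ^+ 2 * tau * (2 * collision (2 * s) / n ^+ 2).
Proof.
move=> s0.
have k0 : 0 < trel r by exact: trel_gt0.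
have E : cov h (survival s) = n ^+ 2 * (j s - tau * sg s).
  by rewrite /cov card_pair /j /tau /sg; field; rewrite gt_eqF.
have H := cov_sqr_le (card_pair_gt0 T_gt1) h (survival s).
have H1 := cov_h_le.
have H2 := poincare_pair sym_r irr_r T_gt1 (survival s).
rewrite survival_energy in H2.
have : (n ^+ 2 * (j s - tau * sg s)) ^+ 2 <=
   trel r * (n ^+ 2 * tau) * (trel r * (2 * collision (2 * s))).
  rewrite -E; apply: le_trans H _; apply: ler_pM => //; exact: cov_ge0 (card_pair_gt0 T_gt1) _.
rewrite exprMn => H3.
have -> : trel r ^+ 2 * tau * (2 * collision (2 * s) / n ^+ 2) =
  trel r * (n ^+ 2 * tau) * (trel r * (2 * collision (2 * s))) / (n ^+ 2) ^+ 2.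
  by field; rewrite gt_eqF.
by rewrite ler_pdivlMr ?exprn_gt0 // mulrC.
Qed.

(** A crude rate suffices: [j] is at most [n ^+ 2 * tau] times [sg], and [sg x * x <= tau] since
    [sg] is nonincreasing with integral at most [tau]. *)
Let j_cvg0 : - j x @[x --> +oo] --> 0.
Proof.
have Hj x : 0 < x -> j x <= n ^+ 2 * tau ^+ 2 / x.
  move=> x0.
  have A1 : j x <= n ^+ 2 * tau * sg x.
    have -> : n ^+ 2 * tau = \sum_p h p by rewrite /tau mulrC divfK ?gt_eqF.
    rewrite /j /sg mulrA ler_pM2r ?invr_gt0 // mulr_sumr.
    apply: ler_sum => p _; apply: ler_wpM2r; first by rewrite survival_ge0 // ltW.
    by rewrite (bigD1 p) //= lerDl; exact: sumr_ge0.
  have A2 : sg x * x <= tau.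
    have := @derive_le R j (fun t => - sg t) 0 x (- sg x) (ltW x0) (fun y _ => is_derive_j y).
    rewrite j0 subr0 mulNr => H.
    have : j x - tau <= - (sg x * x).
      apply: H => y /andP[y0 yx]; rewrite lerN2 /sg ler_pM2r ?invr_gt0 //.
      by apply: ler_sum => p _; exact: survival_anti.
    have := j_ge0 (ltW x0); lra.
  apply: le_trans A1 _; rewrite ler_pdivlMr // [tau ^+ 2]expr2 mulrA -[leLHS]mulrA.
  by rewrite ler_pM2l // mulr_gt0 // mean_meeting_time_gt0.
apply/cvgrPdist_le => /= e e0; near=> x.
have x0 : 0 < x by near: x; exact: nbhs_pinfty_gt.
rewrite sub0r opprK ger0_norm; last by apply: j_ge0; exact: ltW.
apply: le_trans (Hj x x0) _; rewrite ler_pdivrMr // [e * x]mulrC -ler_pdivrMr //.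
Unshelve. all: by end_near. Qed.

(** The function [- j] is an antiderivative of [sg] that tends to 0 at infinity, so the improper
    integral equals [j 0]. *)
Lemma tmeetE : tmeet r = tau.
Proof.
rewrite /tmeet.
rewrite (_ : (fun t => _) = fun t => (sg t)%:E); last first.
  apply/funext => t; congr (_%:E); rewrite mulrC; congr (_ / _).
  by rewrite pair_bigA /=; apply: eq_bigr => -[].
rewrite (@ge0_continuous_FTC2y R sg (fun x => - j x) 0 0) //.
- by rewrite -EFinB /= j0 sub0r opprK.
- apply: continuous_subspaceT; exact: derive_cts is_derive_sg.
- move=> x _; have H := is_derive_j x; have : is_derive x 1 (fun x => - j x) (- - sg x) by exact: is_deriveN.
  by case.
- apply: cvg_at_right_filter; apply: continuousN; exact: (derive_cts is_derive_j).
- move=> x _; have H := is_derive_j x; have H2 : is_derive x 1 (fun x => - j x) (- - sg x) by exact: is_deriveN.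
  by rewrite derive1E derive_val opprK.
Qed.

Lemma tmeet_density s : 2 * trel r <= s ->
  `|tmeet r * (2 * collision s / n ^+ 2) - 1| <= 12 * (s / tmeet r) + 8 * (trel r / s).
Proof.
rewrite tmeetE; apply: (meeting_density_bounds is_derive_sg is_derive_j) => //.
- move=> u v u0 uv; rewrite ler_pM2r ?invr_gt0 // ler_pM2l //; exact: collision_anti.
- by move=> u u0; rewrite mulr_ge0 ?invr_ge0 ?(ltW n2_gt0) // mulr_ge0 // collision_ge0.
- exact: mean_meeting_time_gt0.
- exact: trel_gt0.
Qed.

End MeetingTime.

End Survival.

(** * The heat kernel and the return probability *)

Lemma generator_map (R : realType) (T : finType) (q : T -> T -> R) (phi : T -> T) x y :
  bijective phi -> (forall x y, q (phi x) (phi y) = q x y) ->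
  generator q (phi x) (phi y) = generator q x y.
Proof.
move=> bphi Hq; rewrite /generator (inj_eq (bij_inj bphi)) Hq; case: ifP => // _.
congr (- _); rewrite (reindex phi) /=; last exact: onW_bij.
by apply: eq_big => z; rewrite ?(inj_eq (bij_inj bphi)) ?Hq.
Qed.

Section HeatKernel.
Variables (R : realType) (T : finType) (r : T -> T -> R).
Hypothesis sym_r : sym_rates r.
Implicit Types (p : T * T) (f : T * T -> R).

Let r_ge0 x y : 0 <= r x y. Proof. by case: sym_r. Qed.
Let r_diag x : r x x = 0. Proof. by case: sym_r => _ []. Qed.

Let K s x z := kexp (generator r) s x z.

(* Since the rates are symmetric, this is the heat kernel at time [2 s]. *)
Definition heat (s : R) p : R := \sum_z K s p.1 z * K s p.2 z.

Lemma is_derive_heat (s : R) p : is_derive s 1 (heat ^~ p) (plap r (heat s) p).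
Proof.
have HK x z : is_derive s 1 (fun s => K s x z) (lap r (fun w => K s w z) x).
  by rewrite /lap -sum_generator; exact: is_derive_kexp.
have -> : plap r (heat s) p = \sum_z (lap r (fun w => K s w z) p.1 * K s p.2 z +
    K s p.1 z * lap r (fun w => K s w z) p.2).
  rewrite big_split /= /plap; congr (_ + _); rewrite /lap.
    under [RHS]eq_bigr => z _ do rewrite mulr_suml.
    rewrite exchange_big /=; apply: eq_bigr => w _.
    by rewrite /heat -sumrB mulr_sumr; apply: eq_bigr => z _ /=; ring.
  under [RHS]eq_bigr => z _ do rewrite mulr_sumr.
  rewrite exchange_big /=; apply: eq_bigr => w _.
  by rewrite /heat -sumrB mulr_sumr; apply: eq_bigr => z _ /=; ring.
by apply: is_derive_sumf => z _; apply: is_derive_prod.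
Qed.

Lemma heat0 p : heat 0 p = (p.1 == p.2)%:R.
Proof.
rewrite /heat /K (bigD1 p.1) //= !kexp0 eqxx mul1r big1 ?addr0 1?eq_sym // => z /negbTE zp.
by rewrite kexp0 eq_sym zp mul0r.
Qed.

Lemma heat_ge0 s p : 0 <= s -> 0 <= heat s p.
Proof.
move=> s0.
apply: (@plap_min_principle R T r sym_r xpredT heat (fun s => plap r (heat s)) s) => //.
- by move=> t q _; exact: is_derive_heat.
- by move=> q _; rewrite heat0.
Qed.

Lemma sum_heat s : \sum_p heat s p = #|T|%:R.
Proof.
have -> : \sum_p heat s p = \sum_p heat 0 p.
  apply: (@derive0_const R (fun s => \sum_p heat s p)) => t.
  have : is_derive t 1 (fun s => \sum_p heat s p) (\sum_p plap r (heat t) p).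
    by apply: is_derive_sumf => p _; exact: is_derive_heat.
  by rewrite sum_plap.
under eq_bigr => p _ do rewrite heat0.
transitivity (\sum_(x : T) \sum_(y : T) (x == y)%:R : R); first by rewrite pair_bigA.
rewrite -sumr_const; apply: eq_bigr => x _.
by rewrite (bigD1 x) //= eqxx big1 ?addr0 // => y /negbTE; rewrite eq_sym => ->.
Qed.

Hypothesis irr_r : irreducible r.
Hypothesis T_gt1 : (1 < #|T|)%N.
Hypothesis trans_r : transitive_chain r.

Let rate1 x : rate r x = 1. Proof. by case: trans_r. Qed.

Let n : R := #|T|%:R.
Let n_gt0 : 0 < n. Proof. by rewrite ltr0n (ltn_trans _ T_gt1). Qed.

Definition heat_diag (s : R) : R := (\sum_x heat s (x, x)) / n.

Lemma heat_diagE s x : heat s (x, x) = heat_diag s.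
Proof.
have H y : heat s (y, y) = heat s (x, x).
  have [phi [bphi [phix Hphi]]] := trans_r.1 x y.
  rewrite /heat /= -phix (reindex phi) /=; last exact: onW_bij.
  apply: eq_bigr => z _.
  by rewrite /K !(kexp_map _ _ _ bphi) // => *; exact: generator_map.
rewrite /heat_diag; under eq_bigr => y _ do rewrite H.
by rewrite sumr_const -[_ *+ _]mulr_natl -/n mulrC mulKf // gt_eqF.
Qed.

(** The arithmetic-geometric inequality for two rows of the kernel, whose square sums agree by
    transitivity. *)
Lemma heat_le_diag s p : heat s p <= heat_diag s.
Proof.
have H : heat s p <= (heat s (p.1, p.1) + heat s (p.2, p.2)) / 2.
  rewrite /heat -big_split mulr_suml /=; apply: ler_sum => z _.
  have := sqr_ge0 (K s p.1 z - K s p.2 z); rewrite sqrrB mulr2n.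
  by set a := K s p.1 z; set b := K s p.2 z => ?; lra.
by apply: le_trans H _; rewrite !heat_diagE; lra.
Qed.

Lemma sum_heat_sqr s : \sum_p heat s p * heat s p = n * heat_diag (2 * s).
Proof.
transitivity (\sum_p heat s p * heat (2 * s - s) p).
  by apply: eq_bigr => p _; congr (_ * heat _ p); ring.
transitivity (\sum_p heat (2 * s) p * heat (2 * s - 2 * s) p).
  apply: (@pairing_split R _ xpredT heat (fun s => plap r (heat s))
    heat (fun s => plap r (heat s)) (2 * s) s (2 * s)).
  - by move=> t p _; exact: is_derive_heat.
  - by move=> t p _; exact: is_derive_heat.
  - by move=> u v; exact: sum_plap_sym.
under eq_bigr => p _ do rewrite subrr heat0.
rewrite /heat_diag [RHS]mulrC divfK ?gt_eqF //.
transitivity (\sum_x \sum_y heat (2 * s) (x, y) * (x == y)%:R).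
  by rewrite pair_bigA /=; apply: eq_bigr => -[].
apply: eq_bigr => x _; rewrite (bigD1 x) //= eqxx mulr1 big1 ?addr0 // => y /negbTE.
by rewrite eq_sym => ->; rewrite mulr0.
Qed.

Let a s := heat_diag s - n^-1.
Let da s := (\sum_x plap r (heat s) (x, x)) / n.

Let is_derive_a (s : R) : is_derive s 1 a (da s).
Proof.
rewrite -[da s]subr0; apply: is_derive_sub.
rewrite /da mulrC.
rewrite (_ : heat_diag = fun s => n^-1 * \sum_x heat s (x, x)); last first.
  by apply/funext => t; rewrite mulrC.
by apply: is_derive_scale; apply: is_derive_sumf => x _; exact: is_derive_heat.
Qed.

Let cov_heat s : cov (heat s) (heat s) = n * a (2 * s).
Proof.
rewrite /cov sum_heat_sqr !sum_heat card_pair -/n /a.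
by field; rewrite gt_eqF.
Qed.

Let a_ge0 s : 0 <= a s.
Proof.
have := cov_ge0 (card_pair_gt0 T_gt1) (heat (s / 2)).
by rewrite cov_heat pmulr_rge0 // mulrC divfK.
Qed.

(** The Poincare inequality for [heat (s / 2)], whose energy comes from differentiating
    [sum_heat_sqr]. *)
Let a_decay s : a s <= trel r * - da s.
Proof.
have := poincare_pair sym_r irr_r T_gt1 (heat (s / 2)).
rewrite cov_heat (_ : 2 * (s / 2) = s); last by field.
have -> : - \sum_p plap r (heat (s / 2)) p * heat (s / 2) p = n * - da s.
  have H1 : is_derive (s / 2) 1 (fun s => \sum_p heat s p * heat s p)
      (\sum_p (plap r (heat (s / 2)) p * heat (s / 2) p +
               heat (s / 2) p * plap r (heat (s / 2)) p)).
    by apply: is_derive_sumf => p _; apply: is_derive_prod; exact: is_derive_heat.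
  have H2 : is_derive (s / 2) 1 (fun s => \sum_p heat s p * heat s p) (n * (2 * da s)).
    rewrite (_ : (fun s => _) = fun s => n * (a (2 * s + 0) + n^-1)); last first.
      by apply/funext => t; rewrite sum_heat_sqr /a addr0 subrK.
    apply: is_derive_scale; rewrite -[2 * da s]addr0; apply: is_derive_add.
    apply: is_derive_affine; rewrite addr0 (_ : 2 * (s / 2) = s); last by field.
    exact: is_derive_a.
  have := is_derive_uniq H1 H2; rewrite big_split /=.
  have -> : \sum_p heat (s / 2) p * plap r (heat (s / 2)) p =
    \sum_p plap r (heat (s / 2)) p * heat (s / 2) p by apply: eq_bigr => p _; rewrite mulrC.
  by move=> E; lra.
by rewrite mulrCA ler_pM2l.
Qed.

Let k0 : 0 < trel r. Proof. exact: trel_gt0. Qed.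

(** [a_decay] is integrated over [[s / 2, s]], where [a] is at least [a s]: halving the time gains a
    factor of order [trel r / s]. *)
Let a_half s : 0 < s -> a s <= 2 * trel r / s * a (s / 2).
Proof.
move=> s0.
have A u : u <= s -> a s <= a u.
  move=> us; have := @derive_le R a da u s 0 us (fun x _ => is_derive_a x).
  move=> H; have : a s - a u <= 0 * (s - u); last lra.
  apply: H => x _; rewrite -oppr_ge0 -(pmulr_rge0 _ k0).
  exact: le_trans (a_ge0 x) (a_decay x).
have h : s / 2 <= s by lra.
have H := @derive_le R a da (s / 2) s (- (a s / trel r)) h (fun x _ => is_derive_a x).
have {}H : a s - a (s / 2) <= - (a s / trel r) * (s - s / 2).
  apply: H => x /andP[_ xs]; rewrite -lerN2 opprK ler_pdivrMr // mulrC.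
  exact: le_trans (A x xs) (a_decay x).
have H2 : a s / trel r * (s / 2) <= a (s / 2).
  by have := a_ge0 s; move: H; rewrite (_ : s - s / 2 = s / 2); [lra | field].
have -> : 2 * trel r / s * a (s / 2) = a (s / 2) / ((trel r)^-1 * (s / 2)).
  by field; rewrite !gt_eqF.
have p0 : 0 < (trel r)^-1 * (s / 2).
  by apply: mulr_gt0; [rewrite invr_gt0 | lra].
by rewrite ler_pdivlMr // [leLHS]mulrA.
Qed.

Let a_le1 s : 0 <= s -> a s <= 1.
Proof.
move=> s0; have := @derive_le R a da 0 s 0 s0 (fun x _ => is_derive_a x).
move=> H; have {}H : a s - a 0 <= 0 * (s - 0).
  apply: H => x _; rewrite -oppr_ge0 -(pmulr_rge0 _ k0).
  exact: le_trans (a_ge0 x) (a_decay x).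
have a0 : a 0 <= 1.
  rewrite /a /heat_diag; under eq_bigr => x _ do rewrite heat0 eqxx.
  by rewrite sumr_const -/n divff ?gt_eqF // gerBl invr_ge0 ltW.
by lra.
Qed.

(* Off the diagonal [plap h = -1], so [h] is n times the difference between the
   diagonal and off-diagonal values of the Green function, and its pairing with
   the heat kernel integrates the return probability. *)
Section Green.
Variable h : T * T -> R.
Hypothesis h_ge0 : forall p, 0 <= h p.
Hypothesis h_diag : forall p, ~~ offd p -> h p = 0.
Hypothesis h_off : forall p, offd p -> plap r h p = -1.

Let tau := (\sum_p h p) / n ^+ 2.
Let q s := \sum_p h p * heat s p.

Let sum_h : \sum_p h p = n ^+ 2 * tau.
Proof. by rewrite /tau mulrC divfK // gt_eqF // exprn_gt0. Qed.

Let is_derive_q (s : R) : is_derive s 1 q (n ^+ 2 * a s).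
Proof.
have -> : n ^+ 2 * a s = \sum_p h p * plap r (heat s) p.
  rewrite -(sum_plap_sym sym_r).
  have E (F : T * T -> R) : \sum_p F p =
      \sum_p (offd p)%:R * F p + \sum_x F (x, x).
    have -> : \sum_x F (x, x) = \sum_p (p.1 == p.2)%:R * F p.
      transitivity (\sum_x \sum_y (x == y)%:R * F (x, y)).
        apply: eq_bigr => x _; rewrite (bigD1 x) //= eqxx mul1r big1 ?addr0 // => y /negbTE.
        by rewrite eq_sym => ->; rewrite mul0r.
      by rewrite pair_bigA /=; apply: eq_bigr => -[].
    rewrite -big_split /=; apply: eq_bigr => p _; rewrite /offd.
    by case: (p.1 == p.2); rewrite /= ?mul1r ?mul0r ?addr0 ?add0r.
  (* The values of [plap h] on the diagonal are not known one by one, but [heat] is constant there,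
     so their sum is enough; [sum_plap] gives it. *)
  have E1 : \sum_x plap r h (x, x) = n ^+ 2 - n.
    have := sum_plap sym_r h; rewrite E => H.
    have : \sum_p (offd p)%:R * plap r h p = - (n ^+ 2 - n).
      rewrite -(sum_offd1 R T) -sumrN; apply: eq_bigr => p _.
      by have [/h_off ->|_] := boolP (offd p); rewrite ?mul1r ?mul0r ?oppr0.
    lra.
  have E2 : \sum_p (offd p)%:R * heat s p = n - n * heat_diag s.
    have := sum_heat s; rewrite E.
    under [X in _ + X]eq_bigr => x _ do rewrite heat_diagE.
    by rewrite sumr_const -[heat_diag s *+ _]mulr_natl -/n => H; lra.
  rewrite E.
  have -> : \sum_p (offd p)%:R * (plap r h p * heat s p) = - (n - n * heat_diag s).
    rewrite -E2 -sumrN; apply: eq_bigr => p _.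
    by have [/h_off ->|_] := boolP (offd p); rewrite ?mul1r ?mul0r ?oppr0 ?mulN1r.
  under [X in _ + X]eq_bigr => x _ do rewrite heat_diagE.
  by rewrite -mulr_suml E1 /a; field; rewrite gt_eqF.
by apply: is_derive_sumf => p _; apply: is_derive_scale; exact: is_derive_heat.
Qed.

Let q_le s t : s <= t -> q s <= q t.
Proof.
move=> st; apply: (@ge0_derive_le R q (fun s => n ^+ 2 * a s)) => // x _.
by rewrite mulr_ge0 ?a_ge0 // exprn_ge0 // ltW.
Qed.

(** [q] is nondecreasing and can only approach [n * tau], its value for the uniform kernel [n^-1]:
    the difference is the covariance of [h] with the heat kernel, which tends to 0. *)
Let q_bound s : q s <= n * tau.
Proof.
rewrite leNgt; apply/negP => qs; set d := q s - n * tau.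
have d0 : 0 < d by rewrite subr_gt0.
set C := trel r * (n ^+ 2 * tau) * n.
have tau0 : 0 <= tau by rewrite divr_ge0 ?exprn_ge0 ?(ltW n_gt0) // sumr_ge0.
have n20 : 0 <= n ^+ 2 by rewrite exprn_ge0 ?(ltW n_gt0).
have C0 : 0 <= C by exact: mulr_ge0 (mulr_ge0 (ltW k0) (mulr_ge0 n20 tau0)) (ltW n_gt0).
(* Beyond [s], so that [q t >= q s], and late enough that [C * (trel r / t) < d ^+ 2]. *)
pose t := Num.max `|s| (C * trel r / d ^+ 2 + 1).
have t1 : `|s| <= t by rewrite le_max lexx.
have t2 : C * trel r / d ^+ 2 + 1 <= t by rewrite le_max lexx orbT.
have t0 : 0 < t.
  apply: lt_le_trans t2; rewrite ltr_wpDl // divr_ge0 ?exprn_ge0 ?(ltW d0) //.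
  by rewrite mulr_ge0 // ltW.
have qt : d <= q t - n * tau.
  by rewrite /d lerB // q_le // (le_trans (ler_norm s)).
have H : (q t - n * tau) ^+ 2 <= C * a (2 * t).
  have := cov_sqr_le (card_pair_gt0 T_gt1) h (heat t).
  have -> : cov h (heat t) = q t - n * tau.
    by rewrite /cov sum_heat card_pair -/n sum_h /q; field; rewrite gt_eqF.
  rewrite cov_heat => H; apply: le_trans H _.
  rewrite /C -mulrA; apply: ler_wpM2r; first by rewrite mulr_ge0 ?a_ge0 // ltW.
  exact: (cov_h_le sym_r irr_r T_gt1 h_diag h_off).
have a2 : a (2 * t) <= trel r / t.
  have t20 : 0 < 2 * t by lra.
  apply: le_trans (a_half t20) _.
  rewrite (_ : 2 * trel r / (2 * t) = trel r / t); last by field; rewrite gt_eqF.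
  rewrite -[leRHS]mulr1 ler_wpM2l ?divr_ge0 ?(ltW t0) ?(ltW k0) // a_le1 //; lra.
have H2 : d ^+ 2 <= C * (trel r / t).
  apply: le_trans (ler_wpM2l C0 a2); apply: le_trans H.
  by rewrite lerXn2r // nnegrE ltW // (lt_le_trans d0).
move: H2; rewrite mulrA ler_pdivlMr // leNgt => /negP; apply.
rewrite [ltRHS]mulrC -ltr_pdivrMr ?exprn_gt0 //; lra.
Qed.

Let heat_diag_bound1 s : 0 < s -> heat_diag s - n^-1 <= tau / n / s.
Proof.
move=> s0; rewrite -/(a s) ler_pdivlMr //.
have q0 : q 0 = 0.
  rewrite /q big1 // => p _; rewrite heat0.
  have [|/h_diag ->] := boolP (offd p); last by rewrite mul0r.
  by rewrite /offd => /negbTE ->; rewrite mulr0.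
have := @derive_ge R q (fun s => n ^+ 2 * a s) 0 s (n ^+ 2 * a s) (ltW s0) (fun x _ => is_derive_q x).
rewrite q0 !subr0 => H.
have {}H : n ^+ 2 * a s * s <= q s.
  apply: H => x /andP[x0 xs]; rewrite ler_pM2l ?exprn_gt0 //.
  have := @derive_le R a da x s 0 xs (fun x _ => is_derive_a x).
  move=> H; have {}H : a s - a x <= 0 * (s - x).
    apply: H => y _; rewrite -oppr_ge0 -(pmulr_rge0 _ k0).
    exact: le_trans (a_ge0 y) (a_decay y).
  by lra.
have := le_trans H (q_bound s).
rewrite ler_pdivlMr // (_ : n ^+ 2 * a s * s = n * (a s * s * n)); last by ring.
by rewrite ler_pM2l.
Qed.

(** The second bound is the first at time [s / 2], inserted into [a_half]. *)
Lemma heat_diag_bound s : 0 < s ->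
  heat_diag s - n^-1 <= tmeet r / n / s /\
  heat_diag s - n^-1 <= 4 * trel r * (tmeet r / n) / s ^+ 2.
Proof.
move=> s0.
rewrite (tmeetE sym_r T_gt1 h_ge0 h_diag h_off) -/n -/tau; split; first exact: heat_diag_bound1.
apply: le_trans (a_half s0) _.
have s20 : 0 < s / 2 by lra.
apply: le_trans (ler_wpM2l _ (heat_diag_bound1 s20)) _.
  by rewrite divr_ge0 ?mulr_ge0 // ltW.
by rewrite le_eqVlt; apply/orP; left; apply/eqP; field; rewrite !gt_eqF.
Qed.

End Green.

(** Semigroup of the pair frozen on meeting; for [f] zero on the diagonal it is the semigroup of the
    pair killed on meeting. *)
Definition kflow f (s : R) p : R := \sum_q kexp (generator (pair_rate r)) s p q * f q.

Lemma is_derive_kflow f (s : R) p :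
  is_derive s 1 (kflow f ^~ p) (if offd p then plap r (kflow f s) p else 0).
Proof.
have := is_derive_flow (generator (pair_rate r)) s p f.
by rewrite sum_pair_generator.
Qed.

Lemma kflow_offd f (s : R) p : offd p -> is_derive s 1 (kflow f ^~ p) (plap r (kflow f s) p).
Proof. by move=> op; have := is_derive_kflow f s p; rewrite op. Qed.

Lemma kflow0 f p : kflow f 0 p = f p.
Proof. exact: flow0. Qed.

Lemma kflow_diag f s p : ~~ offd p -> kflow f s p = f p.
Proof.
move=> /negbTE op; rewrite -[RHS]kflow0.
apply: (@derive0_const R (kflow f ^~ p)) => t.
by have := is_derive_kflow f t p; rewrite op.
Qed.

Lemma sum_kflow f g s : (forall p, ~~ offd p -> f p = 0) -> (forall p, ~~ offd p -> g p = 0) ->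
  \sum_p kflow f s p * g p = \sum_p f p * kflow g s p.
Proof.
move=> f0 g0.
have H u v : \sum_(p | offd p) kflow f u p * kflow g v p = \sum_p kflow f u p * kflow g v p.
  by apply: sum_offd => p op; rewrite kflow_diag // f0 // mul0r.
transitivity (\sum_p kflow f s p * kflow g (s - s) p).
  by apply: eq_bigr => p _; rewrite subrr kflow0.
transitivity (\sum_p kflow f 0 p * kflow g (s - 0) p); last first.
  by apply: eq_bigr => p _; rewrite subr0 kflow0.
rewrite -!H.
apply: (@pairing_split R _ (@offd T) (kflow f) (fun s => plap r (kflow f s))
  (kflow g) (fun s => plap r (kflow g s)) s s 0).
- by move=> t p; exact: kflow_offd.
- by move=> t p; exact: kflow_offd.
- move=> u v; rewrite !sum_offd => [||p op].
  + by rewrite (sum_plap_sym sym_r).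
  + by move=> p op; rewrite kflow_diag // f0 // mul0r.
  + by rewrite (kflow_diag g) // g0 // mulr0.
Qed.

(** Killing only lowers the flow. The comparison function [G] is the flow without killing started
    from the rates: the heat kernel averaged over one extra jump of the first walk, hence at most
    [heat_diag]. *)
Lemma kflow_rates_le s p : 0 <= s -> kflow (fun q => r q.1 q.2) s p <= heat_diag s.
Proof.
move=> s0.
pose G t q := \sum_z r q.1 z * heat t (z, q.2).
pose dG t q := \sum_z r q.1 z * plap r (heat t) (z, q.2).
have GE t q : plap r (G t) q = dG t q.
  have rE (F : T -> R) x : lap r F x = \sum_z r x z * F z - F x.
    rewrite /lap; under eq_bigr => z _ do rewrite mulrBr.
    by rewrite sumrB -mulr_suml; have := rate1 x; rewrite /rate => ->; rewrite mul1r.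
  rewrite /plap /dG /plap.
  under [RHS]eq_bigr => z _ do rewrite mulrDr.
  rewrite big_split /= /G /=; congr (_ + _).
    rewrite rE; under [RHS]eq_bigr => z _ do rewrite rE mulrBr.
    by rewrite sumrB.
  rewrite /lap.
  under [RHS]eq_bigr => z _ do rewrite mulr_sumr.
  rewrite exchange_big /=; apply: eq_bigr => w _.
  by rewrite -sumrB mulr_sumr; apply: eq_bigr => z _; ring.
have GD (t : R) q : is_derive t 1 (G ^~ q) (dG t q).
  by apply: is_derive_sumf => z _; apply: is_derive_scale; exact: is_derive_heat.
have G0 t q : 0 <= t -> 0 <= G t q.
  by move=> t0; apply: sumr_ge0 => z _; rewrite mulr_ge0 // heat_ge0.
apply: (@le_trans _ _ (G s p)).
  rewrite -subr_ge0.
  apply: (@plap_min_principle R T r sym_r (@offd T) (fun s q => G s q - kflow (fun q => r q.1 q.2) s q)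
    (fun s q => dG s q - plap r (kflow (fun q => r q.1 q.2) s) q) s) => //.
  - by move=> t q oq; apply: is_derive_sub; exact: kflow_offd.
  - by move=> t q _ _; rewrite plapB GE.
  - move=> t q t0 oq; rewrite kflow_diag //.
    by move: oq; rewrite negbK => /eqP ->; rewrite r_diag subr0 G0.
  - move=> q oq; rewrite kflow0 /G (bigD1 q.2) //= heat0 eqxx mulr1 addrAC subrr add0r.
    by apply: sumr_ge0 => z _; rewrite mulr_ge0 // heat_ge0.
apply: (@le_trans _ _ (\sum_z r p.1 z * heat_diag s)).
  by apply: ler_sum => z _; rewrite ler_wpM2l // heat_le_diag.
by rewrite -mulr_suml; have := rate1 p.1; rewrite /rate => ->; rewrite mul1r.
Qed.

Lemma sum_rates_kflow_le f s : 0 <= s -> (forall p, 0 <= f p) ->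
  (forall p, ~~ offd p -> f p = 0) ->
  \sum_p r p.1 p.2 * kflow f s p <= heat_diag s * \sum_p f p.
Proof.
move=> s0 f0 fd.
rewrite -(sum_kflow s _ fd); last by move=> p; rewrite negbK => /eqP ->; exact: r_diag.
by rewrite mulr_sumr; apply: ler_sum => p _; rewrite ler_wpM2r // kflow_rates_le.
Qed.

End HeatKernel.

(** * Coalescing walks and negative correlation *)

Lemma kexp_generator_ge0 (R : realType) (X : finType) (q : X -> X -> R) t x y :
  (forall x y, 0 <= q x y) -> 0 <= t -> 0 <= kexp (generator q) t x y.
Proof.
move=> q0 t0.
apply: (@min_principle R X xpredT (fun s x => kexp (generator q) s x y)
  (fun s x => \sum_z generator q x z * kexp (generator q) s z y) 0 t) => //.
- by move=> s z _; exact: is_derive_kexp.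
- move=> s z s0 _ _ H; rewrite mul0r sum_generator; apply: sumr_ge0 => w _.
  by rewrite mulr_ge0 // subr_ge0 H.
- by move=> z _; rewrite kexp0.
Qed.

Section Coalescing.
Variables (R : realType) (T : finType) (r : T -> T -> R).
Hypothesis sym_r : sym_rates r.
Implicit Types (A B C D : {set T}) (F G : {set T} -> R) (a b x y : T).

Let r_ge0 x y : 0 <= r x y. Proof. by case: sym_r. Qed.
Let r_diag x : r x x = 0. Proof. by case: sym_r => _ []. Qed.

(* A jump from [a] to [b] acts on every configuration as the image under
   [arrow a b]; hitting [C] after the jump is hitting the preimage of [C] before
   it, which is the duality with the voter model. *)
Definition arrow a b z : T := if z == a then b else z.

(** Arrows from empty sites are included although they do nothing: the rates then no longer depend
    on the configuration, as duality requires. *)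
Definition coal_op F A : R := \sum_a \sum_b r a b * (F (arrow a b @: A)%SET - F A).

Lemma arrow_imset a b A : (arrow a b @: A)%SET = if a \in A then (A :\ a) :|: [set b] else A.
Proof.
apply/setP => z; apply/imsetP/idP => [[w wA ->]|].
  rewrite /arrow; have [wa|wa] := eqVneq w a.
    by rewrite -wa wA !inE eqxx orbT.
  by case: ifP => _ //; rewrite !inE wa wA.
case: ifP => aA.
  rewrite !inE => /orP[/andP[za zA]|/eqP ->].
    by exists z => //; rewrite /arrow (negbTE za).
  by exists a => //; rewrite /arrow eqxx.
move=> zA; exists z => //; rewrite /arrow; case: eqP => // za.
by move: zA; rewrite za aA.
Qed.

Lemma coal_opE F A : \sum_B generator (coal_rate r) A B * F B = coal_op F A.
Proof.
rewrite sum_generator /coal_rate /coal_op.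
transitivity (\sum_(a in A) \sum_b r a b * (F ((A :\ a) :|: [set b]) - F A)).
  under eq_bigr => B _ do rewrite mulr_suml.
  rewrite exchange_big /=; apply: eq_bigr => a aA.
  under eq_bigr => B _ do rewrite mulr_suml.
  rewrite exchange_big /=; apply: eq_bigr => b _.
  rewrite (bigD1 ((A :\ a) :|: [set b])) //= eqxx big1 ?addr0 // => B /negbTE ->.
  by rewrite mul0r.
rewrite big_mkcond; apply: eq_bigr => a _; case: ifP => aA.
  by apply: eq_bigr => b _; rewrite arrow_imset aA.
by rewrite big1 // => b _; rewrite arrow_imset aA subrr mulr0.
Qed.

Definition Ex (t : R) F : R := \sum_B kexp (generator (coal_rate r)) t (setTfin T) B * F B.

Lemma is_derive_Ex (t : R) F : is_derive t 1 (Ex ^~ F) (Ex t (coal_op F)).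
Proof.
have -> : Ex t (coal_op F) =
   \sum_B (\sum_C kexp (generator (coal_rate r)) t (setTfin T) C * generator (coal_rate r) C B) * F B.
  under [RHS]eq_bigr => B _ do rewrite mulr_suml.
  rewrite exchange_big /=; apply: eq_bigr => C _; rewrite -coal_opE mulr_sumr.
  by apply: eq_bigr => B _; rewrite mulrA.
apply: (@is_derive_sumf R _ xpredT (fun B s => kexp (generator (coal_rate r)) s (setTfin T) B * F B)) => B _.
have := is_derive_prod (is_derive_kexpr (generator (coal_rate r)) t (setTfin T) B) (is_derive_cst (F B) t 1).
by rewrite mulr0 addr0.
Qed.

Lemma Ex0 F : Ex 0 F = F (setTfin T).
Proof. exact: flow0. Qed.

Lemma ExD t F G : Ex t (fun A => F A + G A) = Ex t F + Ex t G.
Proof. by rewrite /Ex -big_split; apply: eq_bigr => B _; rewrite mulrDr. Qed.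

Lemma ExB t F G : Ex t (fun A => F A - G A) = Ex t F - Ex t G.
Proof. by rewrite /Ex -sumrB; apply: eq_bigr => B _; rewrite mulrBr. Qed.

Lemma ExZ t (c : R) F : Ex t (fun A => c * F A) = c * Ex t F.
Proof. by rewrite /Ex mulr_sumr; apply: eq_bigr => B _; rewrite mulrCA. Qed.

Lemma Ex_sum t (I : finType) (f : I -> {set T} -> R) :
  Ex t (fun A => \sum_i f i A) = \sum_i Ex t (f i).
Proof.
rewrite /Ex; under eq_bigr => B _ do rewrite mulr_sumr.
by rewrite exchange_big.
Qed.

Lemma Ex_ge0 t F : 0 <= t -> (forall A, 0 <= F A) -> 0 <= Ex t F.
Proof.
move=> t0 F0; apply: sumr_ge0 => B _; rewrite mulr_ge0 // kexp_generator_ge0 // => A C.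
by rewrite /coal_rate; do 2![apply: sumr_ge0 => ? _]; case: ifP.
Qed.

Lemma Ex_le t F G : 0 <= t -> (forall A, F A <= G A) -> Ex t F <= Ex t G.
Proof.
by move=> t0 H; rewrite -subr_ge0 -ExB; apply: Ex_ge0 => // A; rewrite subr_ge0.
Qed.

Lemma Ex_cst t (c : R) : Ex t (fun=> c) = c.
Proof.
rewrite -[RHS](Ex0 (fun=> c)).
apply: (@derive0_const R (Ex ^~ (fun=> c))) => s.
have := is_derive_Ex s (fun=> c).
rewrite (_ : Ex s (coal_op _) = 0) // /Ex big1 // => B _.
by rewrite /coal_op big1 ?mulr0 // => a _; rewrite big1 // => b _; rewrite subrr mulr0.
Qed.

Lemma Ex_sqr_le t F : 0 <= t -> Ex t F ^+ 2 <= Ex t (fun A => F A ^+ 2).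
Proof.
move=> t0; have : 0 <= Ex t (fun A => (F A - Ex t F) ^+ 2).
  by apply: Ex_ge0 => // A; exact: sqr_ge0.
have -> : Ex t (fun A => (F A - Ex t F) ^+ 2) =
    Ex t (fun A => F A ^+ 2 + ((- 2 * Ex t F) * F A + Ex t F ^+ 2)).
  by congr (Ex t _); apply/funext => A; ring.
rewrite !ExD ExZ Ex_cst => H; lra.
Qed.

Definition hit C A : R := [exists z in A, z \in C]%:R.

Lemma hit_arrow a b C A : hit C (arrow a b @: A)%SET = hit (arrow a b @^-1: C)%SET A.
Proof.
rewrite /hit; congr ((nat_of_bool _)%:R).
apply/existsP/existsP => -[z /andP[zA zC]].
  by case/imsetP: zA zC => w wA -> wC; exists w; rewrite wA inE.
by exists (arrow a b z); rewrite imset_f //=; rewrite inE in zC.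
Qed.

Lemma hit_mono C C' A : C \subset C' -> hit C A <= hit C' A.
Proof.
move=> /fintype.subsetP CC'; rewrite /hit; have [/existsP[z /andP[zA zC]]|_] := boolP [exists z in A, z \in C].
  by rewrite (_ : [exists z in A, z \in C'] = true) //; apply/existsP; exists z; rewrite zA CC'.
by rewrite ler0n.
Qed.

Lemma hit_ge0 C A : 0 <= hit C A.
Proof. exact: ler0n. Qed.

Let X2 t (C C' : {set T}) := Ex t (fun A => hit C A * hit C' A).

Let preim_sub a b C : b \notin C -> (arrow a b @^-1: C)%SET \subset C.
Proof.
move=> bC; apply/fintype.subsetP => z; rewrite inE /arrow.
by case: eqP => // _; rewrite (negbTE bC).
Qed.

Let sub_preim a b C : a \notin C -> C \subset (arrow a b @^-1: C)%SET.
Proof.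
move=> aC; apply/fintype.subsetP => z zC; rewrite inE /arrow; case: eqP => // za.
by move: zC; rewrite za (negbTE aC).
Qed.

Let preim_id a b C : (a \in C) = (b \in C) -> (arrow a b @^-1: C)%SET = C.
Proof.
by move=> ab; apply/setP => z; rewrite inE /arrow; case: eqP => // ->; rewrite ab.
Qed.

Let X2_mono t C1 C1' C2 C2' : 0 <= t -> C1 \subset C1' -> C2 \subset C2' ->
  X2 t C1 C2 <= X2 t C1' C2'.
Proof.
by move=> t0 s1 s2; apply: Ex_le => // A; apply: ler_pM; rewrite ?hit_ge0 // hit_mono.
Qed.

(* An arrow that changes both [D] and [C1, C2] takes a site from one side
   and gives it to the other, so the two increments have opposite signs. *)
Let opposite_moves t a b C1 C2 D : 0 <= t -> fintype.disjoint (mem C1) (mem D) -> fintype.disjoint (mem C2) (mem D) ->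
  (X2 t (arrow a b @^-1: C1)%SET (arrow a b @^-1: C2)%SET - X2 t C1 C2) *
  (Ex t (hit (arrow a b @^-1: D)%SET) - Ex t (hit D)) <= 0.
Proof.
move=> t0 d1 d2.
have nC1 z : z \in D -> z \notin C1 by move=> zD; rewrite (disjointFl d1).
have nC2 z : z \in D -> z \notin C2 by move=> zD; rewrite (disjointFl d2).
have [aD|aD] := boolP (a \in D); have [bD|bD] := boolP (b \in D).
- by rewrite (preim_id (C := D)) ?aD ?bD // subrr mulr0.
- apply: mulr_ge0_le0; rewrite ?subr_ge0 ?subr_le0.
    by apply: X2_mono => //; apply: sub_preim; [exact: nC1 | exact: nC2].
  by apply: Ex_le => // A; apply: hit_mono; exact: preim_sub.
- apply: mulr_le0_ge0; rewrite ?subr_ge0 ?subr_le0.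
    by apply: X2_mono => //; apply: preim_sub; [exact: nC1 | exact: nC2].
  by apply: Ex_le => // A; apply: hit_mono; exact: sub_preim.
- by rewrite (preim_id (C := D)) ?(negbTE aD) ?(negbTE bD) // subrr mulr0.
Qed.

(** The triple [(C1, C2, D)] evolves by the dual jumps [sh], which preserve disjointness. At a
    minimum of [X * Y - Z] a jump contributes the increment of this function, nonnegative, minus the
    product of increments from [opposite_moves], nonpositive. Two sets [C1], [C2] are carried so
    that the joint occupation of two sites can be compared with a third. *)
Lemma negative_correlation t C1 C2 D : 0 <= t ->
  fintype.disjoint (mem C1) (mem D) -> fintype.disjoint (mem C2) (mem D) ->
  Ex t (fun A => hit C1 A * hit C2 A * hit D A) <=
  Ex t (fun A => hit C1 A * hit C2 A) * Ex t (hit D).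
Proof.
move=> t0 d1 d2.
pose Z s (c : {set T} * {set T} * {set T}) : R := Ex s (fun A => hit c.1.1 A * hit c.1.2 A * hit c.2 A).
pose X s (c : {set T} * {set T} * {set T}) : R := X2 s c.1.1 c.1.2.
pose Y s (c : {set T} * {set T} * {set T}) : R := Ex s (hit c.2).
pose sh a b (c : {set T} * {set T} * {set T}) :=
  ((arrow a b @^-1: c.1.1)%SET, (arrow a b @^-1: c.1.2)%SET, (arrow a b @^-1: c.2)%SET).
pose op (f : {set T} * {set T} * {set T} -> R) c := \sum_a \sum_b r a b * (f (sh a b c) - f c).
have opE s (f : {set T} * {set T} * {set T} -> {set T} -> R) c :
    (forall a b A, f c (arrow a b @: A)%SET = f (sh a b c) A) ->
    Ex s (coal_op (f c)) = op (fun c => Ex s (f c)) c.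
  move=> H; rewrite /coal_op /op Ex_sum; apply: eq_bigr => a _.
  rewrite Ex_sum; apply: eq_bigr => b _; rewrite ExZ ExB; congr (_ * (Ex s _ - _)).
  by apply/funext => A.
have ZD (s : R) c : is_derive s 1 (Z ^~ c) (op (Z s) c).
  rewrite -(opE s (fun c A => hit c.1.1 A * hit c.1.2 A * hit c.2 A) c); first exact: is_derive_Ex.
  by move=> a b A; rewrite !hit_arrow.
have XD (s : R) c : is_derive s 1 (X ^~ c) (op (X s) c).
  rewrite -(opE s (fun c A => hit c.1.1 A * hit c.1.2 A) c); first exact: is_derive_Ex.
  by move=> a b A; rewrite !hit_arrow.
have YD (s : R) c : is_derive s 1 (Y ^~ c) (op (Y s) c).
  rewrite -(opE s (fun c A => hit c.2 A) c); first exact: is_derive_Ex.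
  by move=> a b A; rewrite !hit_arrow.
pose good (c : {set T} * {set T} * {set T}) :=
  fintype.disjoint (mem c.1.1) (mem c.2) && fintype.disjoint (mem c.1.2) (mem c.2).
have good_sh a b c : good c -> good (sh a b c).
  have H E E' : fintype.disjoint (mem E) (mem E') ->
      fintype.disjoint (mem (arrow a b @^-1: E)%SET) (mem (arrow a b @^-1: E')%SET).
    move=> d; rewrite fintype.disjoint_subset; apply/fintype.subsetP => z.
    by rewrite !inE => zE; apply/negbT; exact: (disjointFr d zE).
  by case/andP => H1 H2; apply/andP; split; exact: H.
rewrite -subr_ge0.
apply: (@min_principle R _ good (fun s c => X s c * Y s c - Z s c)
  (fun s c => op (X s) c * Y s c + X s c * op (Y s) c - op (Z s) c) 0 t _ _ _ t0 (C1, C2, D)).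
- move=> s c _; apply: is_derive_sub; exact: is_derive_prod.
- move=> s c s0 gc _ Hmin; rewrite mul0r /op mulr_suml mulr_sumr -big_split -sumrB.
  apply: sumr_ge0 => a _; rewrite /= mulr_suml mulr_sumr -big_split -sumrB.
  apply: sumr_ge0 => b _ /=.
  have := Hmin (sh a b c) (good_sh a b c gc).
  have /andP[g1 g2] := gc.
  have := opposite_moves a b s0 g1 g2.
  rewrite -/(X s (sh a b c)) -/(Y s (sh a b c)) -/(X s c) -/(Y s c).
  set x := X s c; set x' := X s _; set y := Y s c; set y' := Y s _; set z := Z s c; set z' := Z s _.
  move=> H1 H2.
  rewrite (_ : _ - _ = r a b * (x' * y' - z' - (x * y - z) - (x' - x) * (y' - y))); last by ring.
  by rewrite mulr_ge0 //; lra.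
- by move=> c _; rewrite /X /Y /Z /X2 !Ex0 subrr.
- by rewrite /good /= d1 d2.
Qed.

End Coalescing.

(** * Correlation functions of the occupied set and the rate of merging *)

Section Occupation.
Variables (R : realType) (T : finType) (r : T -> T -> R).
Hypothesis sym_r : sym_rates r.
Hypothesis trans_r : transitive_chain r.
Hypothesis T_gt1 : (1 < #|T|)%N.
Implicit Types (A B : {set T}) (a b x y z : T) (p : T * T).

Let r_ge0 x y : 0 <= r x y. Proof. by case: sym_r. Qed.
Let r_sym x y : r x y = r y x. Proof. by case: sym_r => _ []. Qed.
Let r_diag x : r x x = 0. Proof. by case: sym_r => _ []. Qed.
Let rate1 x : \sum_y r x y = 1. Proof. by case: trans_r => _ /(_ x). Qed.
Let n : R := #|T|%:R.
Let n_gt0 : 0 < n. Proof. by rewrite ltr0n (ltn_trans _ T_gt1). Qed.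

Definition occ x A : R := (x \in A)%:R.

Lemma hit_set1 x A : hit R (finset.set1 x) A = occ x A.
Proof.
rewrite /hit /occ; congr ((nat_of_bool _)%:R); apply/existsP/idP => [[z]|xA].
  by rewrite inE => /andP[zA /eqP <-].
by exists x; rewrite xA inE eqxx.
Qed.

Lemma occ_idem x A : occ x A * occ x A = occ x A.
Proof. by rewrite /occ; case: (x \in A); rewrite ?mulr1 ?mulr0. Qed.

Lemma occ_ge0 x A : 0 <= occ x A.
Proof. exact: ler0n. Qed.

Lemma occ_le1 x A : occ x A <= 1.
Proof. by rewrite lern1 leq_b1. Qed.

Lemma PoccE x t : Pocc r x t = Ex r t (occ x).
Proof.
rewrite /Pocc big_mkcond; apply: eq_bigr => B _.
by rewrite /occ; case: (x \in B); rewrite ?mulr1 ?mulr0.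
Qed.

Lemma coal_rate_arrow A B : coal_rate r A B =
  \sum_(a in A) \sum_b (if B == (arrow a b @: A)%SET then r a b else 0).
Proof. by apply: eq_bigr => a aA; apply: eq_bigr => b _; rewrite arrow_imset aA. Qed.

Lemma coal_rate_map (phi : T -> T) A B : bijective phi ->
  (forall x y, r (phi x) (phi y) = r x y) ->
  coal_rate r (phi @: A)%SET (phi @: B)%SET = coal_rate r A B.
Proof.
move=> bphi Hr; have iphi := bij_inj bphi; rewrite !coal_rate_arrow.
rewrite big_imset /=; last by move=> ? ? _ _; exact: iphi.
apply: eq_bigr => a _; rewrite (reindex phi) /=; last exact: onW_bij.
apply: eq_bigr => b _; rewrite Hr.
have -> : (arrow (phi a) (phi b) @: (phi @: A) = phi @: (arrow a b @: A))%SET.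
  rewrite -!imset_comp; apply: eq_imset => z /=; rewrite /arrow (inj_eq iphi).
  by case: ifP.
by rewrite (inj_eq (imset_inj iphi)).
Qed.

Lemma Pocc_const x y t : Pocc r x t = Pocc r y t.
Proof.
have [phi [bphi [<- Hr]]] := trans_r.1 x y; have iphi := bij_inj bphi.
have bim : bijective (fun A => phi @: A)%SET by apply: injF_bij; exact: imset_inj.
rewrite !PoccE /Ex [RHS](reindex (fun A => phi @: A)%SET) /=; last exact: onW_bij.
apply: eq_bigr => B _; congr (_ * _); last by rewrite /occ mem_imset.
rewrite -[in RHS](_ : (phi @: setTfin T)%SET = setTfin T).
  rewrite (kexp_map _ _ _ bim) // => A C.
  exact: (@generator_map R _ _ (fun A => (phi @: A)%SET) A C bim
    (fun A B => coal_rate_map A B bphi Hr)).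
apply/setP => z; rewrite [RHS]inE; apply/imsetP.
by have [psi phiK psiK] := bphi; exists (psi z); rewrite ?inE ?psiK.
Qed.

Variable x0 : T.
Let P t := Pocc r x0 t.
Let PE x t : Ex r t (occ x) = P t.
Proof. by rewrite -PoccE; exact: Pocc_const. Qed.

Definition rho (t : R) p : R := Ex r t (fun A => occ p.1 A * occ p.2 A).
Definition rho3 (t : R) x y z : R := Ex r t (fun A => occ x A * occ y A * occ z A).

Lemma rho_diag t x : rho t (x, x) = P t.
Proof. by rewrite -(PE x); congr (Ex r t _); apply/funext => A; exact: occ_idem. Qed.

Lemma rho_ge0 t p : 0 <= t -> 0 <= rho t p.
Proof. by move=> t0; apply: Ex_ge0 => // A; rewrite mulr_ge0 ?occ_ge0. Qed.

Lemma rho3_ge0 t x y z : 0 <= t -> 0 <= rho3 t x y z.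
Proof. by move=> t0; apply: Ex_ge0 => // A; rewrite !mulr_ge0 ?occ_ge0. Qed.

Let disj1 x y : x != y -> fintype.disjoint (mem (finset.set1 x)) (mem (finset.set1 y)).
Proof. by move=> xy; rewrite finset.disjoints1 inE. Qed.

Lemma rho3_le t x y z : 0 <= t -> x != z -> y != z -> rho3 t x y z <= rho t (x, y) * P t.
Proof.
move=> t0 xz yz; rewrite -(PE z).
have := negative_correlation sym_r t0 (disj1 xz) (disj1 yz).
have -> : Ex r t (hit R (finset.set1 z)) = Ex r t (occ z).
  by congr (Ex r t _); apply/funext => A; rewrite hit_set1.
have -> : Ex r t (fun A => hit R (finset.set1 x) A * hit R (finset.set1 y) A) = rho t (x, y).
  by congr (Ex r t _); apply/funext => A; rewrite !hit_set1.
apply: le_trans; rewrite le_eqVlt; apply/orP; left; apply/eqP.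
by congr (Ex r t _); apply/funext => A; rewrite !hit_set1.
Qed.

(** The three-point inequality with its first two sites equal. *)
Lemma rho_le t p : 0 <= t -> offd p -> rho t p <= P t ^+ 2.
Proof.
case: p => x y t0 xy; have := rho3_le t0 xy xy.
rewrite rho_diag -expr2; apply: le_trans; rewrite le_eqVlt; apply/orP; left; apply/eqP.
by congr (Ex r t _); apply/funext => A; rewrite occ_idem.
Qed.

Lemma rho_le_P t p : 0 <= t -> rho t p <= P t.
Proof.
move=> t0; rewrite -(PE p.1); apply: Ex_le => // A.
by rewrite ler_piMr ?occ_ge0 ?occ_le1.
Qed.

Lemma Pocc_ge0 t : 0 <= t -> 0 <= P t.
Proof. by move=> t0; rewrite -(PE x0); apply: Ex_ge0 => // A; exact: occ_ge0. Qed.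

Let occ_arrow a b x A : a != b -> occ x (arrow a b @: A)%SET =
  if x == b then occ a A + occ x A - occ a A * occ x A
  else if x == a then 0 else occ x A.
Proof.
move=> ab; rewrite arrow_imset /occ; case: ifP => aA; rewrite ?inE.
  have [->|xb] := eqVneq x b; first by rewrite orbT /=; ring.
  by rewrite orbF; have [->|xa] := eqVneq x a.
have [->|xb] := eqVneq x b; first by rewrite mulr0n; ring.
by have [->|xa] := eqVneq x a; rewrite ?aA.
Qed.

(** A particle at [x] leaves at rate 1; a jump from [a] fills [x] only if [x] was empty, whence the
    subtracted product. *)
Let coal_op_occ x A : coal_op r (occ x) A =
  - occ x A + \sum_a r x a * (occ a A - occ x A * occ a A).
Proof.
rewrite /coal_op.
transitivity (\sum_a \sum_b (r a b * ((a == x)%:R * - occ x A) +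
    r a b * ((b == x)%:R * (occ a A - occ x A * occ a A)))).
  apply: eq_bigr => a _; apply: eq_bigr => b _; rewrite -mulrDr.
  have [->|ab] := eqVneq a b; first by rewrite r_diag !mul0r.
  congr (_ * _); rewrite occ_arrow //.
  have [xb|xb] := eqVneq x b.
    by rewrite -xb in ab; rewrite (negbTE ab) /=; ring.
  by have [xa|xa] := eqVneq x a; rewrite ?mulr0n ?mulr1n /=; ring.
under eq_bigr => a _ do rewrite big_split /=.
rewrite big_split /=; congr (_ + _).
  rewrite (bigD1 x) //= [X in _ + X]big1 ?addr0; last first.
    by move=> a /negbTE ->; rewrite big1 // => b _; rewrite mul0r mulr0.
  by rewrite -mulr_suml rate1 eqxx !mul1r.
apply: eq_bigr => a _; rewrite (bigD1 x) //= [X in _ + X]big1 ?addr0; last first.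
  by move=> b /negbTE ->; rewrite mul0r mulr0.
by rewrite eqxx mul1r r_sym.
Qed.

Definition merge_rate t x : R := \sum_y r x y * rho t (x, y).

Lemma is_derive_Pocc (t : R) x : is_derive t 1 P (- merge_rate t x).
Proof.
have := is_derive_Ex r t (occ x).
rewrite (_ : Ex r ^~ (occ x) = P); last by apply/funext => s; exact: PE.
rewrite (_ : Ex r t (coal_op r (occ x)) = - merge_rate t x) //.
rewrite (_ : coal_op r (occ x) = fun A => (- 1) * occ x A + \sum_a r x a * (occ a A - occ x A * occ a A)); last first.
  by apply/funext => A; rewrite coal_op_occ mulN1r.
rewrite ExD ExZ PE Ex_sum.
under eq_bigr => a _ do rewrite ExZ ExB PE mulrBr.
by rewrite sumrB -mulr_suml rate1 /merge_rate; ring.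
Qed.

Lemma merge_rateE t x y : merge_rate t x = merge_rate t y.
Proof. by have := is_derive_uniq (is_derive_Pocc t x) (is_derive_Pocc t y) => /oppr_inj. Qed.

Let drho t x y : R := - (2 * rho t (x, y)) +
  \sum_a r x a * ((a != y)%:R * (rho t (a, y) - rho3 t x a y)) +
  \sum_a r y a * ((a != x)%:R * (rho t (x, a) - rho3 t y a x)).

Let coal_op_occ2 x y A : x != y -> coal_op r (fun A => occ x A * occ y A) A =
  - 2 * (occ x A * occ y A) +
  (\sum_a r x a * ((a != y)%:R * (occ a A * occ y A - occ x A * occ a A * occ y A)) +
  \sum_a r y a * ((a != x)%:R * (occ x A * occ a A - occ y A * occ a A * occ x A))).
Proof.
move=> xy; rewrite /coal_op.
transitivity (\sum_a \sum_b
  (r a b * ((a == x)%:R * - (occ x A * occ y A)) +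
   r a b * ((a == y)%:R * - (occ x A * occ y A)) +
   (r a b * ((b == x)%:R * ((a != y)%:R * (occ a A * occ y A - occ x A * occ a A * occ y A))) +
    r a b * ((b == y)%:R * ((a != x)%:R * (occ x A * occ a A - occ y A * occ a A * occ x A)))))).
  apply: eq_bigr => a _; apply: eq_bigr => b _; rewrite -!mulrDr.
  have [->|ab] := eqVneq a b; first by rewrite r_diag !mul0r.
  congr (_ * _); rewrite !occ_arrow //.
  have yx : y == x = false by rewrite eq_sym (negbTE xy).
  have xy' : x == y = false by rewrite (negbTE xy).
  have [xb|xb] := eqVneq x b.
    rewrite -xb in ab *; rewrite yx xy' (negbTE ab) /=.
    by have [_|_] := eqVneq y a; rewrite /=; ring.
  have [xa|xa] := eqVneq x a.
    by rewrite -xa xy' /=; ring.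
  have [yb|yb] := eqVneq y b.
    by rewrite -yb in ab *; rewrite (negbTE ab) /=; ring.
  by have [ya|ya] := eqVneq y a; rewrite /=; ring.
have S1 (c : R) z : \sum_a \sum_b r a b * ((a == z)%:R * c) = c.
  rewrite (bigD1 z) //= [X in _ + X]big1 ?addr0; last first.
    by move=> a /negbTE ->; rewrite big1 // => b _; rewrite mul0r mulr0.
  by rewrite -mulr_suml rate1 eqxx !mul1r.
have S2 (f : T -> R) z : \sum_a \sum_b r a b * ((b == z)%:R * f a) = \sum_a r z a * f a.
  apply: eq_bigr => a _; rewrite (bigD1 z) //= [X in _ + X]big1 ?addr0; last first.
    by move=> b /negbTE ->; rewrite mul0r mulr0.
  by rewrite eqxx mul1r r_sym.
under eq_bigr => a _ do rewrite !big_split /=.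
rewrite !big_split /= !S1 -!S2.
by congr (_ + _); ring.
Qed.

Let is_derive_rho (t : R) x y : x != y -> is_derive t 1 (rho ^~ (x, y)) (drho t x y).
Proof.
move=> xy; have := is_derive_Ex r t (fun A => occ x A * occ y A).
rewrite (_ : Ex r t (coal_op r _) = drho t x y) //.
rewrite (_ : coal_op r _ = fun A => - 2 * (occ x A * occ y A) +
  (\sum_a r x a * ((a != y)%:R * (occ a A * occ y A - occ x A * occ a A * occ y A)) +
  \sum_a r y a * ((a != x)%:R * (occ x A * occ a A - occ y A * occ a A * occ x A)))); last first.
  by apply/funext => A; exact: coal_op_occ2.
rewrite ExD ExD ExZ !Ex_sum /drho -addrA mulNr; congr (_ + (_ + _)).
  by apply: eq_bigr => a _; rewrite !ExZ ExB.
by apply: eq_bigr => a _; rewrite !ExZ ExB.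
Qed.

(** The value 0 on the diagonal, where [rho] is [P], is the boundary value of the killed pair; with
    it [rho] solves the killed equation up to [triple]. *)
Let rhoo t p := if offd p then rho t p else 0.

Let triple t x y : R := \sum_a r x a * ((a != y)%:R * rho3 t x a y) +
  \sum_a r y a * ((a != x)%:R * rho3 t y a x).

Let drhoE t x y : x != y -> drho t x y = plap r (rhoo t) (x, y) - triple t x y.
Proof.
move=> xy; rewrite /plap /lap /=.
have -> : rhoo t (x, y) = rho t (x, y) by rewrite /rhoo /offd /= xy.
under eq_bigr => a _ do rewrite mulrBr.
under [X in _ = _ + X - _]eq_bigr => a _ do rewrite mulrBr.
rewrite !sumrB -!mulr_suml !rate1 !mul1r /drho /triple.
have -> : \sum_i r x i * rhoo t (i, y) = \sum_a r x a * ((a != y)%:R * rho t (a, y)).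
  by apply: eq_bigr => a _; rewrite /rhoo /offd /=; case: (a != y); rewrite ?mul1r ?mul0r.
have -> : \sum_i r y i * rhoo t (x, i) = \sum_a r y a * ((a != x)%:R * rho t (x, a)).
  by apply: eq_bigr => a _; rewrite /rhoo /offd /= eq_sym; case: (a != x); rewrite ?mul1r ?mul0r.
under eq_bigr => a _ do rewrite !mulrBr.
under [X in _ + X = _]eq_bigr => a _ do rewrite !mulrBr.
by rewrite !sumrB; ring.
Qed.

Let triple_ge0 t x y : 0 <= t -> 0 <= triple t x y.
Proof.
by move=> t0; rewrite addr_ge0 //; apply: sumr_ge0 => a _; rewrite !mulr_ge0 ?rho3_ge0.
Qed.

Let triple_le t x y : 0 <= t -> x != y -> triple t x y <= 2 * P t * merge_rate t x0.
Proof.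
move=> t0 xy.
have H u v : u != v -> \sum_a r u a * ((a != v)%:R * rho3 t u a v) <= P t * merge_rate t x0.
  move=> uv; rewrite (merge_rateE t x0 u) /merge_rate mulr_sumr.
  apply: ler_sum => a _; rewrite [leRHS]mulrCA; apply: ler_wpM2l => //.
  have [av|av] := eqVneq a v; first by rewrite mul0r mulr_ge0 ?Pocc_ge0 ?rho_ge0.
  by rewrite mul1r mulrC rho3_le.
have := H x y xy; have := H y x _; rewrite eq_sym xy => /(_ isT).
by rewrite /triple => ? ?; lra.
Qed.

Lemma merge_rate_ge0 t x : 0 <= t -> 0 <= merge_rate t x.
Proof. by move=> t0; apply: sumr_ge0 => y _; rewrite mulr_ge0 ?rho_ge0. Qed.

Lemma merge_rate_le t x : 0 <= t -> merge_rate t x <= P t ^+ 2.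
Proof.
move=> t0; rewrite -[leRHS]mul1r -(rate1 x) mulr_suml; apply: ler_sum => y _.
have [<-|xy] := eqVneq x y; first by rewrite r_diag !mul0r.
by rewrite ler_wpM2l // rho_le.
Qed.

Lemma merge_rate_le_P t x : 0 <= t -> merge_rate t x <= P t.
Proof.
move=> t0; rewrite -[leRHS]mul1r -(rate1 x) mulr_suml; apply: ler_sum => y _.
by rewrite ler_wpM2l // rho_le_P.
Qed.

Lemma Pocc_anti s t : 0 <= s -> s <= t -> P t <= P s.
Proof.
move=> s0 st; have := @derive_le R P (fun t => - merge_rate t x0) s t 0 st (fun u _ => is_derive_Pocc u x0).
move=> H; have : P t - P s <= 0 * (t - s); last lra.
by apply: H => u /andP[su _]; rewrite oppr_le0 merge_rate_ge0 // (le_trans s0).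
Qed.

Lemma Pocc_start : P 0 = 1.
Proof. by rewrite -(PE x0) Ex0 /occ inE. Qed.

Let sum_merge t : \sum_p r p.1 p.2 * rhoo t p = n * merge_rate t x0.
Proof.
transitivity (\sum_x merge_rate t x); last first.
  under eq_bigr => x _ do rewrite (merge_rateE t x x0).
  by rewrite sumr_const -mulr_natl.
rewrite /merge_rate pair_bigA /=; apply: eq_bigr => -[x y] _ /=.
rewrite /rhoo /offd /=; have [->|//] := eqVneq x y.
by rewrite r_diag !mul0r.
Qed.

Let sum_rates : \sum_p r p.1 p.2 = n.
Proof.
rewrite -(pair_bigA _ (fun x y => r x y)) /=.
by under eq_bigr => x _ do rewrite rate1; rewrite sumr_const.
Qed.

Let sum_rates_offd : \sum_p r p.1 p.2 * (offd p)%:R = n.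
Proof.
rewrite -sum_rates; apply: eq_bigr => -[x y] _; rewrite /offd /=.
by have [->|_] := eqVneq x y; rewrite ?r_diag ?mul0r ?mulr1.
Qed.

Lemma merge_rate_upper t0 s : 0 <= t0 -> 0 <= s ->
  merge_rate (t0 + s) x0 <= collision r s / n * P t0 ^+ 2.
Proof.
move=> t00 s0.
have H p : 0 <= P t0 ^+ 2 * survival r s p - rhoo (1 * s + t0) p.
  apply: (@plap_min_principle R T r sym_r (@offd T)
    (fun s p => P t0 ^+ 2 * survival r s p - rhoo (1 * s + t0) p)
    (fun s p => P t0 ^+ 2 * plap r (survival r s) p - 1 * drho (1 * s + t0) p.1 p.2) s) => //.
  - move=> u [x y] op; apply: is_derive_sub.
      by apply: is_derive_scale; exact: survival_offd.
    apply: (@is_derive_affine R (rhoo ^~ (x, y))).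
    rewrite /rhoo op; exact: is_derive_rho.
  - move=> u [x y] u0 op; rewrite plapB plapZ lerB // mul1r drhoE //=.
    by rewrite gerBl triple_ge0 // mul1r addr_ge0.
  - by move=> u q _ oq; rewrite survival_diag // mulr0 /rhoo (negbTE oq) subrr.
  - by move=> q oq; rewrite survival0 oq mulr0 add0r mulr1 /rhoo oq subr_ge0 rho_le.
have : 0 <= \sum_p r p.1 p.2 * (P t0 ^+ 2 * survival r s p - rhoo (1 * s + t0) p).
  by apply: sumr_ge0 => p _; rewrite mulr_ge0.
under eq_bigr => p _ do rewrite mulrBr.
rewrite sumrB sum_merge mul1r [s + t0]addrC subr_ge0.
under eq_bigr => p _ do rewrite mulrCA.
rewrite -mulr_sumr -/(collision r s) => H2.
by rewrite mulrAC ler_pdivlMr // mulrC [collision r s * _]mulrC.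
Qed.

Let w t p : R := if offd p then P t ^+ 2 - rho t p else 0.

Let w_ge0 t p : 0 <= t -> 0 <= w t p.
Proof. by move=> t0; rewrite /w; case: ifP => // op; rewrite subr_ge0 rho_le. Qed.

Let sum_w t : 0 <= t -> \sum_p w t p <= n * P t.
Proof.
move=> t0.
have E1 : \sum_p rho t p = \sum_p rhoo t p + n * P t.
  have -> : n * P t = \sum_p (if offd p then 0 else rho t p).
    transitivity (\sum_x \sum_y (if x != y then 0 else rho t (x, y))).
      rewrite /n -sumr_const mulr_suml; apply: eq_bigr => x _.
      rewrite mul1r (bigD1 x) //= eqxx /= big1 ?addr0 ?rho_diag // => y.
      by rewrite eq_sym => ->.
    by rewrite pair_bigA /=; apply: eq_bigr => -[].
  rewrite -big_split /=; apply: eq_bigr => p _; rewrite /rhoo.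
  by case: (offd p); rewrite ?addr0 ?add0r.
have E2 : \sum_p rho t p = Ex r t (fun A => (\sum_x occ x A) ^+ 2).
  transitivity (\sum_x \sum_y rho t (x, y)); first by rewrite [RHS]pair_bigA; apply: eq_bigr => -[].
  rewrite (_ : (fun A => _) = fun A => \sum_x \sum_y occ x A * occ y A); last first.
    apply/funext => A; rewrite expr2 mulr_suml; apply: eq_bigr => x _.
    by rewrite mulr_sumr.
  by rewrite Ex_sum; apply: eq_bigr => x _; rewrite Ex_sum.
have E3 : (n * P t) ^+ 2 <= \sum_p rho t p.
  rewrite E2; apply: le_trans (Ex_sqr_le sym_r _ t0).
  rewrite Ex_sum; under eq_bigr => x _ do rewrite PE.
  by rewrite sumr_const -[P t *+ _]mulr_natl.
have E4 : \sum_p w t p = P t ^+ 2 * (n ^+ 2 - n) - \sum_p rhoo t p.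
  rewrite -sum_offd1 mulr_sumr -sumrB; apply: eq_bigr => p _.
  by rewrite /w /rhoo; case: (offd p); rewrite ?mulr1 ?mulr0 ?subrr.
have : 0 <= n * P t ^+ 2 by rewrite mulr_ge0 ?sqr_ge0 // ltW.
by rewrite E4; rewrite exprMn in E3; lra.
Qed.

(* The deficit [w = P^2 - rho] satisfies [w' <= plap w + 2 r P^2] off the
   diagonal: the triple correlations in [- rho'] are at most [P rho], hence are
   absorbed by the derivative [- 2 P (sum r rho)] of [P^2].  Comparing [w] with
   the killed flow started from its value at time [t0] gives the bound. *)
Lemma merge_rate_lower t0 s : 0 <= t0 -> 0 <= s ->
  P (t0 + s) ^+ 2 - P t0 ^+ 2 * (1 - collision r s / n) - heat_diag r s * P t0
  <= merge_rate (t0 + s) x0.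
Proof.
move=> t00 s0.
(* Duhamel form: the first term carries the initial deficit, the second answers the source
   [2 * r * P t0 ^+ 2], since [offd - survival] solves the killed equation with source [2 * r]. *)
pose W s p := kflow r (w t0) s p + P t0 ^+ 2 * ((offd p)%:R - survival r s p).
pose dW s p := plap r (kflow r (w t0) s) p + P t0 ^+ 2 * (0 - plap r (survival r s) p).
have plapW u q : plap r (W u) q = plap r (kflow r (w t0) u) q +
    P t0 ^+ 2 * (plap r (fun q => (offd q)%:R) q - plap r (survival r u) q).
  by rewrite -plapB -plapZ /plap /lap addrACA -!big_split /=; apply: eq_bigr => z _; rewrite /W; ring.
have plapw u q : offd q -> plap r (w u) q = P u ^+ 2 * (- 2 * r q.1 q.2) - plap r (rhoo u) q.
  move=> oq; rewrite -(plap_offd sym_r oq) -plapZ -plapB; congr (plap r _ q).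
  by apply/funext => p; rewrite /w /rhoo; case: (offd p); rewrite ?mulr1 ?mulr0 ?subrr.
have H p : 0 <= W s p - w (1 * s + t0) p.
  apply: (@plap_min_principle R T r sym_r (@offd T)
    (fun s p => W s p - w (1 * s + t0) p)
    (fun s p => dW s p - 1 * ((- merge_rate (1 * s + t0) x0 * P (1 * s + t0) +
       P (1 * s + t0) * - merge_rate (1 * s + t0) x0) - drho (1 * s + t0) p.1 p.2)) s) => //.
  - move=> u [x y] op; apply: is_derive_sub.
      apply: is_derive_add; first exact: kflow_offd.
      apply: is_derive_scale; apply: is_derive_sub; exact: survival_offd.
    apply: (@is_derive_affine R (w ^~ (x, y))); rewrite /w op.
    apply: is_derive_sub; last exact: is_derive_rho.
    rewrite (_ : (fun s => P s ^+ 2) = fun s => P s * P s); last by apply/funext => v; rewrite expr2.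
    by apply: is_derive_prod; exact: is_derive_Pocc.
  - move=> u [x y] u0 op; rewrite plapB plapW plapw // plap_offd // mul1r /dW drhoE //=.
    set v := u + t0.
    have v0 : 0 <= v by rewrite addr_ge0.
    (* The actual source, with [P v], is dominated by the one frozen at time [t0]. *)
    have Hv : P v ^+ 2 <= P t0 ^+ 2.
      by rewrite lerXn2r ?nnegrE ?Pocc_ge0 // Pocc_anti // /v lerDr.
    have /= := triple_le v0 op; have : r x y * P v ^+ 2 <= r x y * P t0 ^+ 2 by rewrite ler_wpM2l.
    by move=> ? ?; lra.
  - move=> u q _ oq; rewrite /W survival_diag // kflow_diag // /w !(negbTE oq).
    by rewrite subrr mulr0 addr0 subrr.
  - move=> q oq; rewrite /W survival0 subrr mulr0 addr0 kflow0 mulr0 add0r subrr //.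
have : 0 <= \sum_p r p.1 p.2 * (W s p - w (1 * s + t0) p).
  by apply: sumr_ge0 => p _; rewrite mulr_ge0.
under eq_bigr => p _ do rewrite mulrBr.
rewrite sumrB mul1r [s + t0]addrC.
set t := t0 + s.
have -> : \sum_p r p.1 p.2 * w t p = P t ^+ 2 * n - n * merge_rate t x0.
  rewrite -sum_merge -sum_rates_offd mulr_sumr -sumrB; apply: eq_bigr => p _.
  by rewrite /w /rhoo; case: (offd p) => /=; ring.
have -> : \sum_p r p.1 p.2 * W s p = \sum_p r p.1 p.2 * kflow r (w t0) s p +
    P t0 ^+ 2 * (n - collision r s).
  rewrite -sum_rates_offd /collision -sumrB mulr_sumr -big_split /=.
  by apply: eq_bigr => p _; rewrite /W; ring.
have H1 : \sum_p r p.1 p.2 * kflow r (w t0) s p <= heat_diag r s * \sum_p w t0 p.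
  apply: (sum_rates_kflow_le sym_r T_gt1 trans_r s0) => [p|p /negbTE op].
    exact: w_ge0.
  by rewrite /w op.
have e0 : 0 <= heat_diag r s.
  by rewrite -(heat_diagE T_gt1 trans_r s x0); exact: heat_ge0.
have H2 := ler_wpM2l e0 (sum_w t00).
move=> H3.
rewrite -(ler_pM2l n_gt0).
have -> : n * (P t ^+ 2 - P t0 ^+ 2 * (1 - collision r s / n) - heat_diag r s * P t0) =
  n * P t ^+ 2 - P t0 ^+ 2 * (n - collision r s) - heat_diag r s * (n * P t0).
  by field; rewrite gt_eqF.
lra.
Qed.

End Occupation.

(** * From window estimates to the growth of the inverse occupation probability *)

Section Riccati.
Variables (R : realType) (P B al e : R -> R).
Hypothesis P0 : P 0 = 1.
Hypothesis P' : forall t : R, is_derive t 1 P (- B t).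
Hypothesis B_ge0 : forall t, 0 <= t -> 0 <= B t.
Hypothesis B_le_P : forall t, 0 <= t -> B t <= P t.
Hypothesis B_le_sqr : forall t, 0 <= t -> B t <= P t ^+ 2.
Hypothesis al_ge0 : forall s, 0 <= s -> 0 <= al s.
Hypothesis al_le1 : forall s, 0 <= s -> al s <= 1.
Hypothesis al_anti : forall s t, 0 <= s -> s <= t -> al t <= al s.
Hypothesis e_ge0 : forall s, 0 <= s -> 0 <= e s.
Hypothesis B_upper : forall t s, 0 <= t -> 0 <= s -> B (t + s) <= al s * P t ^+ 2.
Hypothesis B_lower : forall t s, 0 <= t -> 0 <= s ->
  P (t + s) ^+ 2 - P t ^+ 2 * (1 - al s) - e s * P t <= B (t + s).

(** [B <= P] makes [expR t * P t] nondecreasing, so that [1 / P] can be used. *)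
Lemma occupation_gt0 t : 0 <= t -> 0 < P t.
Proof.
move=> t0; have H (s : R) : is_derive s 1 (fun s => expR s * P s) (expR s * P s + expR s * - B s).
  exact: is_derive_prod.
have := @ge0_derive_le R _ _ 0 t t0 (fun s _ => H s).
rewrite expR0 P0 mulr1 => /(_ _) H1.
have : 1 <= expR t * P t.
  by apply: H1 => s /andP[s0 _]; rewrite -mulrDr mulr_ge0 ?expR_ge0 // subr_ge0 B_le_P.
move=> H2; have : 0 < expR t * P t by exact: lt_le_trans H2.
by rewrite pmulr_rgt0 ?expR_gt0.
Qed.

Let phi t := (P t)^-1.

Let phi' (t : R) : 0 <= t -> is_derive t 1 phi (B t * phi t ^+ 2).
Proof.
move=> t0; have := is_derive_inv (lt0r_neq0 (occupation_gt0 t0)) (P' t).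
by rewrite opprK /phi exprVn.
Qed.

Let phi_gt0 t : 0 <= t -> 0 < phi t.
Proof. by move=> t0; rewrite invr_gt0 occupation_gt0. Qed.

Let Pphi t : 0 <= t -> P t * phi t = 1.
Proof. by move=> t0; rewrite /phi mulfV // gt_eqF // occupation_gt0. Qed.

Let phi_slope s t : 0 <= s -> s <= t -> phi s <= phi t <= phi s + (t - s).
Proof.
move=> s0 st.
have D u : s <= u <= t -> is_derive u 1 phi (B u * phi u ^+ 2).
  by move=> /andP[su _]; apply: phi'; exact: le_trans su.
apply/andP; split.
  apply: (ge0_derive_le st D) => u /andP[su _].
  by rewrite mulr_ge0 ?sqr_ge0 // B_ge0 // (le_trans s0).
have : phi t - phi s <= 1 * (t - s); last lra.
apply: (derive_le st D) => u /andP[su _].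
have u0 : 0 <= u by exact: le_trans su.
have -> : 1 = P u ^+ 2 * phi u ^+ 2 by rewrite -exprMn Pphi // expr1n.
by rewrite ler_wpM2r ?sqr_ge0 // B_le_sqr.
Qed.

Let phi0 : phi 0 = 1. Proof. by rewrite /phi P0 invr1. Qed.

Let phi_le t : 0 <= t -> phi t <= 1 + t.
Proof. by move=> t0; have /andP[_] := phi_slope (lexx 0) t0; rewrite phi0 subr0. Qed.

(** The window estimate compares with [P t] at the start of the window; the growth factor [rho] of
    [phi] converts it into a bound on the speed of [phi] at the end. *)
Let speed_upper t s rho : 0 <= t -> 0 <= s -> phi (t + s) <= rho * phi t ->
  B (t + s) * phi (t + s) ^+ 2 <= al s * rho ^+ 2.
Proof.
move=> t0 s0 H; have ts0 : 0 <= t + s by rewrite addr_ge0.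
have H2 : phi (t + s) ^+ 2 <= (rho * phi t) ^+ 2.
  by rewrite lerXn2r // nnegrE ltW // ?phi_gt0 // (lt_le_trans _ H) // phi_gt0.
apply: le_trans (ler_wpM2r (sqr_ge0 _) (B_upper t0 s0)) _.
apply: (@le_trans _ _ (al s * P t ^+ 2 * (rho * phi t) ^+ 2)).
  by apply: ler_wpM2l H2; rewrite mulr_ge0 ?sqr_ge0 // al_ge0.
rewrite (_ : _ * _ * _ = al s * rho ^+ 2 * (P t * phi t) ^+ 2); last by ring.
by rewrite Pphi // expr1n mulr1.
Qed.

Let speed_lower t s rho : 0 <= t -> 0 <= s -> phi (t + s) <= rho * phi t ->
  1 - rho ^+ 2 * (1 - al s) - e s * rho * phi (t + s) <= B (t + s) * phi (t + s) ^+ 2.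
Proof.
move=> t0 s0 H; have ts0 : 0 <= t + s by rewrite addr_ge0.
have p1 := phi_gt0 ts0; have p0 := phi_gt0 t0.
have H2 : phi (t + s) ^+ 2 <= (rho * phi t) ^+ 2.
  by rewrite lerXn2r // nnegrE ltW // (lt_le_trans p1).
apply: le_trans (ler_wpM2r (sqr_ge0 _) (B_lower t0 s0)).
rewrite !mulrBl -[P (t + s) ^+ 2 * _]exprMn Pphi // expr1n.
have A1 : P t ^+ 2 * (1 - al s) * phi (t + s) ^+ 2 <= rho ^+ 2 * (1 - al s).
  apply: (@le_trans _ _ (P t ^+ 2 * (1 - al s) * (rho * phi t) ^+ 2)).
    by apply: ler_wpM2l H2; rewrite mulr_ge0 ?sqr_ge0 // subr_ge0 al_le1.
  rewrite (_ : _ * _ * _ = rho ^+ 2 * (1 - al s) * (P t * phi t) ^+ 2); last by ring.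
  by rewrite Pphi // expr1n mulr1.
have A2 : e s * P t * phi (t + s) ^+ 2 <= e s * rho * phi (t + s).
  apply: (@le_trans _ _ (e s * P t * (rho * phi t * phi (t + s)))).
    apply: ler_wpM2l; first by rewrite mulr_ge0 ?e_ge0 // ltW // occupation_gt0.
    by rewrite expr2 ler_pM2r.
  rewrite (_ : _ * _ * _ = e s * rho * phi (t + s) * (P t * phi t)); last by ring.
  by rewrite Pphi // mulr1.
lra.
Qed.

Variables (T a0 C n : R).
Hypothesis T_gt0 : 0 < T.
Hypothesis a0_gt0 : 0 < a0.
Hypothesis a0_le : a0 <= al T.
Hypothesis C_gt0 : 0 < C.
Hypothesis n_gt0 : 0 < n.
Hypothesis e_le : forall s, 0 < s -> e s <= n^-1 + C / s.
Hypothesis T_le : (1 + T) / n <= a0 / 16.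

(** Solves [c1 + 2 * (C * c1 / d) = a0 / 4] with [d = a0 / 8], the relation that closes
    [inverse_occupation_linear]. *)
Let c1 := a0 / 4 / (1 + 16 * C / a0).

Let a0_le1 : a0 <= 1. Proof. by apply: le_trans a0_le _; apply: al_le1; exact: ltW. Qed.

Let K_gt0 : 0 < 1 + 16 * C / a0.
Proof. by rewrite ltr_pwDl // divr_ge0 ?mulr_ge0 // ltW. Qed.

Let c1_gt0 : 0 < c1.
Proof. by rewrite /c1 !divr_gt0. Qed.

(* At a negative minimum u of [phi - c1 * u], compare the times [u - s] and [u]
   with [s] proportional to [phi u]: the resulting speed exceeds [c1]. *)
Lemma inverse_occupation_linear u : 0 <= u <= T -> c1 * u <= phi u.
Proof.
move=> uT; rewrite leNgt; apply/negP => Hu.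
pose g (t : R) := phi t - c1 * t.
have gD : forall t : R, 0 <= t -> is_derive t 1 g (B t * phi t ^+ 2 - c1 * 1).
  move=> t t0; apply: is_derive_sub; exact: phi'.
have [|v vT Hv] := @EVT_min R g 0 T (ltW T_gt0).
  apply: derivable_within_continuous => s; rewrite in_itv => /andP[s0 _].
  by case: (gD s s0).
have {}Hv s : 0 <= s <= T -> g v <= g s by move=> sT; apply: Hv; rewrite in_itv.
have {vT}/andP[v0 vT] : 0 <= v <= T by rewrite in_itv in vT.
have gv : g v < 0 by apply: le_lt_trans (Hv u uT) _; rewrite subr_lt0.
have vpos : 0 < v.
  rewrite lt_neqAle v0 andbT; apply/eqP => vE.
  by move: gv; rewrite -vE /g phi0 mulr0 subr0 ltNge ler01.
have := min_derive_le0 vpos vT (gD v v0) Hv; rewrite mulr1 subr_le0 => slow.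
set F := phi v in slow.
have F0 : 0 < F by exact: phi_gt0.
have Fv : F < c1 * v by rewrite -subr_lt0.
pose d := a0 / 8.
have d0 : 0 < d by rewrite divr_gt0.
have d8 : d <= 8^-1 by rewrite /d; have := a0_le1; lra.
(* Over this length, minimality of [g] at [v] lets [phi] have been smaller by at most the fraction
   [d], see [Hphi]; [F < c1 * v] makes the window fit into [[0, v]]. *)
pose s := d * F / c1.
have s0 : 0 < s by rewrite divr_gt0 // mulr_gt0.
have c1s : c1 * s = d * F by rewrite /s; field; rewrite gt_eqF.
have sv : s < v.
  rewrite -(ltr_pM2l c1_gt0) c1s; apply: le_lt_trans Fv.
  by rewrite -[leRHS]mul1r ler_pM2r //; lra.
have vs0 : 0 <= v - s by lra.
have Hphi : (1 - d) * F <= phi (v - s).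
  have := Hv (v - s); rewrite /g -/F => H.
  have {}H : F - c1 * v <= phi (v - s) - c1 * (v - s) by apply: H; apply/andP; split; lra.
  by move: H; rewrite mulrBr c1s; lra.
have d1 : 0 < 1 - d by lra.
have vE : v - s + s = v by ring.
have H1 : phi (v - s + s) <= (1 - d)^-1 * phi (v - s).
  by rewrite vE ler_pdivlMl.
have := speed_lower vs0 (ltW s0) H1; rewrite vE -/F => H2.
have rho2 : (1 - d)^-1 ^+ 2 <= 1 + 3 * d.
  rewrite exprVn -[leLHS]mul1r ler_pdivrMr ?exprn_gt0 //.
  have X : 0 <= 1 - 5 * d + 3 * d ^+ 2 by have := sqr_ge0 d; lra.
  have := mulr_ge0 (ltW d0) X; lra.
have rho1 : (1 - d)^-1 <= 2.
  by rewrite -[leRHS]invrK lef_pV2 ?posrE ?invr_gt0 //; lra.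
have als : a0 <= al s by apply: le_trans a0_le (al_anti (ltW s0) _); lra.
have al1 := al_le1 (ltW s0).
have A1 : (1 - d)^-1 ^+ 2 * (1 - al s) <= 1 - a0 + 3 * d.
  apply: (@le_trans _ _ ((1 + 3 * d) * (1 - al s))).
    by rewrite ler_wpM2r // subr_ge0.
  have := mulr_ge0 (ltW d0) (al_ge0 (ltW s0)); lra.
have A2 : e s * F <= a0 / 16 + C * c1 / d.
  apply: (@le_trans _ _ ((n^-1 + C / s) * F)); first by rewrite ler_wpM2r ?e_le // ltW.
  rewrite mulrDl; apply: lerD.
    apply: le_trans T_le; rewrite mulrC ler_pM2r ?invr_gt0 //.
    by apply: le_trans (phi_le v0) _; lra.
  by rewrite /s le_eqVlt; apply/orP; left; apply/eqP; field; rewrite !gt_eqF.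
have es0 : 0 <= e s * F by rewrite mulr_ge0 ?e_ge0 // ltW.
have A3 : e s * (1 - d)^-1 * F <= 2 * (a0 / 16 + C * c1 / d).
  rewrite mulrAC mulrC; apply: ler_pM => //; rewrite ?invr_ge0; lra.
have A4 : c1 + 2 * (C * c1 / d) = a0 / 4.
  by rewrite /c1 /d; field; rewrite !gt_eqF //; have := a0_gt0; have := C_gt0; nra.
(* The speed is at least [a0 - 3 * d - a0 / 8 - 2 * (C * c1 / d)], that is
   [a0 / 2 - 2 * (C * c1 / d)], and at most [c1], which contradicts [A4]. *)
have := a0_gt0; rewrite /d in A1; lra.
Qed.

Variable ep : R.
Hypothesis ep_gt0 : 0 < ep.
Hypothesis ep_half : ep <= 2^-1.
Hypothesis ep_c1 : 2 * ep <= c1.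

(** On [[ep * T, T]] the speed of [phi] is [al s] up to [3 * k + 2 * E]. The stretch before costs at
    most [1 + ep * T], which after division by [T] is the term [ep + T^-1]. *)
Lemma inverse_occupation_asymptotic :
  `|phi T / T - al (ep ^+ 2 * T)| <=
    ep + 6 * (ep / c1) + 2 * (e (ep ^+ 2 * T) * (1 + T)) + T^-1.
Proof.
set s := ep ^+ 2 * T; set k := 2 * (ep / c1).
have s0 : 0 < s by rewrite mulr_gt0 // exprn_gt0.
have k0 : 0 <= k by rewrite mulr_ge0 // divr_ge0 // ltW.
have k1 : k <= 1 by rewrite /k mulrA ler_pdivrMr // mul1r.
have T0 := T_gt0.
pose U := ep * T.
have U0 : 0 < U by rewrite mulr_gt0.
have sU : s <= U / 2.
  rewrite /s /U expr2 -!mulrA ler_pM2l // mulrC ler_pM2l //.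
have UT : U <= T by rewrite /U -[leRHS]mul1r ler_pM2r //; have := ep_half; lra.
set A := al s.
have A0 : 0 <= A by apply: al_ge0; exact: ltW.
have A1 : A <= 1 by apply: al_le1; exact: ltW.
set E := e s * (1 + T).
have es0 : 0 <= e s by apply: e_ge0; exact: ltW.
have E0 : 0 <= E by rewrite mulr_ge0 //; lra.
(* Speed at most 1 bounds the increment of [phi] by [s = k * (c1 * (U / 2))]; by the linear bound
   and [u - s >= U / 2] this is at most [k * phi (u - s)]. *)
have ratio u : U <= u <= T -> phi u <= (1 + k) * phi (u - s).
  move=> /andP[Uu uT].
  have us0 : 0 <= u - s by lra.
  have us : u - s <= u by lra.
  have /andP[_] := phi_slope us0 us; rewrite (_ : u - (u - s) = s); last by ring.
  move=> H; apply: le_trans H _; rewrite mulrDl mul1r lerD2l.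
  have H1 : c1 * (u - s) <= phi (u - s) by apply: inverse_occupation_linear; lra.
  apply: (@le_trans _ _ (k * (c1 * (U / 2)))).
    rewrite (_ : k * (c1 * (U / 2)) = s) // /k /U /s; field; by rewrite gt_eqF.
  apply: ler_wpM2l => //; apply: le_trans H1; rewrite ler_pM2l //; lra.
have up u : U <= u <= T -> B u * phi u ^+ 2 <= A * (1 + k) ^+ 2.
  move=> uI; have /andP[Uu uT] := uI; have us0 : 0 <= u - s by lra.
  have := speed_upper us0 (ltW s0) (rho := 1 + k).
  by rewrite subrK => H; apply: H; exact: ratio.
have lo u : U <= u <= T -> A - 3 * k - 2 * E <= B u * phi u ^+ 2.
  move=> uI; have /andP[Uu uT] := uI; have us0 : 0 <= u - s by lra.
  have := speed_lower us0 (ltW s0) (rho := 1 + k).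
  rewrite subrK => H; apply: le_trans (H (ratio u uI)).
  have u0 : 0 <= u by lra.
  have H1 : e s * (1 + k) * phi u <= 2 * E.
    rewrite /E mulrA [2 * _]mulrC; apply: ler_pM.
    - by rewrite mulr_ge0 //; lra.
    - by rewrite ltW // phi_gt0.
    - by apply: ler_wpM2l => //; lra.
    - by apply: le_trans (phi_le u0) _; lra.
  have H2 : (1 + k) ^+ 2 * (1 - A) <= 1 - A + 3 * k.
    have : (1 + k) ^+ 2 - 1 <= 3 * k by nra.
    have : 0 <= (1 + k) ^+ 2 - 1 by nra.
    set X := (1 + k) ^+ 2 - 1 => X0 X3; rewrite (_ : (1 + k) ^+ 2 = 1 + X); last by rewrite /X; ring.
    have : 0 <= X * A by rewrite mulr_ge0.
    lra.
  by rewrite -/A; lra.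
have D u : U <= u <= T -> is_derive u 1 phi (B u * phi u ^+ 2).
  by move=> /andP[Uu _]; apply: phi'; lra.
have I1 := derive_ge UT D lo; have I2 := derive_le UT D up.
have pU0 := phi_gt0 (ltW U0).
have pU1 := phi_le (ltW U0).
have kE : 6 * (ep / c1) = 3 * k by rewrite /k; ring.
have k2 : A * (1 + k) ^+ 2 <= A + 3 * k.
  have : (1 + k) ^+ 2 - 1 <= 3 * k by nra.
  have : 0 <= (1 + k) ^+ 2 - 1 by nra.
  set X := (1 + k) ^+ 2 - 1 => X0 X3; rewrite (_ : (1 + k) ^+ 2 = 1 + X); last by rewrite /X; ring.
  have : 0 <= X * (1 - A) by rewrite mulr_ge0 // subr_ge0.
  lra.
have TU : 0 <= T - U by lra.
rewrite kE ler_norml; apply/andP; split.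
  rewrite lerBrDr ler_pdivlMr //.
  have J1 : (3 * k + 2 * E) * (T - U) <= (3 * k + 2 * E) * T.
    by apply: ler_wpM2l; lra.
  have J2 : A * U <= U by rewrite -[leRHS]mul1r ler_wpM2r // ltW.
  have J3 : T^-1 * T = 1 by rewrite mulVf // gt_eqF.
  have J4 : ep * T = U by [].
  lra.
rewrite lerBlDr ler_pdivrMr //.
have J1 : A * (1 + k) ^+ 2 * (T - U) <= (A + 3 * k) * T.
  apply: le_trans (ler_wpM2r TU k2) _; apply: ler_wpM2l; lra.
have J3 : T^-1 * T = 1 by rewrite mulVf // gt_eqF.
have J4 : ep * T = U by [].
have J5 : 0 <= E * T by rewrite mulr_ge0 // ltW.
lra.
Qed.

End Riccati.

(** * Quantitative mean-field bound for a single chain *)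

Section Chain.
Variables (R : realType) (T : finType) (r : T -> T -> R).
Hypothesis sym_r : sym_rates r.
Hypothesis trans_r : transitive_chain r.
Hypothesis irr_r : irreducible r.
Hypothesis T_gt1 : (1 < #|T|)%N.

Let n : R := #|T|%:R.
Let n_gt0 : 0 < n. Proof. by rewrite ltr0n (ltn_trans _ T_gt1). Qed.
Let r_ge0 x y : 0 <= r x y. Proof. by case: sym_r. Qed.
Let rate1 x : rate r x = 1. Proof. by case: trans_r. Qed.

Lemma alphaE x s : alpha r x s = \sum_y r x y * survival r s (x, y).
Proof.
by rewrite /alpha rate1 mul1r; apply: eq_bigr => y _; rewrite divr1.
Qed.

Lemma alpha_const x y s : alpha r x s = alpha r y s.
Proof.
have [phi [bphi [<- Hr]]] := trans_r.1 x y; have iphi := bij_inj bphi.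
pose phi2 (p : T * T) := (phi p.1, phi p.2).
have b2 : bijective phi2.
  have [psi phiK psiK] := bphi; exists (fun p => (psi p.1, psi p.2)) => -[u v].
    by rewrite /phi2 /= !phiK.
  by rewrite /phi2 /= !psiK.
have pair_map p q : pair_rate r (phi2 p) (phi2 q) = pair_rate r p q.
  by rewrite /pair_rate /phi2 /= !(inj_eq iphi) !Hr.
rewrite !alphaE [RHS](reindex phi) /=; last exact: onW_bij.
apply: eq_bigr => z _; rewrite Hr; congr (_ * _).
rewrite !survivalE [RHS](reindex phi2) /=; last exact: onW_bij.
apply: eq_bigr => q _; rewrite /offd /phi2 /= (inj_eq iphi); congr (_ * _).
rewrite -[RHS]/(kexp (generator (pair_rate r)) s (phi2 (x, z)) (phi2 q)).
by rewrite (kexp_map _ _ _ b2) // => p p'; exact: generator_map.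
Qed.

Lemma collisionE x s : collision r s / n = alpha r x s.
Proof.
have -> : collision r s = n * alpha r x s.
  rewrite /n -sumr_const mulr_suml /collision.
  transitivity (\sum_y \sum_z r y z * survival r s (y, z)).
    by rewrite [RHS]pair_bigA; apply: eq_bigr => -[].
  by apply: eq_bigr => y _; rewrite mul1r -alphaE; exact: alpha_const.
by rewrite mulrC mulKf // gt_eqF.
Qed.

Lemma tmeet_gt0 : 0 < tmeet r.
Proof.
have [h [h0 hd ho]] := meeting_time_exists sym_r irr_r T_gt1.
by rewrite (tmeetE sym_r T_gt1 h0 hd ho); exact: (mean_meeting_time_gt0 T_gt1 h0 ho).
Qed.

Lemma alpha_estimate x s : 2 * trel r <= s ->
  `|2 * (tmeet r / n) * alpha r x s - 1| <= 12 * (s / tmeet r) + 8 * (trel r / s).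
Proof.
move=> H; have [h [h0 hd ho]] := meeting_time_exists sym_r irr_r T_gt1.
have := tmeet_density sym_r irr_r T_gt1 h0 hd ho H.
rewrite -(collisionE x) -/n.
rewrite (_ : tmeet r * (2 * collision r s / n ^+ 2) = 2 * (tmeet r / n) * (collision r s / n)) //.
by field; rewrite gt_eqF.
Qed.

Lemma alpha_ge0 x s : 0 <= s -> 0 <= alpha r x s.
Proof.
by move=> s0; rewrite -(collisionE x) divr_ge0 ?(ltW n_gt0) // collision_ge0.
Qed.

Lemma alpha_le1 x s : 0 <= s -> alpha r x s <= 1.
Proof.
move=> s0; rewrite alphaE -(rate1 x) /rate; apply: ler_sum => y _.
by rewrite -[leRHS]mulr1 ler_wpM2l // survival_le1.
Qed.

Lemma alpha_anti x s t : 0 <= s -> s <= t -> alpha r x t <= alpha r x s.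
Proof.
by move=> s0 st; rewrite -!(collisionE x) ler_pM2r ?invr_gt0 // collision_anti.
Qed.

(** [u] and [v] are the two small parameters, and [a0] is the lower bound on [alpha] at time [t]
    that [tmeet r <= C * n] provides. The error is arranged so that [ep] makes its first part small
    and then, for this [ep], small [u + v] handles the rest. *)
Lemma mean_field_bound (C ep t : R) x :
  let a0 := (4 * C)^-1 in let c1 := a0 / 4 / (1 + 16 * C / a0) in
  let u := trel r / t in let v := t / tmeet r in
  1 <= C -> tmeet r <= C * n -> 0 < ep -> ep <= 2^-1 -> 2 * ep <= c1 ->
  0 < t -> u <= ep ^+ 2 / 2 -> 12 * v + 8 * u <= 2^-1 -> v <= a0 / (32 * C) ->
  `|2 * (tmeet r / n) * ((Pocc r x t)^-1 / t) - 1| <=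
    2 * C * (1 + 6 / c1) * ep +
    (8 * C ^+ 2 + 32 * C ^+ 2 / ep ^+ 4 + 4 * C + 12 + 8 / ep ^+ 2) * (u + v).
Proof.
move=> a0 c1 u v C1 tC ep0 ep2 epc t0 u1 uv1 v1.
have C0 : 0 < C by exact: lt_le_trans C1.
have tm0 := tmeet_gt0.
have k0 : 0 < trel r by exact: trel_gt0.
have k2 : 2^-1 <= trel r by exact: trel_ge_half.
set tau := tmeet r / n.
have tau0 : 0 < tau by rewrite divr_gt0.
have tauC : tau <= C by rewrite ler_pdivrMr.
have a00 : 0 < a0 by rewrite invr_gt0 mulr_gt0.
have u0 : 0 < u by rewrite divr_gt0.
have v0 : 0 < v by rewrite divr_gt0.
have kE : trel r = u * t by rewrite /u divfK // gt_eqF.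
have epsq : ep ^+ 2 <= 4^-1.
  have : 0 <= (2^-1 - ep) * (2^-1 + ep) by apply: mulr_ge0; lra.
  lra.
have t1 : 1 <= t.
  have : u * t <= 2^-1 * t by rewrite ler_pM2r //; lra.
  lra.
have tinv : t^-1 <= 2 * u.
  rewrite -[leLHS]mul1r ler_pdivrMr // -mulrA -kE; lra.
have tn : t / n <= C * v.
  have -> : t / n = tau * v by rewrite /tau /v; field; rewrite !gt_eqF.
  by rewrite ler_pM2r.
have Tn : (1 + t) / n <= a0 / 16.
  apply: (@le_trans _ _ (2 * (t / n))).
    by rewrite mulrA ler_pM2r ?invr_gt0 //; lra.
  apply: (@le_trans _ _ (2 * (C * (a0 / (32 * C))))).
    by rewrite ler_pM2l //; apply: le_trans tn _; rewrite ler_pM2l.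
  by rewrite le_eqVlt; apply/orP; left; apply/eqP; field; rewrite gt_eqF.
have aT : a0 <= alpha r x t.
  have : 2 * trel r <= t by rewrite kE mulrA -[leRHS]mul1r ler_pM2r //; lra.
  move=> /(alpha_estimate x); rewrite -/tau -/u -/v => H.
  have {}H : 2^-1 <= 2 * tau * alpha r x t.
    by move: (le_trans H uv1); rewrite ler_norml => /andP[H1 _]; lra.
  rewrite -(ler_pM2l tau0) -(ler_pM2l (ltr0n R 2)).
  apply: le_trans (_ : 2^-1 <= _); last by rewrite mulrA.
  have : tau * a0 <= 4^-1.
    by rewrite /a0 ler_pdivrMr ?mulr_gt0 //; lra.
  lra.
have [h [h0 hd ho]] := meeting_time_exists sym_r irr_r T_gt1.
have he s (s0 : 0 < s) := heat_diag_bound sym_r irr_r T_gt1 trans_r h0 hd ho s0.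
have hdiag s : 0 <= s -> 0 <= heat_diag r s.
  by move=> s0; rewrite -(heat_diagE T_gt1 trans_r s x); exact: heat_ge0.
have eb s : 0 < s -> heat_diag r s <= n^-1 + C / s.
  move=> s0; have [H _] := he s s0.
  have : tau / s <= C / s by rewrite ler_pM2r ?invr_gt0.
  by rewrite -/n -/tau in H; lra.
pose P s := Pocc r x s.
pose B s := merge_rate r s x.
have P1 : P 0 = 1 by exact: Pocc_start.
have PD : forall s : R, is_derive s 1 P (- B s) by move=> s; exact: is_derive_Pocc.
have B0 s : 0 <= s -> 0 <= B s by exact: merge_rate_ge0.
have BP s : 0 <= s -> B s <= P s by exact: merge_rate_le_P.
have BP2 s : 0 <= s -> B s <= P s ^+ 2 by exact: merge_rate_le.
have mu (s s' : R) : 0 <= s -> 0 <= s' -> B (s + s') <= alpha r x s' * P s ^+ 2.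
  by move=> ? ?; rewrite -(collisionE x); exact: merge_rate_upper.
have ml (s s' : R) : 0 <= s -> 0 <= s' ->
    P (s + s') ^+ 2 - P s ^+ 2 * (1 - alpha r x s') - heat_diag r s' * P s <= B (s + s').
  by move=> ? ?; rewrite -(collisionE x); exact: merge_rate_lower.
have := inverse_occupation_asymptotic P1 PD B0 BP BP2 (@alpha_ge0 x) (@alpha_le1 x)
  (@alpha_anti x) hdiag mu ml t0 a00 aT C0 n_gt0 eb Tn ep0 ep2 epc.
rewrite -/c1; set s := ep ^+ 2 * t; set A := alpha r x s => main.
have s0 : 0 < s by rewrite mulr_gt0 // exprn_gt0.
(* The part [n^-1] of the return probability costs [t / n], of order [v]; the excess is bounded by
   its decay of order [trel r / s ^+ 2]. *)
have eT : heat_diag r s * (1 + t) <= 2 * C * v + 8 * C * u / ep ^+ 4.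
  have [_ H] := he s s0; rewrite -/n -/tau in H.
  have H1 : heat_diag r s * (1 + t) <= (n^-1 + 4 * trel r * tau / s ^+ 2) * (2 * t).
    by apply: ler_pM; [exact/hdiag/ltW | lra | lra | lra].
  apply: le_trans H1 _; rewrite mulrDl; apply: lerD.
    by rewrite mulrCA -mulrA [n^-1 * _]mulrC ler_pM2l.
  have -> : 4 * trel r * tau / s ^+ 2 * (2 * t) = 8 * tau * u / ep ^+ 4.
    by rewrite /s kE; field; rewrite !gt_eqF.
  by rewrite ler_pM2r ?invr_gt0 ?exprn_gt0 // ler_pM2r // ler_pM2l.
have al : `|2 * tau * A - 1| <= 12 * (ep ^+ 2 * v) + 8 * (u / ep ^+ 2).
  have : 2 * trel r <= s.
    by rewrite /s kE mulrA ler_pM2r //; lra.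
  move=> /(alpha_estimate x); rewrite -/tau -/A.
  have -> : s / tmeet r = ep ^+ 2 * v by rewrite /s /v mulrA.
  by have -> : trel r / s = u / ep ^+ 2 by rewrite /s kE; field; rewrite !gt_eqF.
have -> : 2 * tau * ((Pocc r x t)^-1 / t) - 1 =
    2 * tau * ((Pocc r x t)^-1 / t - A) + (2 * tau * A - 1) by ring.
apply: le_trans (ler_normD _ _) _.
have c10 : 0 < c1.
  by rewrite !divr_gt0 // ltr_pwDl // divr_ge0 ?mulr_ge0 // ltW.
have m1 : `|2 * tau * ((Pocc r x t)^-1 / t - A)| <= 2 * C *
    (ep + 6 * (ep / c1) + 2 * (2 * C * v + 8 * C * u / ep ^+ 4) + 2 * u).
  rewrite normrM ger0_norm; last by rewrite mulr_ge0 // ltW.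
  apply: ler_pM => //; first by rewrite mulr_ge0 // ltW.
    by rewrite ler_pM2l.
  by apply: le_trans main _; lra.
apply: le_trans (lerD m1 al) _.
have e4 : 0 < (ep ^+ 4)^-1 by rewrite invr_gt0 exprn_gt0.
have e2 : 0 < (ep ^+ 2)^-1 by rewrite invr_gt0 exprn_gt0.
have X1 : 0 <= C ^+ 2 * u by rewrite mulr_ge0 ?sqr_ge0 // ltW.
have X2 : 0 <= C ^+ 2 * (ep ^+ 4)^-1 * v by exact: mulr_ge0 (mulr_ge0 (sqr_ge0 _) (ltW e4)) (ltW v0).
have X3 : 0 <= C * v by rewrite mulr_ge0 // ltW.
have X4 : 0 <= (ep ^+ 2)^-1 * v by rewrite mulr_ge0 // ltW.
have X5 : ep ^+ 2 * v <= v by rewrite -[leRHS]mul1r ler_pM2r //; lra.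
rewrite (_ : 6 * (ep / c1) = 6 / c1 * ep); last by ring.
lra.
Qed.

End Chain.

Theorem theorem1p9 (R : realType) (V : nat -> finType)
  (r : forall n, V n -> V n -> R) (x : forall n, V n) (t : nat -> R) :
  (forall n, sym_rates (r n)) ->
  (forall n, irreducible (r n)) ->
  (forall n, transitive_chain (r n)) ->
  ((fun n => (#|V n|)%:R : R) @ \oo --> +oo) ->
  (exists C : R, forall n, tmeet (r n) <= C * (#|V n|)%:R) ->
  ((fun n => trel (r n) / tmeet (r n)) @ \oo --> (0 : R)) ->
  (forall n, 0 <= t n) ->
  (\forall n \near \oo, 0 < t n) ->
  ((fun n => trel (r n) / t n) @ \oo --> (0 : R)) ->
  ((fun n => t n / tmeet (r n)) @ \oo --> (0 : R)) ->
  ((fun n => (#|V n|)%:R * t n / (2 * tmeet (r n)) * Pocc (r n) (x n) (t n))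
      @ \oo --> (1 : R)) /\
  ((fun n => t n * alpha (r n) (x n) (t n) * Pocc (r n) (x n) (t n))
      @ \oo --> (1 : R)).
Proof.
move=> sym irr trans Vn [C0 HC0] _ _ tpos ulim vlim.
pose C := Num.max C0 1.
have C1 : 1 <= C by rewrite le_max lexx orbT.
have HC n : tmeet (r n) <= C * (#|V n|)%:R.
  by apply: le_trans (HC0 n) _; rewrite ler_wpM2r // le_max lexx.
have near_gt1 : \forall n \near \oo, (1 < #|V n|)%N.
  have /cvgryPgt/(_ 1) := Vn.
  by apply: filterS => n; rewrite ltr1n.
have near_le (f : nat -> R) (e : R) : 0 < e -> f @ \oo --> 0 -> \forall n \near \oo, f n <= e.
  by move=> e0 /cvgrPdist_le/(_ e e0); apply: filterS => n; rewrite sub0r normrN => /(le_trans (ler_norm _)).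
pose a0 : R := (4 * C)^-1; pose c1 : R := a0 / 4 / (1 + 16 * C / a0).
have C_gt0 : 0 < C by exact: lt_le_trans C1.
have a00 : 0 < a0 by rewrite invr_gt0 mulr_gt0.
have c10 : 0 < c1.
  by rewrite !divr_gt0 // ltr_pwDl // divr_ge0 ?mulr_ge0 // ltW.
have phi_lim : (fun n => 2 * (tmeet (r n) / (#|V n|)%:R) * ((Pocc (r n) (x n) (t n))^-1 / t n)) @ \oo --> (1 : R).
  apply/cvgrPdist_le => /= d d0.
  pose M := 2 * C * (1 + 6 / c1).
  have M0 : 0 < M by rewrite mulr_gt0 ?mulr_gt0 // ltr_pwDl // divr_ge0 // ltW.
  (* Small enough that [M * ep <= d / 2]; with [ep] fixed, [K] is a constant and
     [K * (u + v) <= d / 2] eventually. *)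
  pose ep := Num.min (Num.min 2^-1 (c1 / 2)) (d / (2 * M)).
  have ep0 : 0 < ep.
    have e1 : 0 < c1 / 2 by rewrite divr_gt0.
    have e2 : 0 < d / (2 * M) by rewrite divr_gt0 // mulr_gt0.
    have e3 : (0 : R) < 2^-1 by rewrite invr_gt0.
    by rewrite !lt_min e1 e2 e3.
  have ep2 : ep <= 2^-1 by rewrite !ge_min lexx.
  have epc : 2 * ep <= c1.
    have : ep <= c1 / 2 by rewrite !ge_min lexx orbT.
    by move=> H; lra.
  have epM : M * ep <= d / 2.
    have : ep <= d / (2 * M) by rewrite !ge_min lexx !orbT.
    rewrite -(ler_pM2l M0) => H; apply: le_trans H _.
    by rewrite le_eqVlt; apply/orP; left; apply/eqP; field; rewrite gt_eqF.
  pose K := 8 * C ^+ 2 + 32 * C ^+ 2 / ep ^+ 4 + 4 * C + 12 + 8 / ep ^+ 2.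
  have K0 : 0 < K.
    rewrite /K; apply: ltr_wpDr; first by rewrite divr_ge0 ?exprn_ge0 // ltW.
    apply: ltr_wpDl => //; rewrite !addr_ge0 ?mulr_ge0 ?exprn_ge0 ?invr_ge0 ?exprn_ge0 ?(ltW C_gt0) ?(ltW ep0) //.
  have small u v : u <= 32^-1 -> v <= 48^-1 -> 12 * v + 8 * u <= 2^-1 :> R.
    by clear => *; lra.
  have total u v : u <= d / (4 * K) -> v <= d / (4 * K) -> M * ep + K * (u + v) <= d.
    move=> Hu Hv; have dE : d = d / 2 + d / 2 by clear; field.
    rewrite [leRHS]dE; apply: lerD => //.
    have -> : d / 2 = K * (d / (4 * K) + d / (4 * K)) by clear -K0; field; rewrite gt_eqF.
    by rewrite ler_pM2l // lerD.
  near=> n.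
  have gt1 : (1 < #|V n|)%N by near: n.
  have tn0 : 0 < t n by near: n.
  have u1 : trel (r n) / t n <= ep ^+ 2 / 2 by near: n; apply: near_le ulim; rewrite divr_gt0 ?exprn_gt0.
  have u2 : trel (r n) / t n <= 32^-1 by near: n; apply: near_le ulim.
  have u3 : trel (r n) / t n <= d / (4 * K) by near: n; apply: near_le ulim; rewrite divr_gt0 ?mulr_gt0.
  have v1 : t n / tmeet (r n) <= a0 / (32 * C) by near: n; apply: near_le vlim; rewrite divr_gt0 ?mulr_gt0.
  have v2 : t n / tmeet (r n) <= 48^-1 by near: n; apply: near_le vlim.
  have v3 : t n / tmeet (r n) <= d / (4 * K) by near: n; apply: near_le vlim; rewrite divr_gt0 ?mulr_gt0.
  rewrite distrC.
  have uv := small _ _ u2 v2.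
  apply: le_trans (mean_field_bound (sym n) (trans n) (irr n) gt1 (x n) C1 (HC n) ep0 ep2 epc tn0 u1 uv v1) _.
  exact: total.
have lim1 : (fun n => (#|V n|)%:R * t n / (2 * tmeet (r n)) * Pocc (r n) (x n) (t n)) @ \oo --> (1 : R).
  (* The sequence of the first limit is the inverse of the one in [phi_lim]. *)
  have := cvgV (oner_neq0 R) phi_lim; rewrite invr1.
  move=> H; refine (cvg_trans _ (H _)); apply: near_eq_cvg; near=> n.
  by rewrite /= !invfM !invrK; ring.
split => //.
have alpha_lim : (fun n => 2 * (tmeet (r n) / (#|V n|)%:R) * alpha (r n) (x n) (t n)) @ \oo --> (1 : R).
  apply/cvgrPdist_le => /= d d0.
  have le2 a b : 0 < b -> a / b <= 2^-1 -> 2 * a <= b :> R.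
    by clear => b0; rewrite ler_pdivrMr // => *; lra.
  have total u v : u <= d / 16 -> v <= d / 24 -> 12 * v + 8 * u <= d.
    by clear => *; lra.
  near=> n.
  have gt1 : (1 < #|V n|)%N by near: n.
  have tn0 : 0 < t n by near: n.
  have u1 : trel (r n) / t n <= 2^-1 by near: n; apply: near_le ulim.
  have u2 : trel (r n) / t n <= d / 16 by near: n; apply: near_le ulim; rewrite divr_gt0.
  have v1 : t n / tmeet (r n) <= d / 24 by near: n; apply: near_le vlim; rewrite divr_gt0.
  rewrite distrC.
  apply: le_trans (alpha_estimate (sym n) (trans n) (irr n) gt1 (x n) (le2 _ _ tn0 u1)) _.
  exact: total.
(* In the product of the two sequences the factors [tmeet] and [#|V n|] cancel as soon as they are
   nonzero, which holds eventually. *)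
have := cvgM lim1 alpha_lim; rewrite mulr1.
move=> H; refine (cvg_trans _ (H _)); apply: near_eq_cvg; near=> n.
have gt1 : (1 < #|V n|)%N by near: n.
have tm := tmeet_gt0 (sym n) (irr n) gt1.
have n0 : (0 : R) < (#|V n|)%:R by rewrite ltr0n (ltn_trans _ gt1).
by rewrite /=; field; rewrite !gt_eqF.
Unshelve. all: by end_near. Qed.
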